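(* Let $\mathbb{K}$ be an algebraically closed field of characteristic $0$. Let $f\in\mathbb{K}[X]$, $\gamma\in\mathbb{K}$ and $r,s\in\mathbb{K}^*$, and let $L=L(f,r,s,\gamma)$ be the corresponding generalized down-up algebra. Assume that $r$ is not a root of unity and that $f(X)=sg(X)-g(rX-\gamma)$ for some $g\in\mathbb{K}[X]$. Let $\tau$ be the nonnegative integer attached to $(r,s)$ in the context. Then the group $\mathrm{Aut}_{\mathbb{K}}(L)$ of $\mathbb{K}$-algebra automorphisms of $L$ is isomorphic to: (a) $(\mathbb{K}^* )^3\rtimes\mathbb{Z}/3\mathbb{Z}$ if $f=0$ and $s=r^{-1}$, where the generator $1+3\mathbb{Z}$ of $\mathbb{Z}/3\mathbb{Z}$ acts on $(\mathbb{K}^* )^3$ via the automorphism $(\lambda_1,\lambda_2,\lambda_3)\mapsto(\lambda_3,\lambda_1,\lambda_2)$; (b) $\mathbb{K}\rtimes(\mathbb{K}^* )^3$ if $f=0$ and $s^\tau=r$, where $(\lambda_1,\lambda_2,\lambda_3)\in(\mathbb{K}^* )^3$ acts on the additive group $\mathbb{K}$ via the automorphism $t\mapsto\lambda_1^{-1}(\lambda_2\lambda_3)^\tau t$; (c) $\mathbb{K}\rtimes(\mathbb{K}^* )^2$ if $\deg(f)=0$ and $s^\tau=r$, where $(\lambda_1,\lambda_2)\in(\mathbb{K}^* )^2$ acts on the additive group $\mathbb{K}$ via the automorphism $t\mapsto\lambda_1^{-1}t$; (d) $(\mathbb{K}^* )^2\rtimes\mathbb{Z}/2\mathbb{Z}$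 if $\deg(f)=1$, $s=r^{-1}$ and $f\left(\frac{\gamma}{r-1}\right)=0$, where the generator $1+2\mathbb{Z}$ of $\mathbb{Z}/2\mathbb{Z}$ acts on $(\mathbb{K}^* )^2$ via the automorphism $(\lambda_1,\lambda_2)\mapsto(\lambda_1,\lambda_2^{-1}\lambda_1)$; (e) $\mathbb{K}^*\rtimes\mathbb{Z}/2\mathbb{Z}$ if $\deg(f)=1$, $s=r^{-1}$ and $f\left(\frac{\gamma}{r-1}\right)\neq0$, where the generator $1+2\mathbb{Z}$ of $\mathbb{Z}/2\mathbb{Z}$ acts on $\mathbb{K}^*$ via the automorphism $\lambda\mapsto\lambda^{-1}$; (f) $\mathcal{H}$ otherwise, where $\mathcal{H}$ is the group defined in the context from the polynomial $\tilde f(X)=f\left(\frac{1}{r-1}(X+\gamma)\right)$.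
   Context: $\mathbb{K}^*$ is the multiplicative group of nonzero elements of $\mathbb{K}$. The generalized down-up algebra $L(f,r,s,\gamma)$ is the unital associative $\mathbb{K}$-algebra generated by $d,u,h$ subject to the relations $dh-rhd+\gamma d=0$, $hu-ruh+\gamma u=0$, $du-sud+f(h)=0$. The zero polynomial has degree $-\infty$, so $\deg(f)=0$ means $f$ is a nonzero constant. Definition of $\tau$ (with $r$ not a root of unity): if $\{i>0\mid s^i=r^j\text{ for some }j\in\mathbb{Z}\}$ is nonempty, $\tau$ is its minimum; otherwise $\tau=0$. Definition of $\rho$: for a nonzero polynomial $p=\sum a_iX^i\in\mathbb{K}[X]$ let $\mathrm{supp}(p)=\{i\mid a_i\ne0\}$; then $\rho=\gcd\{\deg(p)-i\mid i\in\mathrm{supp}(p)\}$ if $\{\deg(p)-i\mid i\in\mathrm{supp}(p)\}\neq\{0\}$, and $\rho=0$ otherwise. Here $\rho$ is computed for $p=\tilde f$ when $\tilde f\neq0$. The group $\mathcal{H}$: let $\tilde L=L(\tilde f,r,s,0)$ with canonical generators $d,u,h$. Then $\mathcal{H}$ is the group of all $\mathbb{K}$-algebra automorphisms $\phi$ of $\tilde L$ such that $\phi(h)=\lambda h$ for some $\lambda\in\mathbb{K}^*$. It is described as follows. If $\tilde f=0$, $\mathcal{H}$ consists of the automorphisms $h\mapsto\alpha h$, $d\mapsto\beta d$, $u\mapsto\delta u$ with $(\alpha,\beta,\delta)\in(\mathbb{K}^* )^3$, so $\mathcal{H}\simeq(\mathbb{K}^* )^3$. If $\tilde f\ne0$,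 $\mathcal{H}$ consists of the automorphisms $h\mapsto\alpha h$, $d\mapsto\beta d$, $u\mapsto\beta^{-1}\alpha^{\deg(\tilde f)}u$ with $(\alpha,\beta)\in(\mathbb{K}^* )^2$ and $\alpha^\rho=1$, so $\mathcal{H}\simeq(\mathbb{K}^* )^2$ if $\rho=0$ and $\mathcal{H}\simeq\mathbb{Z}/\rho\mathbb{Z}\times\mathbb{K}^*$ if $\rho>0$. In $N\rtimes Q$, the group $Q$ acts on the normal subgroup $N$. *)

(* Defs.v *)
From HB Require Import structures.
From mathcomp Require Import all_boot all_order all_algebra.
From mathcomp Require Import boolp finmap ring monalg.

Set Implicit Arguments.
Unset Strict Implicit.
Unset Printing Implicit Defensive.

Import GRing.Theory.
Local Open Scope ring_scope.
Local Open Scope quotient_scope.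

(** * Groups *)

Definition group_isomorphic (G H : groupType) : Prop :=
  exists phi : {multiplicative G -> H}, bijective phi.

Record group_action (Q N : groupType) := GroupAction {
  gact :> Q -> N -> N;
  gact1 : forall n, gact 1%g n = n;
  gactM : forall p q n, gact (p * q)%g n = gact p (gact q n);
  gact_morph : forall q, {morph gact q : m n / (m * n)%g}
}.

(* N x| Q, with Q acting on the normal subgroup N. *)
Definition semidirect (Q N : groupType) (a : group_action Q N) : Type :=
  (N * Q)%type.

Section Semidirect.
Variables (Q N : groupType) (a : group_action Q N).
Local Notation S := (semidirect a).
Local Open Scope group_scope.

HB.instance Definition _ := Choice.on S.

Definition sd_one : S := (1, 1).
Definition sd_mul (x y : S) : S := (x.1 * a x.2 y.1, x.2 * y.2).
Definition sd_inv (x : S) : S := (a x.2^-1 x.1^-1, x.2^-1).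

Lemma gact_1r q : a q 1 = 1.
Proof. by apply: (mulgI (a q 1)); rewrite -gact_morph !mulg1. Qed.

Lemma sd_mulA : associative sd_mul.
Proof. by move=> x y z; rewrite /sd_mul /= gact_morph gactM !mulgA. Qed.

Lemma sd_mul1 : left_id sd_one sd_mul.
Proof. by case=> n q; rewrite /sd_mul /= gact1 !mul1g. Qed.

Lemma sd_1mul : right_id sd_one sd_mul.
Proof. by case=> n q; rewrite /sd_mul /= gact_1r !mulg1. Qed.

Lemma sd_mulV : left_inverse sd_one sd_inv sd_mul.
Proof. by case=> n q; rewrite /sd_mul /= -gact_morph !mulVg gact_1r. Qed.

Lemma sd_Vmul : right_inverse sd_one sd_inv sd_mul.
Proof.
by case=> n q; rewrite /sd_mul /= -gactM mulgV gact1 mulgV.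
Qed.

HB.instance Definition _ :=
  isGroup.Build S sd_mulA sd_mul1 sd_1mul sd_mulV sd_Vmul.
End Semidirect.

(* The additive group of K as a multiplicative [groupType]. *)
Definition additive_group (K : fieldType) : Type := K.

Section AdditiveGroup.
Variable K : fieldType.
HB.instance Definition _ := Choice.on (additive_group K).
HB.instance Definition _ := @isGroup.Build (additive_group K)
  (0 : K) (@GRing.opp K) (@GRing.add K)
  (@addrA K) (@add0r K) (@addr0 K) (@addNr K) (@addrN K).
End AdditiveGroup.

Record unit_group (K : fieldType) := UnitGroup {
  uval :> K;
  uval_neq0 : uval != 0
}.

Section UnitGroup.
Variable K : fieldType.
Local Notation Ks := (unit_group K).
HB.instance Definition _ := [isSub for @uval K].
HB.instance Definition _ := [Choice of Ks by <:].

Definition ug_one : Ks := UnitGroup (oner_neq0 K).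
Definition ug_mul (x y : Ks) : Ks :=
  UnitGroup (mulf_neq0 (uval_neq0 x) (uval_neq0 y)).
Lemma ug_inv_subproof (x : Ks) : (uval x)^-1 != 0.
Proof. by rewrite invr_eq0 uval_neq0. Qed.
Definition ug_inv (x : Ks) : Ks := UnitGroup (ug_inv_subproof x).

Lemma ug_mulA : associative ug_mul.
Proof. by move=> x y z; apply: val_inj; rewrite /= mulrA. Qed.
Lemma ug_mulC : commutative ug_mul.
Proof. by move=> x y; apply: val_inj; rewrite /= mulrC. Qed.
Lemma ug_mul1 : left_id ug_one ug_mul.
Proof. by move=> x; apply: val_inj; rewrite /= mul1r. Qed.
Lemma ug_1mul : right_id ug_one ug_mul.
Proof. by move=> x; rewrite ug_mulC ug_mul1. Qed.
Lemma ug_mulV : left_inverse ug_one ug_inv ug_mul.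
Proof. by move=> x; apply: val_inj; rewrite /= mulVf // uval_neq0. Qed.
Lemma ug_Vmul : right_inverse ug_one ug_inv ug_mul.
Proof. by move=> x; rewrite ug_mulC ug_mulV. Qed.

HB.instance Definition _ :=
  isGroup.Build Ks ug_mulA ug_mul1 ug_1mul ug_mulV ug_Vmul.
End UnitGroup.

(* The action of Z/n on N where the generator 1 acts by sigma. *)
Section CyclicAction.
Variables (n : nat) (N : groupType) (sigma : N -> N).
Hypotheses (n_gt1 : (1 < n)%N) (sigmaM : {morph sigma : x y / (x * y)%g}).
Hypothesis sigma_n : forall x, iter n sigma x = x.

Let cact (k : 'Z_n) (x : N) := iter k sigma x.

Lemma cyclic_act1 x : cact 1%g x = x. Proof. by []. Qed.

Lemma cyclic_actM p q x : cact (p * q)%g x = cact p (cact q x).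
Proof.
rewrite /cact -iterD.
have -> : (p * q)%g = ((p + q) %% n)%N :> nat by congr modn; apply: Zp_cast.
have itn m y : iter (m * n) sigma y = y.
  by elim: m => // m IHm; rewrite mulSn iterD IHm sigma_n.
by rewrite [in RHS](divn_eq (p + q)%N n) addnC iterD itn.
Qed.

Lemma cyclic_act_morph q : {morph cact q : x y / (x * y)%g}.
Proof. by move=> x y; rewrite /cact; elim: (q : nat) => //= m ->. Qed.

Definition cyclic_action : group_action 'Z_n N :=
  GroupAction cyclic_act1 cyclic_actM cyclic_act_morph.
End CyclicAction.

(** * Generalized down-up algebras *)

Section FreeAlgebra.
Variables (R : comNzRingType) (M : monomType).
Implicit Types (c x : R) (m : M) (a b : {malg R[M]}).

Lemma malg_scaleU c x m : c *: mkmalgU m x = mkmalgU m (c * x).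
Proof. by apply/malgP=> k; rewrite mcoeffZ !mcoeffU mulrnAr. Qed.

Lemma malg_scalerAr c a b : c *: (a * b) = a * (c *: b).
Proof.
rewrite (malgMEw (fsubset_refl (msupp a)) (msuppZ_le c b)) malgME scaler_sumr.
apply: eq_bigr => i _; rewrite scaler_sumr; apply: eq_bigr => j _.
by rewrite malg_scaleU mcoeffZ mulrCA.
Qed.
End FreeAlgebra.

(* The free (noncommutative) algebra on three generators; an alias because the
   [algType] structure of [malg] is only canonical for commutative monoids. *)
Definition free_alg (K : fieldType) : Type := {malg K[{fmonom 'I_3}]}.
HB.instance Definition _ (K : fieldType) := GRing.Lalgebra.on (free_alg K).
HB.instance Definition _ (K : fieldType) :=
  GRing.Lalgebra_isAlgebra.Build K (free_alg K) (@malg_scalerAr K _).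

Definition free_gen (K : fieldType) (i : 'I_3) : free_alg K := mkmalgU (fmu i) 1.

Inductive two_sided_ideal (A : pzRingType) (S : A -> Prop) : A -> Prop :=
| ideal_gen x of S x : two_sided_ideal S x
| ideal_0 : two_sided_ideal S 0
| ideal_add x y of two_sided_ideal S x & two_sided_ideal S y :
    two_sided_ideal S (x + y)
| ideal_mul a x b of two_sided_ideal S x : two_sided_ideal S (a * x * b).

Lemma ideal_opp (A : pzRingType) (S : A -> Prop) x :
  two_sided_ideal S x -> two_sided_ideal S (- x).
Proof.
by move=> Ix; have := ideal_mul (-1) 1 Ix; rewrite mulr1 mulN1r.
Qed.

Section DownUp.
Variables (K : fieldType) (f : {poly K}) (r s gamma : K).

Local Notation F := (free_alg K).
Definition free_d : F := free_gen K (@Ordinal 3 0 isT).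
Definition free_u : F := free_gen K (@Ordinal 3 1 isT).
Definition free_h : F := free_gen K (@Ordinal 3 2 isT).

Inductive gdua_relator : F -> Prop :=
| relator_dh :
    gdua_relator (free_d * free_h - r *: (free_h * free_d) + gamma *: free_d)
| relator_hu :
    gdua_relator (free_h * free_u - r *: (free_u * free_h) + gamma *: free_u)
| relator_du :
    gdua_relator
      (free_d * free_u - s *: (free_u * free_d) + horner_alg free_h f).

Local Notation I := (two_sided_ideal gdua_relator).

(* The algebra is nonzero (as required by [algType]): it acts on the space
   with basis e_0, e_1, ... by h e_n = lam n e_n, u e_n = e_(n+1) and
   d e_n = mu n e_(n-1). *)
Section Nontrivial.
Fixpoint verma_lam n : K := if n is n'.+1 then r * verma_lam n' - gamma else 0.
Fixpoint verma_mu n : K :=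
  if n is n'.+1 then s * verma_mu n' - f.[verma_lam n'] else 0.

Definition verma_gen (i : 'I_3) (v : nat -> K) (n : nat) : K :=
  match val i with
  | 0 => verma_mu n.+1 * v n.+1
  | 1 => if n is n'.+1 then v n' else 0
  | _ => verma_lam n * v n
  end.

Definition verma_word (w : {fmonom 'I_3}) (v : nat -> K) : nat -> K :=
  foldr verma_gen v w.

Definition verma (a : F) (v : nat -> K) (n : nat) : K :=
  mmap (idfun : K -> K) (fun w => verma_word w v n) a.

Lemma verma_gen_sum (J : Type) (X : seq J) (c : J -> K) G i :
  verma_gen i (fun n => \sum_(k <- X) c k * G k n) =
  (fun n => \sum_(k <- X) c k * verma_gen i (G k) n).
Proof.
apply/funext => n; rewrite /verma_gen; case: (val i) => [|[|_]].
- by rewrite mulr_sumr; apply: eq_bigr => k _; rewrite mulrCA.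
- by case: n => [|n] //; rewrite big1 // => k _; rewrite mulr0.
- by rewrite mulr_sumr; apply: eq_bigr => k _; rewrite mulrCA.
Qed.

Lemma verma_word_sum (J : Type) (X : seq J) (c : J -> K) G w :
  verma_word w (fun n => \sum_(k <- X) c k * G k n) =
  (fun n => \sum_(k <- X) c k * verma_word w (G k) n).
Proof.
rewrite /verma_word; elim: (w : seq 'I_3) => //= i l ->.
by rewrite verma_gen_sum.
Qed.

Lemma verma0 v n : verma 0 v n = 0. Proof. exact: raddf0. Qed.
Lemma vermaD a b v n : verma (a + b) v n = verma a v n + verma b v n.
Proof. exact: raddfD. Qed.
Lemma vermaN a v n : verma (- a) v n = - verma a v n.
Proof. exact: raddfN. Qed.

Lemma vermaM a b v n : verma (a * b) v n = verma a (verma b v) n.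
Proof.
rewrite malgME /verma raddf_sum /= [RHS]mmapE; apply: eq_bigr => i _.
rewrite raddf_sum /= [in RHS](_ : (fun n : nat => _) =
  (fun n => \sum_(k <- msupp b) mcoeff k b * verma_word k v n)); last first.
  by apply/funext => m; rewrite mmapE.
rewrite verma_word_sum mulr_sumr; apply: eq_bigr => j _.
by rewrite mmapU /= mulrA /verma_word fmM foldr_cat.
Qed.

Lemma verma_gE i v n : verma (free_gen K i) v n = verma_gen i v n.
Proof. by rewrite /verma /free_gen mmapU /= mul1r /verma_word fmU. Qed.

Lemma vermaA c v n : verma (c%:A) v n = c * v n.
Proof.
by rewrite /verma malg_scaleU mmapU /= mulr1 /verma_word fm1.
Qed.

Lemma vermaZ c a v n : verma (c *: a) v n = c * verma a v n.
Proof. by rewrite -mulr_algl vermaM vermaA. Qed.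

Lemma verma_horner p v n :
  verma (horner_alg free_h p) v n = p.[verma_lam n] * v n.
Proof.
elim/poly_ind: p v => [|p c IHp] v; first by rewrite rmorph0 verma0 horner0 mul0r.
rewrite rmorphD rmorphM /= horner_algX horner_algC hornerMXaddC.
by rewrite vermaD vermaM vermaA IHp verma_gE /verma_gen /= mulrDl mulrA.
Qed.

Lemma verma_dE v n : verma free_d v n = verma_mu n.+1 * v n.+1.
Proof. exact: verma_gE. Qed.
Lemma verma_uE v n : verma free_u v n = if n is n'.+1 then v n' else 0.
Proof. exact: verma_gE. Qed.
Lemma verma_hE v n : verma free_h v n = verma_lam n * v n.
Proof. exact: verma_gE. Qed.

Definition vermaE := (vermaD, vermaN, vermaZ, vermaM, verma_horner,
  verma_dE, verma_uE, verma_hE).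

Lemma verma_ideal a : I a -> forall v n, verma a v n = 0.
Proof.
have sc0 : forall b n, verma b (fun _ => 0) n = 0.
  move=> b n; have -> : (fun _ => 0) = verma 0 (fun _ => 0).
    by apply/funext => m; rewrite verma0.
  by rewrite -vermaM mulr0 verma0.
elim=> {a} [a [] v n|v n|a b _ Ia _ Ib v n|a x b _ Ix v n].
- by rewrite !vermaE /=; ring.
- by rewrite !vermaE; case: n => [|n] /=; rewrite ?vermaE; ring.
- by rewrite !vermaE; case: n => [|n] /=; rewrite ?vermaE /=; ring.
- exact: verma0.
- by rewrite vermaD Ia Ib addr0.
- rewrite !vermaM (_ : verma x _ = fun _ => 0) ?sc0 //.
  by apply/funext => m; rewrite Ix.
Qed.

Lemma ideal_proper : ~ I 1.
Proof.
rewrite -[1]scale1r => /verma_ideal/(_ (fun _ => 1) 0%N)/eqP.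
by rewrite vermaA mulr1 oner_eq0.
Qed.
End Nontrivial.

Definition gdua_eqv (x y : F) : bool := `[< I (x - y) >].

Lemma gdua_eqv_equiv : equiv_class_of gdua_eqv.
Proof.
split=> [x|x y|y x z].
- by apply/asboolP; rewrite subrr; apply: ideal_0.
- by apply/asboolP/asboolP => /ideal_opp; rewrite opprB.
- move=> /asboolP Ixy /asboolP Iyz; apply/asboolP.
  by have := ideal_add Ixy Iyz; rewrite addrA subrK.
Qed.

Canonical gdua_equiv := EquivRelPack gdua_eqv_equiv.

Definition gdua : Type := {eq_quot gdua_eqv}.
HB.instance Definition _ := Choice.on gdua.
HB.instance Definition _ := EqQuotient.on gdua.

Lemma gdua_eqP (x y : F) : I (x - y) <-> \pi_gdua x = \pi_gdua y.
Proof.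
split=> [Ixy|/eqP]; first by apply/eqP; rewrite eqmodE; apply/asboolP.
by rewrite eqmodE => /asboolP.
Qed.

Lemma gdua_reprP (x : F) : I (repr (\pi_gdua x) - x).
Proof. by apply/gdua_eqP; rewrite reprK. Qed.

Definition gdua_zero : gdua := \pi_gdua 0.
Definition gdua_one : gdua := \pi_gdua 1.
Definition gdua_opp (x : gdua) : gdua := \pi_gdua (- repr x).
Definition gdua_add (x y : gdua) : gdua := \pi_gdua (repr x + repr y).
Definition gdua_mul (x y : gdua) : gdua := \pi_gdua (repr x * repr y).
Definition gdua_scale (c : K) (x : gdua) : gdua := \pi_gdua (c *: repr x).

Lemma pi_gdua_opp x : gdua_opp (\pi_gdua x) = \pi_gdua (- x).
Proof.
by apply/gdua_eqP; rewrite -opprD; apply/ideal_opp/gdua_reprP.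
Qed.

Lemma pi_gdua_add x y : gdua_add (\pi_gdua x) (\pi_gdua y) = \pi_gdua (x + y).
Proof.
apply/gdua_eqP; rewrite opprD addrACA.
by apply: ideal_add; apply: gdua_reprP.
Qed.

Lemma pi_gdua_mul x y : gdua_mul (\pi_gdua x) (\pi_gdua y) = \pi_gdua (x * y).
Proof.
apply/gdua_eqP; set x' := repr _; set y' := repr _.
have -> : x' * y' - x * y = 1 * (x' - x) * y' + x * (y' - y) * 1.
  by rewrite mul1r mulr1 mulrBl mulrBr addrA subrK.
by apply: ideal_add; apply: ideal_mul; apply: gdua_reprP.
Qed.

Lemma pi_gdua_scale c x : gdua_scale c (\pi_gdua x) = \pi_gdua (c *: x).
Proof.
apply/gdua_eqP; rewrite -scalerBr -mulr_algl -[_ * _]mulr1.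
exact/ideal_mul/gdua_reprP.
Qed.

Let piW (P : gdua -> Prop) : (forall x, P (\pi_gdua x)) -> forall x, P x.
Proof. by move=> Ppi x; rewrite -[x]reprK. Qed.

Let piE := (pi_gdua_opp, pi_gdua_add, pi_gdua_mul, pi_gdua_scale).

Lemma gdua_addA : associative gdua_add.
Proof.
by elim/piW=> x; elim/piW=> y; elim/piW=> z; rewrite !piE addrA.
Qed.
Lemma gdua_addC : commutative gdua_add.
Proof. by elim/piW=> x; elim/piW=> y; rewrite !piE addrC. Qed.
Lemma gdua_add0 : left_id gdua_zero gdua_add.
Proof. by elim/piW=> x; rewrite !piE add0r. Qed.
Lemma gdua_addN : left_inverse gdua_zero gdua_opp gdua_add.
Proof. by elim/piW=> x; rewrite !piE addNr. Qed.

HB.instance Definition _ :=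
  GRing.isZmodule.Build gdua gdua_addA gdua_addC gdua_add0 gdua_addN.

Lemma gdua_mulA : associative gdua_mul.
Proof.
by elim/piW=> x; elim/piW=> y; elim/piW=> z; rewrite !piE mulrA.
Qed.
Lemma gdua_1mul : left_id gdua_one gdua_mul.
Proof. by elim/piW=> x; rewrite !piE mul1r. Qed.
Lemma gdua_mul1 : right_id gdua_one gdua_mul.
Proof. by elim/piW=> x; rewrite !piE mulr1. Qed.
Lemma gdua_mulDl : left_distributive gdua_mul +%R.
Proof.
elim/piW=> x; elim/piW=> y; elim/piW=> z.
by rewrite -![_ + _]/(gdua_add _ _) !piE mulrDl.
Qed.
Lemma gdua_mulDr : right_distributive gdua_mul +%R.
Proof.
elim/piW=> x; elim/piW=> y; elim/piW=> z.
by rewrite -![_ + _]/(gdua_add _ _) !piE mulrDr.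
Qed.
Lemma gdua_1_neq0 : gdua_one != 0.
Proof.
by apply/eqP => /gdua_eqP; rewrite subr0; apply: ideal_proper.
Qed.

HB.instance Definition _ := GRing.Zmodule_isNzRing.Build gdua
  gdua_mulA gdua_1mul gdua_mul1 gdua_mulDl gdua_mulDr gdua_1_neq0.

Lemma gdua_scaleA a b x : gdua_scale a (gdua_scale b x) = gdua_scale (a * b) x.
Proof. by elim/piW: x => x; rewrite !piE scalerA. Qed.
Lemma gdua_scale1 : left_id 1 gdua_scale.
Proof. by elim/piW=> x; rewrite !piE scale1r. Qed.
Lemma gdua_scaleDr : right_distributive gdua_scale +%R.
Proof.
move=> c; elim/piW=> x; elim/piW=> y.
by rewrite -![_ + _]/(gdua_add _ _) !piE scalerDr.
Qed.
Lemma gdua_scaleDl x : {morph gdua_scale^~ x : a b / a + b}.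
Proof.
move=> a b; elim/piW: x => x.
by rewrite -![_ + _ in RHS]/(gdua_add _ _) !piE scalerDl.
Qed.

HB.instance Definition _ := GRing.Zmodule_isLmodule.Build K gdua
  gdua_scaleA gdua_scale1 gdua_scaleDr gdua_scaleDl.

Lemma gdua_scaleAl c (x y : gdua) : c *: (x * y) = (c *: x) * y.
Proof.
elim/piW: x => x; elim/piW: y => y.
by rewrite -![_ * _]/(gdua_mul _ _) -![_ *: _]/(gdua_scale _ _) !piE scalerAl.
Qed.

HB.instance Definition _ := GRing.Lmodule_isLalgebra.Build K gdua gdua_scaleAl.

Lemma gdua_scaleAr c (x y : gdua) : c *: (x * y) = x * (c *: y).
Proof.
elim/piW: x => x; elim/piW: y => y.
by rewrite -![_ * _]/(gdua_mul _ _) -![_ *: _]/(gdua_scale _ _) !piE scalerAr.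
Qed.

HB.instance Definition _ :=
  GRing.Lalgebra_isAlgebra.Build K gdua gdua_scaleAr.

Definition gdua_d : gdua := \pi_gdua free_d.
Definition gdua_u : gdua := \pi_gdua free_u.
Definition gdua_h : gdua := \pi_gdua free_h.
End DownUp.

(** * Automorphism groups *)

Record alg_aut (K : fieldType) (A : algType K) := AlgAut {
  alg_aut_map :> {lrmorphism A -> A};
  alg_aut_bij : bijective alg_aut_map
}.

Section AlgAut.
Variables (K : fieldType) (A : algType K).
Local Notation aut := (alg_aut A).
Implicit Types phi psi : aut.

HB.instance Definition _ := gen_eqMixin aut.
HB.instance Definition _ := gen_choiceMixin aut.

Lemma alg_autP phi psi : (forall x, phi x = psi x) -> phi = psi.
Proof.
case: phi psi => [f fb] [g gb] /= efg.
have {}efg : f = g.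
  have {}efg : f = g :> (A -> A) by apply/funext.
  case: f g efg {fb gb} => [f cf] [g cg] /= efg; subst g.
  congr GRing.LRMorphism.Pack.
  case: cf cg => [[f1] [f2] [f3]] [[g1] [g2] [g3]].
  by rewrite (Prop_irrelevance f1 g1) (Prop_irrelevance f2 g2)
             (Prop_irrelevance f3 g3).
by subst g; rewrite (Prop_irrelevance fb gb).
Qed.

Definition aut_one : aut :=
  @AlgAut K A (idfun : {lrmorphism A -> A})
    (Bijective (fun _ => erefl) (fun _ => erefl)).

Definition aut_mul phi psi : aut :=
  @AlgAut K A (phi \o psi : {lrmorphism A -> A})
    (bij_comp (alg_aut_bij phi) (alg_aut_bij psi)).

Section Inverse.
Variable phi : aut.

Lemma aut_inv_ex : {g : A -> A | cancel phi g /\ cancel g phi}.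
Proof. by apply: cid; case: (alg_aut_bij phi) => g fK gK; exists g. Qed.

Definition aut_inv_fun : A -> A := sval aut_inv_ex.

Lemma aut_funK : cancel phi aut_inv_fun. Proof. exact: (svalP aut_inv_ex).1. Qed.
Lemma aut_invfK : cancel aut_inv_fun phi. Proof. exact: (svalP aut_inv_ex).2. Qed.

Let phi_inj := can_inj aut_funK.

Lemma aut_inv_zmod : zmod_morphism aut_inv_fun.
Proof. by move=> x y; apply: phi_inj; rewrite rmorphB /= !aut_invfK. Qed.
Lemma aut_inv_monoid : GRing.monoid_morphism aut_inv_fun.
Proof.
split=> [|x y]; apply: phi_inj; first by rewrite rmorph1 aut_invfK.
by rewrite rmorphM /= !aut_invfK.
Qed.
Lemma aut_inv_scalable : scalable aut_inv_fun.
Proof. by move=> c x; apply: phi_inj; rewrite linearZ /= !aut_invfK. Qed.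

HB.instance Definition _ :=
  GRing.isZmodMorphism.Build A A aut_inv_fun aut_inv_zmod.
HB.instance Definition _ :=
  GRing.isMonoidMorphism.Build A A aut_inv_fun aut_inv_monoid.
HB.instance Definition _ :=
  GRing.isScalable.Build K A A *:%R aut_inv_fun aut_inv_scalable.

Definition aut_inv : aut := @AlgAut K A (aut_inv_fun : {lrmorphism A -> A})
  (Bijective aut_invfK aut_funK).
End Inverse.

Lemma aut_mulA : associative aut_mul.
Proof. by move=> x y z; apply: alg_autP. Qed.
Lemma aut_1mul : left_id aut_one aut_mul.
Proof. by move=> x; apply: alg_autP. Qed.
Lemma aut_mul1 : right_id aut_one aut_mul.
Proof. by move=> x; apply: alg_autP. Qed.
Lemma aut_mulV : left_inverse aut_one aut_inv aut_mul.
Proof. by move=> x; apply: alg_autP => a /=; rewrite aut_funK. Qed.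
Lemma aut_Vmul : right_inverse aut_one aut_inv aut_mul.
Proof. by move=> x; apply: alg_autP => a /=; rewrite aut_invfK. Qed.

HB.instance Definition _ :=
  isGroup.Build aut aut_mulA aut_1mul aut_mul1 aut_mulV aut_Vmul.
End AlgAut.

(* The group of automorphisms of L(f, r, s, 0) that map h to a nonzero scalar
   multiple of h. *)
Section HGroup.
Variables (K : fieldType) (f : {poly K}) (r s : K).
Local Notation L := (gdua f r s 0).
Local Notation h := (gdua_h f r s 0).

Definition h_diagonal : {pred alg_aut L} :=
  fun phi => `[< exists2 lambda : K, lambda != 0 & phi h = lambda *: h >].

Lemma h_diagonal_closed : group_closed h_diagonal.
Proof.
split=> [|phi psi /asboolP [a a0 pa] /asboolP [b b0 pb]]; apply/asboolP.
  by exists 1; rewrite ?oner_neq0 //= scale1r.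
exists (a / b); first by rewrite mulf_neq0 ?invr_eq0.
have -> : (phi / psi)%g h = phi ((psi^-1)%g h) by [].
have -> : (psi^-1)%g h = b^-1 *: h.
  apply: (bij_inj (alg_aut_bij psi)); rewrite linearZ /= pb.
  by rewrite aut_invfK scalerA mulVf ?scale1r.
by rewrite linearZ /= pa scalerA mulrC.
Qed.

Definition h_group : Type := {phi : alg_aut L | phi \in h_diagonal}.
HB.instance Definition _ := SubChoice.on h_group.
HB.instance Definition _ :=
  SubChoice_isSubGroup.Build (alg_aut L) h_diagonal h_group h_diagonal_closed.
End HGroup.

(** * Actions and parameters *)

Section Actions.
Variable K : fieldType.
Local Notation Ks := (unit_group K).

Lemma unit_mulC (x y : Ks) : (x * y = y * x)%g. Proof. exact: ug_mulC. Qed.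

Definition rot3 (x : Ks * Ks * Ks) : Ks * Ks * Ks := (x.2, x.1.1, x.1.2).

Lemma rot3M : {morph rot3 : x y / (x * y)%g}. Proof. by []. Qed.
Lemma rot3_3 x : iter 3 rot3 x = x. Proof. by case: x => [[]]. Qed.

Definition rot3_action : group_action 'Z_3 (Ks * Ks * Ks)%type :=
  @cyclic_action 3 _ _ isT rot3M rot3_3.

Definition flip2 (x : Ks * Ks) : Ks * Ks := (x.1, x.2^-1 * x.1)%g.

Lemma flip2M : {morph flip2 : x y / (x * y)%g}.
Proof.
move=> x y; congr pair => /=.
by apply: val_inj; rewrite /= invfM; ring.
Qed.
Lemma flip2_2 x : iter 2 flip2 x = x.
Proof.
case: x => a b.
by rewrite /flip2 /= invgM invgK unit_mulC mulgA mulgV mul1g.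
Qed.

Definition flip2_action : group_action 'Z_2 (Ks * Ks)%type :=
  @cyclic_action 2 _ _ isT flip2M flip2_2.

Lemma unit_invM : {morph (fun x : Ks => x^-1)%g : x y / (x * y)%g}.
Proof. by move=> x y; rewrite invgM unit_mulC. Qed.

Definition inv_action : group_action 'Z_2 Ks :=
  @cyclic_action 2 _ _ isT unit_invM (@invgK Ks).

(* The action of Q on the additive group K through a character of Q. *)
Section Scaling.
Variables (Q : groupType) (chi : Q -> Ks).
Hypothesis chiM : {morph chi : x y / (x * y)%g}.

Let scal (q : Q) (t : additive_group K) : additive_group K :=
  uval (chi q) * (t : K).

Lemma scaling_1 t : scal 1%g t = t.
Proof.
rewrite /scal; have -> : chi 1%g = 1%g.
  by apply: (mulgI (chi 1%g)); rewrite -chiM !mulg1.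
exact: mul1r.
Qed.
Lemma scaling_M p q t : scal (p * q)%g t = scal p (scal q t).
Proof. by rewrite /scal chiM mulrA. Qed.
Lemma scaling_morph q : {morph scal q : t t' / (t * t')%g}.
Proof. by move=> t t'; apply: mulrDr. Qed.

Definition scaling_action : group_action Q (additive_group K) :=
  GroupAction scaling_1 scaling_M scaling_morph.
End Scaling.

Lemma unit_expgMn (x y : Ks) n : ((x * y) ^+ n = x ^+ n * y ^+ n)%g.
Proof. by apply: expgMn; apply: unit_mulC. Qed.

Definition chi3 (n : nat) (x : Ks * Ks * Ks) : Ks :=
  (x.1.1^-1 * (x.1.2 * x.2) ^+ n)%g.

Lemma chi3M n : {morph chi3 n : x y / (x * y)%g}.
Proof.
move=> x y.
have -> : chi3 n (x * y)%g = ((x.1.1 * y.1.1)^-1 *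
    ((x.1.2 * y.1.2) * (x.2 * y.2)) ^+ n)%g by [].
rewrite unit_invM !unit_expgMn /chi3 !unit_expgMn; apply: val_inj => /=; ring.
Qed.

Definition chi2 (x : Ks * Ks) : Ks := x.1^-1%g.

Lemma chi2M : {morph chi2 : x y / (x * y)%g}.
Proof. by move=> x y; apply: unit_invM. Qed.

End Actions.

Section TauTilde.
Variable K : fieldType.

Definition not_root_of_unity (r : K) : Prop :=
  forall n, (0 < n)%N -> ~~ n.-unity_root r.

Definition power_dependent (r s : K) : pred nat :=
  fun i => (0 < i)%N && `[< exists j : int, s ^+ i = r ^ j >].

Definition tau (r s : K) : nat :=
  if pselect (exists i, power_dependent r s i) is left ex_i then ex_minn ex_i
  else 0.

Definition f_tilde (f : {poly K}) (r gamma : K) : {poly K} :=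
  f \Po ((r - 1)^-1 *: ('X + gamma%:P)).
End TauTilde.

(* Main.v *)
(* The substitution h := (r - 1) h - gamma reduces to gamma = 0. Put
   z = ud - g(h) and let sigma be the automorphism h -> r h, z -> s z of
   K[h, z]. Then z commutes with h, and L embeds in the skew Laurent ring
   K[h, z][u, u^-1; sigma] with d = (z + g(h)) u^-1, whence a Z-grading.
   As r is not a root of unity, looking at top and bottom degrees shows that
   normal elements are homogeneous. So for an automorphism phi the element
   phi(h), which is normal and irreducible, is a multiple of u or of d, or
   belongs to K[h, z].
   In the first case f = 0 and s = r^-1: L is a quantum affine space with a
   cyclic symmetry. In the second case p = phi(h) is an eigenvector of sigma,
   and phi(u), phi(d) are homogeneous of opposite degrees, which are 1 and -1
   by surjectivity; so phi preserves or exchanges the lines K u and K d.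
   The image of d u = s u d - f(h) under phi then determines p. If the lines are
   preserved, p = l h, or f is constant, s ^ j = r and p = l h + t z ^ j;
   if they are exchanged, deg f = 1, s = r^-1 and p = l z. *)
Require Import Defs.
From HB Require Import structures.
From mathcomp Require Import all_boot all_order all_algebra.
From mathcomp Require Import boolp finmap ring zify monalg.

Set Implicit Arguments.
Unset Strict Implicit.
Unset Printing Implicit Defensive.

Import Order.TTheory GRing.Theory Num.Theory.
Local Open Scope ring_scope.

(** Independence of the monomials of L is the one thing rewriting would make painful; it is read off
    a model instead. L acts on all sequences [int -> K[h, z]], and the coefficients of x are those
    of x applied to the sequence supported in degree 0 with value 1. Composition of operators makes
    associativity free, and the product rule, the absence of zero divisors and all degree arguments
    follow from these coefficients. What distinguishes L inside the Laurent ring is that its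
    coefficients in degree -n are multiples of a product of n translates of z + g(h). Irreducibility
    of u and d, and the vanishing of f when u or d is normal, rest on this divisibility. The
    polynomial g is not determined by f: a monomial X^i with s = r^i can be added to it. When f is
    constant, g is taken constant, so that every automorphism preserving the lines K u and K d
    rescales z. To identify the groups, a candidate group indexes the triples of images of d, u, h.
    One composition rule for these triples yields both the invertibility of the endomorphisms and
    the homomorphism property. *)

Lemma malg_indU (R : nzRingType) (I : choiceType) (P : {malg R[I]} -> Prop) :
  P 0 -> (forall x y, P x -> P y -> P (x + y)) ->
  (forall c k, P (mkmalgU k c)) -> forall x, P x.
Proof.
by move=> P0 PD PU x; rewrite [x]monalgE; apply: big_ind => [||i _]; [|apply: PD|].
Qed.

(** * Universal property of L *)

Section UniversalProperty.
Local Open Scope quotient_scope.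
Variables (K : fieldType) (A : algType K) (D U H : A).

Definition gen_image (i : 'I_3) : A :=
  match val i with 0%N => D | 1%N => U | _ => H end.

Definition word_image (w : {fmonom 'I_3}) : A :=
  \prod_(i <- (w : seq 'I_3)) gen_image i.

Lemma word_image_mmorphism : mmorphism word_image.
Proof.
split=> [x y|]; first by rewrite /word_image fmM big_cat.
by rewrite /word_image fm1 big_nil.
Qed.

HB.instance Definition _ :=
  monalg.isMultiplicative.Build _ A word_image word_image_mmorphism.

Definition free_map (x : free_alg K) : A := mmap (in_alg A) word_image x.

Lemma free_map_zmod : zmod_morphism free_map.
Proof. by move=> x y; rewrite /free_map raddfB. Qed.

Lemma free_map_monoid : GRing.monoid_morphism free_map.
Proof.
suff [M1 M2] : GRing.multiplicative (free_map : {malg K[{fmonom 'I_3}]} -> A).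
  by split.
apply: commr_mmap_is_multiplicative => g m m'.
by rewrite /GRing.comm /= mulr_algl mulr_algr.
Qed.

Lemma free_map_scalable : scalable free_map.
Proof.
by move=> c x; rewrite /free_map mmapZ /= mulr_algl.
Qed.

HB.instance Definition _ :=
  GRing.isZmodMorphism.Build (free_alg K) A free_map free_map_zmod.
HB.instance Definition _ :=
  GRing.isMonoidMorphism.Build (free_alg K) A free_map free_map_monoid.
HB.instance Definition _ :=
  GRing.isScalable.Build K (free_alg K) A *:%R free_map free_map_scalable.

Lemma free_map_gen i : free_map (free_gen K i) = gen_image i.
Proof.
by rewrite /free_map /free_gen mmapU /= scale1r mul1r /word_image fmU big_seq1.
Qed.

Lemma free_mapD x y : free_map (x + y) = free_map x + free_map y.
Proof. exact: (rmorphD free_map). Qed.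
Lemma free_mapN x : free_map (- x) = - free_map x.
Proof. exact: (rmorphN free_map). Qed.
Lemma free_mapM x y : free_map (x * y) = free_map x * free_map y.
Proof. exact: (rmorphM free_map). Qed.
Lemma free_mapZ c x : free_map (c *: x) = c *: free_map x.
Proof. exact: free_map_scalable. Qed.

Lemma free_mapZE c x y : free_map x = y -> free_map (c *: x) = c *: y.
Proof. by move=> <-; apply: free_mapZ. Qed.

Lemma free_map_relator c x y z a b t :
  free_map x = a -> free_map y = b -> free_map z = t ->
  a * b - c *: (b * a) + t = 0 -> free_map (x * y - c *: (y * x) + z) = 0.
Proof.
move=> <- <- <-; rewrite -(free_mapM x y) -(free_mapM y x).
move: (x * y) (y * x) => p q <-; rewrite (free_mapD (p - c *: q) z).
by rewrite (free_mapD p (- (c *: q))) (free_mapN (c *: q)) (free_mapZ c q).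
Qed.

Lemma free_dE : free_map (free_d K) = D. Proof. exact: free_map_gen. Qed.
Lemma free_uE : free_map (free_u K) = U. Proof. exact: free_map_gen. Qed.
Lemma free_hE : free_map (free_h K) = H. Proof. exact: free_map_gen. Qed.

Lemma lrmorph_horner_alg (A1 A2 : algType K) (e : {lrmorphism A1 -> A2}) a p :
  e (horner_alg a p) = horner_alg (e a) p.
Proof.
elim/poly_ind: p => [|p c IHp]; first by rewrite !rmorph0.
rewrite !rmorphD !rmorphM /= IHp !horner_algX !horner_algC.
by rewrite linearZ /= rmorph1.
Qed.

Variables (f : {poly K}) (r s gamma : K).
Hypothesis dh : D * H - r *: (H * D) + gamma *: D = 0.
Hypothesis hu : H * U - r *: (U * H) + gamma *: U = 0.
Hypothesis du : D * U - s *: (U * D) + horner_alg H f = 0.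

Lemma free_map_ideal x :
  two_sided_ideal (gdua_relator f r s gamma) x -> free_map x = 0.
Proof.
elim=> {x} [x []||x y _ Ix _ Iy|a x b _ Ix].
- exact: (free_map_relator free_dE free_hE (free_mapZE gamma free_dE) dh).
- exact: (free_map_relator free_hE free_uE (free_mapZE gamma free_uE) hu).
- apply: (free_map_relator free_dE free_uE _ du).
  by rewrite -free_hE; exact: (lrmorph_horner_alg free_map).
- exact: (rmorph0 free_map).
- by rewrite (free_mapD x) Ix Iy addr0.
- by rewrite (free_mapM (a * x)) (free_mapM a) Ix mulr0 mul0r.
Qed.

Definition gdua_map (x : gdua f r s gamma) : A := free_map (repr x).

Lemma gdua_map_pi x : gdua_map (\pi x) = free_map x.
Proof.
apply/eqP; rewrite -subr_eq0 -free_mapN -free_mapD free_map_ideal //.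
exact: gdua_reprP.
Qed.

Lemma gdua_map_zmod : zmod_morphism gdua_map.
Proof.
move=> x y; rewrite -[x]reprK -[y]reprK.
have -> : \pi_(gdua f r s gamma) (repr x) - \pi_(gdua f r s gamma) (repr y) =
  \pi_(gdua f r s gamma) (repr x - repr y).
  by rewrite -pi_gdua_add -pi_gdua_opp.
by rewrite !gdua_map_pi free_mapD free_mapN.
Qed.

Lemma gdua_map_monoid : GRing.monoid_morphism gdua_map.
Proof.
split=> [|x y]; first by rewrite gdua_map_pi; exact: (rmorph1 free_map).
rewrite -[x]reprK -[y]reprK.
have -> : \pi_(gdua f r s gamma) (repr x) * \pi_(gdua f r s gamma) (repr y) =
  \pi_(gdua f r s gamma) (repr x * repr y) by rewrite -pi_gdua_mul.
by rewrite !gdua_map_pi free_mapM.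
Qed.

Lemma gdua_map_scalable : scalable gdua_map.
Proof.
move=> c x; rewrite -[x]reprK.
have -> : c *: \pi_(gdua f r s gamma) (repr x) = \pi_(gdua f r s gamma) (c *: repr x).
  by rewrite -pi_gdua_scale.
by rewrite !gdua_map_pi free_mapZ.
Qed.

HB.instance Definition _ :=
  GRing.isZmodMorphism.Build (gdua f r s gamma) A gdua_map gdua_map_zmod.
HB.instance Definition _ :=
  GRing.isMonoidMorphism.Build (gdua f r s gamma) A gdua_map gdua_map_monoid.
HB.instance Definition _ :=
  GRing.isScalable.Build K (gdua f r s gamma) A *:%R gdua_map gdua_map_scalable.

Theorem gdua_universal : exists phi : {lrmorphism gdua f r s gamma -> A},
  [/\ phi (gdua_d f r s gamma) = D, phi (gdua_u f r s gamma) = U &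
      phi (gdua_h f r s gamma) = H].
Proof.
exists (gdua_map : {lrmorphism _ -> _}).
by split; rewrite /= gdua_map_pi free_map_gen.
Qed.
End UniversalProperty.

(** * Relations and induction principle of L *)

Section Presentation.
Local Open Scope quotient_scope.
Variables (K : fieldType) (f : {poly K}) (r s gamma : K).
Local Notation L := (gdua f r s gamma).
Local Notation d := (gdua_d f r s gamma).
Local Notation u := (gdua_u f r s gamma).
Local Notation h := (gdua_h f r s gamma).

Lemma pi_horner_alg p : \pi_L (horner_alg (free_h K) p) = horner_alg h p.
Proof.
elim/poly_ind: p => [|p c IHp]; first by rewrite !rmorph0.
rewrite !rmorphD !rmorphM /= !horner_algX !horner_algC -pi_gdua_add -IHp.
by rewrite -pi_gdua_mul -pi_gdua_scale.
Qed.

Lemma gdua_relP x : gdua_relator f r s gamma x -> \pi_L x = 0.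
Proof.
by move=> Rx; apply/gdua_eqP; rewrite subr0; apply: ideal_gen.
Qed.

Lemma gdua_dh : d * h - r *: (h * d) + gamma *: d = 0.
Proof.
rewrite -(gdua_relP (relator_dh _ _ _ _)).
by rewrite -!(pi_gdua_add, pi_gdua_opp, pi_gdua_scale, pi_gdua_mul).
Qed.

Lemma gdua_hu : h * u - r *: (u * h) + gamma *: u = 0.
Proof.
rewrite -(gdua_relP (relator_hu _ _ _ _)).
by rewrite -!(pi_gdua_add, pi_gdua_opp, pi_gdua_scale, pi_gdua_mul).
Qed.

Lemma gdua_du : d * u - s *: (u * d) + horner_alg h f = 0.
Proof.
rewrite -(gdua_relP (relator_du _ _ _ _)) -pi_horner_alg.
by rewrite -!(pi_gdua_add, pi_gdua_opp, pi_gdua_scale, pi_gdua_mul).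
Qed.

(** The words in d, u, h span L and each arises from 1 by left multiplications, so closure under
    right multiplication is not asked for. *)
Lemma gdua_ind (P : L -> Prop) :
  P 1 -> (forall x y, P x -> P y -> P (x + y)) ->
  (forall c x, P x -> P (c *: x)) ->
  (forall x, P x -> P (d * x)) -> (forall x, P x -> P (u * x)) ->
  (forall x, P x -> P (h * x)) -> forall x, P x.
Proof.
move=> P1 PD PZ Pd Pu Ph x; rewrite -[x]reprK.
have P0 : P 0 by rewrite -(scale0r 1); apply: PZ.
move: (repr x : {malg K[{fmonom 'I_3}]}); apply: malg_indU => [|a b Pa Pb|c w].
- by [].
- rewrite (_ : \pi_L _ = \pi_L (a : free_alg K) + \pi_L (b : free_alg K)).
    exact: PD.
  by rewrite -pi_gdua_add.
have -> : \pi_L (mkmalgU w c : free_alg K) = c *: \pi_L (mkmalgU w 1 : free_alg K).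
  by rewrite -[RHS]/(gdua_scale _ _) pi_gdua_scale malg_scaleU mulr1.
apply: PZ; case: w => w; elim: w => [|i w IHw].
  by rewrite (_ : FMonom [::] = mone) //; apply/eqP; rewrite fmP fm1.
have -> : \pi_L (mkmalgU (FMonom (i :: w)) 1 : free_alg K) =
    \pi_L (free_gen K i) * \pi_L (mkmalgU (FMonom w) 1 : free_alg K).
  rewrite -[RHS]/(gdua_mul _ _) pi_gdua_mul; congr (\pi_L _).
  rewrite /free_gen -[LHS]/(mkmalgU _ _ : {malg K[{fmonom 'I_3}]}).
  rewrite -[RHS]/((mkmalgU _ _ : {malg K[{fmonom 'I_3}]}) * mkmalgU _ _).
  rewrite [RHS]fgmulUU mulr1; congr mkmalgU.
  by apply/eqP; rewrite fmP fmM fmU.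
case: i => [[|[|[|//]]] lti].
- by rewrite (_ : Ordinal lti = @Ordinal 3 0 isT); [apply: Pd|apply: val_inj].
- by rewrite (_ : Ordinal lti = @Ordinal 3 1 isT); [apply: Pu|apply: val_inj].
- by rewrite (_ : Ordinal lti = @Ordinal 3 2 isT); [apply: Ph|apply: val_inj].
Qed.
End Presentation.

(** * The polynomial ring K[h, z] and its diagonal substitutions *)

Section BivariatePolynomials.
Variable K : fieldType.
Local Notation R := {poly {poly K}}.

(* Elements of K[h, z] are polynomials in z with coefficients in K[h]. *)
Definition bicst (c : K) : R := c%:P%:P.
Definition bih : R := 'X%:P.

Lemma bicstM a b : bicst (a * b) = bicst a * bicst b.
Proof. by rewrite /bicst !polyCM. Qed.
Lemma bicstD a b : bicst (a + b) = bicst a + bicst b.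
Proof. by rewrite /bicst !polyCD. Qed.
Lemma bicst1 : bicst 1 = 1. Proof. by []. Qed.
Lemma bicst0 : bicst 0 = 0. Proof. by rewrite /bicst !polyC0. Qed.

Lemma bipolyP (p q : R) : (forall j i, p`_j`_i = q`_j`_i) <-> p = q.
Proof. by split=> [pq|->//]; apply/polyP => j; apply/polyP => i. Qed.

Lemma coef_bicstM c (p : R) j i : (bicst c * p)`_j`_i = c * p`_j`_i.
Proof. by rewrite !coefCM. Qed.

Lemma coef_comp_scale (A : comNzRingType) (c : A) (p : {poly A}) i :
  (p \Po (c *: 'X))`_i = c ^+ i * p`_i.
Proof.
rewrite coef_comp_poly.
under eq_bigr => j _ do rewrite exprZn coefZ coefXn.
case: (ltnP i (size p)) => [ltip|leip].
  rewrite (bigD1 (Ordinal ltip)) //= eqxx mulr1 mulrC big1 ?addr0 // => j.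
  by rewrite -val_eqE /= eq_sym => /negPf ->; rewrite !mulr0.
rewrite nth_default // mulr0 big1 // => j _.
by rewrite (gtn_eqF (leq_trans (ltn_ord j) leip)) !mulr0.
Qed.

(* [tw a b] is the substitution h := a h, z := b z. *)
Definition tw (a b : K) : R -> R :=
  comp_poly (b%:P *: 'X) \o map_poly (comp_poly (a *: 'X)).

HB.instance Definition _ a b := GRing.RMorphism.on (tw a b).

Lemma coef_tw a b p j i : (tw a b p)`_j`_i = b ^+ j * a ^+ i * p`_j`_i.
Proof.
by rewrite /tw /= coef_comp_scale -polyC_exp coefCM coef_map /= coef_comp_scale mulrA.
Qed.

Lemma tw1 p : tw 1 1 p = p.
Proof. by apply/bipolyP => j i; rewrite coef_tw !expr1n !mul1r. Qed.

Lemma tw_tw a b a' b' p : tw a b (tw a' b' p) = tw (a * a') (b * b') p.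
Proof. by apply/bipolyP => j i; rewrite !coef_tw !exprMn; ring. Qed.

Lemma twK a b : a != 0 -> b != 0 -> cancel (tw a b) (tw a^-1 b^-1).
Proof. by move=> a0 b0 p; rewrite tw_tw !mulVf ?tw1. Qed.

Lemma tw_cst a b c : tw a b (bicst c) = bicst c.
Proof. by rewrite /tw /= map_polyC /= !comp_polyC. Qed.

Lemma tw_h a b : tw a b bih = bicst a * bih.
Proof.
by rewrite /tw /= map_polyC /= comp_polyX comp_polyC -polyCM mul_polyC.
Qed.

Lemma tw_z a b : tw a b 'X = bicst b * 'X.
Proof. by rewrite /tw /= map_polyX comp_polyX mul_polyC. Qed.

Lemma tw_polyC a b p : tw a b p%:P = (p \Po (a *: 'X))%:P.
Proof. by rewrite /tw /= map_polyC /= comp_polyC. Qed.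

Lemma tw_eq0 a b p : a != 0 -> b != 0 -> (tw a b p == 0) = (p == 0).
Proof.
move=> a0 b0; apply/eqP/eqP => [tp0|->]; last exact: rmorph0.
by rewrite -(twK a0 b0 p) tp0 rmorph0.
Qed.

Lemma size_tw a b p : a != 0 -> b != 0 -> size (tw a b p) = size p.
Proof.
have le a' b' q : (size (tw a' b' q) <= size q)%N.
  apply/leq_sizeP => j leqj; apply/polyP => i.
  by rewrite coef_tw [q`_j]nth_default // !coef0 mulr0.
move=> a0 b0; apply/anti_leq; rewrite le /=.
by rewrite -{1}(twK a0 b0 p) le.
Qed.
End BivariatePolynomials.

(** * The algebra of K[h, z]-linear operators on sequences *)

Section OperatorAlgebra.
Variable K : fieldType.
Local Notation R := {poly {poly K}}.
Local Notation V := (int -> R).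

(** These operators replace the skew Laurent ring acting on itself from the left: linearity over
    K[h, z] is linearity for the right coefficients. Sequences of arbitrary support are allowed, so
    no finiteness has to be carried along. *)
Record oper := Oper {
  oper_fun :> V -> V;
  oper_lin : forall a v w n, oper_fun (fun k => a * v k + w k) n =
    a * oper_fun v n + oper_fun w n
}.

HB.instance Definition _ := gen_eqMixin oper.
HB.instance Definition _ := gen_choiceMixin oper.
Implicit Types x y : oper.

Lemma operP x y : (forall v n, x v n = y v n) -> x = y.
Proof.
case: x y => [x xl] [y yl] /= xy.
have {}xy : x = y by apply/funext => v; apply/funext => n.
by subst y; rewrite (Prop_irrelevance xl yl).
Qed.

Definition oper_zero : oper.
Proof. by apply: (@Oper (fun _ _ => 0)) => *; rewrite mulr0 addr0. Defined.
Definition oper_one : oper.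
Proof. by apply: (@Oper (fun v => v)). Defined.
Definition oper_opp x : oper.
Proof.
by apply: (@Oper (fun v n => - x v n)) => *; rewrite oper_lin; ring.
Defined.
Definition oper_add x y : oper.
Proof.
by apply: (@Oper (fun v n => x v n + y v n)) => *; rewrite !oper_lin; ring.
Defined.
Definition oper_mul x y : oper.
Proof.
apply: (@Oper (fun v => x (y v))) => a v w n.
by rewrite -oper_lin; congr (x _ n); apply/funext => k; rewrite oper_lin.
Defined.
Definition oper_scale (c : K) x : oper.
Proof.
by apply: (@Oper (fun v n => bicst c * x v n)) => *; rewrite !oper_lin; ring.
Defined.

Lemma oper_addA : associative oper_add.
Proof. by move=> x y z; apply: operP => v n /=; rewrite addrA. Qed.
Lemma oper_addC : commutative oper_add.
Proof. by move=> x y; apply: operP => v n /=; rewrite addrC. Qed.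
Lemma oper_add0 : left_id oper_zero oper_add.
Proof. by move=> x; apply: operP => v n /=; rewrite add0r. Qed.
Lemma oper_addN : left_inverse oper_zero oper_opp oper_add.
Proof. by move=> x; apply: operP => v n /=; rewrite addNr. Qed.

HB.instance Definition _ :=
  GRing.isZmodule.Build oper oper_addA oper_addC oper_add0 oper_addN.

Lemma oper_mulA : associative oper_mul.
Proof. by move=> x y z; apply: operP. Qed.
Lemma oper_mul1 : left_id oper_one oper_mul.
Proof. by move=> x; apply: operP. Qed.
Lemma oper_1mul : right_id oper_one oper_mul.
Proof. by move=> x; apply: operP. Qed.
Lemma oper_mulDl : left_distributive oper_mul +%R.
Proof. by move=> x y z; apply: operP. Qed.

Lemma oper0 x n : x (fun _ => 0) n = 0.
Proof.
have E : (fun _ : int => 1 * (0 : R) + 0) = fun _ => 0.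
  by apply/funext => k; rewrite mulr0 addr0.
have := oper_lin x 1 (fun _ => 0) (fun _ => 0) n; rewrite E mul1r.
by rewrite -[X in X = _]addr0 => /addrI.
Qed.
Lemma operD x v w n : x (fun k => v k + w k) n = x v n + x w n.
Proof.
rewrite -[x v n]mul1r -oper_lin; congr (x _ n).
by apply/funext => k; rewrite mul1r.
Qed.
Lemma operZ x a v n : x (fun k => a * v k) n = a * x v n.
Proof.
rewrite -[RHS]addr0 -(oper0 x n) -oper_lin; congr (x _ n).
by apply/funext => k; rewrite addr0.
Qed.

Lemma oper_mulDr : right_distributive oper_mul +%R.
Proof. by move=> x y z; apply: operP => v n /=; rewrite -operD. Qed.

Lemma oper_1_neq0 : oper_one != 0.
Proof.
apply/eqP => /(congr1 (fun x : oper => x (fun _ => 1) 0)) /= /eqP.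
by rewrite oner_eq0.
Qed.

HB.instance Definition _ := GRing.Zmodule_isNzRing.Build oper
  oper_mulA oper_mul1 oper_1mul oper_mulDl oper_mulDr oper_1_neq0.

Lemma oper_scaleA a b x : oper_scale a (oper_scale b x) = oper_scale (a * b) x.
Proof. by apply: operP => v n /=; rewrite mulrA bicstM. Qed.
Lemma oper_scale1 : left_id 1 oper_scale.
Proof. by move=> x; apply: operP => v n /=; rewrite mul1r. Qed.
Lemma oper_scaleDr : right_distributive oper_scale +%R.
Proof. by move=> c x y; apply: operP => v n /=; rewrite mulrDr. Qed.
Lemma oper_scaleDl x : {morph oper_scale^~ x : a b / a + b}.
Proof. by move=> a b; apply: operP => v n /=; rewrite bicstD mulrDl. Qed.

HB.instance Definition _ := GRing.Zmodule_isLmodule.Build K oper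
  oper_scaleA oper_scale1 oper_scaleDr oper_scaleDl.

Lemma oper_scaleAl c x y : c *: (x * y) = (c *: x) * y.
Proof. exact: operP. Qed.
HB.instance Definition _ := GRing.Lmodule_isLalgebra.Build K oper oper_scaleAl.

Lemma oper_scaleAr c x y : c *: (x * y) = x * (c *: y).
Proof. by apply: operP => v n /=; rewrite -operZ. Qed.
HB.instance Definition _ := GRing.Lalgebra_isAlgebra.Build K oper oper_scaleAr.

Lemma operDE x y v n : (x + y) v n = x v n + y v n. Proof. by []. Qed.
Lemma operNE x v n : (- x) v n = - x v n. Proof. by []. Qed.
Lemma operME x y v : (x * y) v = x (y v). Proof. by []. Qed.
Lemma operZE c x v n : (c *: x) v n = bicst c * x v n. Proof. by []. Qed.
Lemma oper1E v : (1 : oper) v = v. Proof. by []. Qed.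
Lemma oper0E v n : (0 : oper) v n = 0. Proof. by []. Qed.

Definition operE := (operDE, operNE, operZE, operME, oper1E, oper0E).

Lemma oper_sum x (J : Type) (X : seq J) (P : pred J) (F : J -> V) n :
  x (fun k => \sum_(j <- X | P j) F j k) n = \sum_(j <- X | P j) x (F j) n.
Proof.
elim: X => [|j X IHX].
  rewrite big_nil -[RHS](oper0 x n); congr (x _ n).
  by apply/funext => k; rewrite big_nil.
rewrite big_cons -IHX; case: ifP => Pj; rewrite -?operD; congr (x _ n);
  by apply/funext => k; rewrite big_cons Pj.
Qed.
End OperatorAlgebra.

(** * The presentation with gamma = 0, for an arbitrary algebra *)

Section Presented.
Variables (K : fieldType) (f : {poly K}) (r s : K).

(* [A] is generated by [d], [u], [h] with the defining relations of
   L(f, r, s, 0). *)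
Record presented (A : algType K) (d u h : A) : Prop := Presented {
  presented_dh : d * h = r *: (h * d);
  presented_hu : h * u = r *: (u * h);
  presented_du : d * u = s *: (u * d) - horner_alg h f;
  presented_ind : forall P : A -> Prop,
    P 1 -> (forall x y, P x -> P y -> P (x + y)) ->
    (forall c x, P x -> P (c *: x)) ->
    (forall x, P x -> P (d * x)) -> (forall x, P x -> P (u * x)) ->
    (forall x, P x -> P (h * x)) -> forall x, P x;
  presented_univ : forall (B : algType K) (D U H : B),
    D * H = r *: (H * D) -> H * U = r *: (U * H) ->
    D * U = s *: (U * D) - horner_alg H f ->
    exists e : {lrmorphism A -> B}, [/\ e d = D, e u = U & e h = H]
}.
End Presented.

(** * The automorphism sigma of K[h, z] and its integer powers *)

Section ConformalAlgebra.
Variables (K : fieldType) (f g : {poly K}) (r s : K).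
Hypotheses (r0 : r != 0) (s0 : s != 0).
Hypothesis f_conf : f = s *: g - (g \Po (r *: 'X)).

Local Notation R := {poly {poly K}}.
Definition sig (j : int) : R -> R := tw (r ^ j) (s ^ j).
HB.instance Definition _ j := GRing.RMorphism.on (sig j).

Lemma sigD i j p : sig i (sig j p) = sig (i + j) p.
Proof. by rewrite /sig tw_tw !expfzDr. Qed.
Lemma sig0 p : sig 0 p = p. Proof. exact: tw1. Qed.
Lemma sigK j : cancel (sig j) (sig (- j)).
Proof. by move=> p; rewrite sigD addNr sig0. Qed.
Lemma sig_cst j c : sig j (bicst c) = bicst c. Proof. exact: tw_cst. Qed.
Lemma sig_eq0 j p : (sig j p == 0) = (p == 0).
Proof. by rewrite tw_eq0 // expfz_neq0. Qed.
Lemma size_sig j p : size (sig j p) = size p.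
Proof. by rewrite size_tw // expfz_neq0. Qed.
Lemma sig_h j : sig j (bih K) = bicst (r ^ j) * bih K. Proof. exact: tw_h. Qed.
Lemma sig_z j : sig j 'X = bicst (s ^ j) * 'X. Proof. exact: tw_z. Qed.
Lemma sig_polyC j p : sig j p%:P = (p \Po (r ^ j *: 'X))%:P.
Proof. exact: tw_polyC. Qed.

(** This is [u * d] seen in K[h, z]; compare [ev_w]. *)
Definition biw : R := 'X + g%:P.

Lemma sig_w j : sig j biw = bicst (s ^ j) * 'X + (g \Po (r ^ j *: 'X))%:P.
Proof. by rewrite /biw rmorphD /= sig_z sig_polyC. Qed.

Lemma size_w : size biw = 2.
Proof. exact: size_XaddC. Qed.

Lemma w_neq0 : biw != 0.
Proof. by rewrite -size_poly_eq0 size_w. Qed.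

(** * A faithful representation *)

Local Notation V := (int -> R).

(* The action on skew Laurent polynomials written [\sum_n u ^ n v_n] with right
   coefficients [v_n] in K[h, z], where [d = u^-1 w]. *)
Definition op_h : oper K.
Proof.
by apply: (@Oper _ (fun v n => bicst (r ^ n) * bih K * v n)) => *; ring.
Defined.
Definition op_u : oper K.
Proof. by apply: (@Oper _ (fun v n => v (n - 1))). Defined.
Definition op_d : oper K.
Proof.
by apply: (@Oper _ (fun v n => sig (n + 1) biw * v (n + 1))) => *; ring.
Defined.

Lemma op_horner p v n :
  horner_alg op_h p v n = (p \Po (r ^ n *: 'X))%:P * v n.
Proof.
elim/poly_ind: p v => [|p c IHp] v.
  by rewrite rmorph0 oper0E comp_poly0 polyC0 mul0r.
rewrite rmorphD rmorphM /= horner_algX horner_algC !operE IHp.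
rewrite comp_polyD comp_polyM comp_polyX comp_polyC polyCD polyCM /=.
by rewrite -mul_polyC polyCM -/(bicst _) -/(bih K) -/(bicst c); ring.
Qed.

Lemma op_dh : op_d * op_h = r *: (op_h * op_d).
Proof.
apply: operP => v n; rewrite !operE /= expfzDr // expr1z bicstM.
by ring.
Qed.

Lemma op_hu : op_h * op_u = r *: (op_u * op_h).
Proof.
apply: operP => v n; rewrite !operE /=.
have -> : r ^ n = r ^ (n - 1) * r by rewrite -[X in _ * X]expr1z -expfzDr ?subrK.
by rewrite bicstM; ring.
Qed.

(** In degree n the two products multiply by the translates n + 1 and n of w. Their z-parts differ
    exactly by the factor s, and what is left of g is - f(r^n h) by the conformality of f. *)
Lemma op_du : op_d * op_u = s *: (op_u * op_d) - horner_alg op_h f.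
Proof.
apply: operP => v n; rewrite !operE op_horner /= addrK subrK !sig_w f_conf.
rewrite comp_polyB comp_polyZ -comp_polyA comp_polyZ comp_polyX.
rewrite scalerA -!(mulrC (r ^ n)) !(expfzDr _ _ r0, expfzDr _ _ s0) !expr1z.
by rewrite bicstM polyCB -[s *: _]mul_polyC polyCM -/(bicst s); ring.
Qed.

Variables (A : algType K) (d u h : A).
Hypothesis pA : presented f r s d u h.

Lemma act_exists : exists act : {lrmorphism A -> oper K},
  [/\ act d = op_d, act u = op_u & act h = op_h].
Proof. exact: (presented_univ pA op_dh op_hu op_du). Qed.

Definition act : {lrmorphism A -> oper K} := sval (cid act_exists).
Lemma act_d : act d = op_d. Proof. by case: (svalP (cid act_exists)). Qed.
Lemma act_u : act u = op_u. Proof. by case: (svalP (cid act_exists)). Qed.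
Lemma act_h : act h = op_h. Proof. by case: (svalP (cid act_exists)). Qed.

Let dhE : d * h = r *: (h * d) := presented_dh pA.
Let huE : h * u = r *: (u * h) := presented_hu pA.
Let duE : d * u = s *: (u * d) - horner_alg h f := presented_du pA.

Local Notation hp := (horner_alg h).

Lemma d_hp p : d * hp p = hp (p \Po (r *: 'X)) * d.
Proof.
elim/poly_ind: p => [|p c IHp]; first by rewrite comp_poly0 !rmorph0 mul0r mulr0.
rewrite comp_polyD comp_polyM comp_polyX comp_polyC !rmorphD !rmorphM /=.
rewrite linearZ /= horner_algX !horner_algC mulrDr mulrDl mulr_algl mulr_algr.
by rewrite (mulrA d) IHp -(mulrA _ d) dhE -!scalerAr -!scalerAl mul1r mulrA.
Qed.

Lemma hp_u p : hp p * u = u * hp (p \Po (r *: 'X)).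
Proof.
elim/poly_ind: p => [|p c IHp]; first by rewrite comp_poly0 !rmorph0 mul0r mulr0.
rewrite comp_polyD comp_polyM comp_polyX comp_polyC !rmorphD !rmorphM /=.
rewrite linearZ /= horner_algX !horner_algC mulrDr mulrDl mulr_algl mulr_algr.
rewrite -(mulrA _ h) huE -!scalerAr (mulrA _ u) IHp ?mulr1 ?mul1r mulrA.
by rewrite mulr_algr -scalerAl -scalerAr mulrA.
Qed.

Definition gz : A := u * d - hp g.

Lemma udE : u * d = gz + hp g. Proof. by rewrite subrK. Qed.

Lemma duE' : d * u = s *: gz + hp (g \Po (r *: 'X)).
Proof.
rewrite duE udE f_conf rmorphB /= -mul_polyC rmorphM /= horner_algC mulr_algl.
by rewrite scalerDr opprB addrA addrAC addrK.
Qed.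

(** * Normal form *)

Lemma z_hp p : gz * hp p = hp p * gz.
Proof.
rewrite /gz mulrBl mulrBr -!rmorphM /= [p * g]mulrC; congr (_ - _).
by rewrite -mulrA d_hp !mulrA -hp_u.
Qed.

(** In d (u d) = (d u) d the term g(r h) d coming from d u is the one subtracted through d g(h). *)
Lemma dz : d * gz = s *: (gz * d).
Proof.
rewrite {1}/gz mulrBr mulrA duE' d_hp mulrDl addrK.
by rewrite scalerAl.
Qed.

Lemma zu : gz * u = s *: (u * gz).
Proof.
rewrite {1}/gz mulrBl -mulrA duE' hp_u mulrDr addrK.
by rewrite scalerAr.
Qed.

Lemma z_comm : commr_rmorph hp gz.
Proof. exact: z_hp. Qed.

Definition ev : R -> A := horner_morph z_comm.
HB.instance Definition _ := GRing.RMorphism.on ev.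

Lemma ev_polyC p : ev p%:P = hp p. Proof. exact: horner_morphC. Qed.
Lemma ev_z : ev 'X = gz. Proof. exact: horner_morphX. Qed.
Lemma ev_h : ev (bih K) = h. Proof. by rewrite ev_polyC horner_algX. Qed.
Lemma ev_cst c : ev (bicst c) = c%:A. Proof. by rewrite ev_polyC horner_algC. Qed.
Lemma ev_w : ev biw = u * d.
Proof. by rewrite rmorphD /= ev_z ev_polyC udE. Qed.
Lemma ev_sig_w : ev (sig 1 biw) = d * u.
Proof.
by rewrite sig_w rmorphD rmorphM /= ev_cst ev_z ev_polyC !expr1z mulr_algl duE'.
Qed.

Lemma sig1_MX p q : sig 1 (p * 'X + q%:P) =
  sig 1 p * (bicst s * 'X) + (q \Po (r *: 'X))%:P.
Proof. by rewrite rmorphD rmorphM /= sig_z sig_polyC !expr1z. Qed.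

Lemma d_ev a : d * ev a = ev (sig 1 a) * d.
Proof.
elim/poly_ind: a => [|a c IHa]; first by rewrite !rmorph0 mul0r mulr0.
rewrite sig1_MX !rmorphD !rmorphM /= ev_cst !ev_polyC ev_z.
rewrite mulrDr mulrDl (mulrA d) IHa d_hp -(mulrA _ d) dz; congr (_ + _).
by rewrite mulr_algl -mulrA -scalerAl.
Qed.

Lemma ev_u a : ev a * u = u * ev (sig 1 a).
Proof.
elim/poly_ind: a => [|a c IHa]; first by rewrite !rmorph0 mul0r mulr0.
rewrite sig1_MX !rmorphD !rmorphM /= ev_cst !ev_polyC ev_z.
rewrite [LHS]mulrDl [RHS]mulrDr -(mulrA _ gz) zu hp_u -scalerAr (mulrA _ u) IHa.
by rewrite mulr_algl -!scalerAr mulrA.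
Qed.

Lemma u_ev a : u * ev a = ev (sig (-1) a) * u.
Proof. by rewrite ev_u sigD subrr sig0. Qed.

Definition um (k : int) : A :=
  match k with Posz n => u ^+ n | Negz n => d ^+ n.+1 end.

Lemma d_um k : exists e, d * um k = ev e * um (k - 1).
Proof.
case: k => [[|n]|n].
- by exists 1; rewrite rmorph1 mul1r /= mulr1.
- exists (sig 1 biw); rewrite (_ : n.+1%:Z - 1 = n); last by lia.
  by rewrite ev_sig_w -mulrA /um exprS.
- exists 1; rewrite rmorph1 mul1r (_ : Negz n - 1 = Negz n.+1); last by lia.
  by rewrite /um -exprS.
Qed.

Lemma u_um k : exists e, u * um k = ev e * um (k + 1).
Proof.
case: k => [n|[|n]].
- exists 1; rewrite rmorph1 mul1r (_ : n%:Z + 1 = n.+1); last by lia.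
  by rewrite /um -exprS.
- by exists biw; rewrite ev_w /= mulr1.
- exists biw; rewrite ev_w (_ : Negz n.+1 + 1 = Negz n); last by lia.
  by rewrite /um -mulrA -exprS.
Qed.

Definition nform (a : {malg R[int]}) : A := mmap ev um a.

Lemma nformU k c : nform (mkmalgU k c) = ev c * um k.
Proof. exact: mmapU. Qed.

Lemma nform_mul y : (forall k c, exists k' c', y * (ev c * um k) = ev c' * um k') ->
  forall a, exists a', y * nform a = nform a'.
Proof.
move=> yU; apply: malg_indU => [|a b [a' Ea] [b' Eb]|c k].
- by exists 0; rewrite /nform !raddf0 mulr0.
- by exists (a' + b'); rewrite /nform !raddfD /= mulrDr -/(nform a) -/(nform b) Ea Eb.
- by have [k' [c' E]] := yU k c; exists (mkmalgU k' c'); rewrite !nformU.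
Qed.

(** Left multiplication by a generator preserves normal forms: d and u pass through K[h, z] at the
    cost of a twist, and then either lengthen the power or meet the opposite generator, where
    [u * d] and [d * u] fall back into K[h, z]. *)
Lemma nform_surj x : exists a, x = nform a.
Proof.
elim/(presented_ind pA): x => [|x y [a ->] [b ->]|c x [a ->]|x [a ->]|x [a ->]|x [a ->]].
- by exists (mkmalgU 0 1); rewrite nformU rmorph1 mulr1.
- by exists (a + b); rewrite /nform raddfD.
- rewrite -mulr_algl -ev_cst; apply: nform_mul => k e.
  by exists k, (bicst c * e); rewrite rmorphM mulrA.
- apply: nform_mul => k c; have [e E] := d_um k.
  by exists (k - 1), (sig 1 c * e); rewrite mulrA d_ev -mulrA E rmorphM mulrA.
- apply: nform_mul => k c; have [e E] := u_um k.
  by exists (k + 1), (sig (-1) c * e); rewrite mulrA u_ev -mulrA E rmorphM mulrA.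
- rewrite -ev_h; apply: nform_mul => k e.
  by exists k, (bih K * e); rewrite rmorphM mulrA.
Qed.
(** * Graded components *)

(* [gcoef x n] is the coefficient of [u ^ n] in the image of [x]; that of
   [d ^ k] in degree [- k] is [weight (- k)]. *)
Definition e0 (n : int) : R := (n == 0)%:R.
Definition gcoef (x : A) (n : int) : R := act x e0 n.

Lemma act_hp p v n : act (hp p) v n = (p \Po (r ^ n *: 'X))%:P * v n.
Proof. by rewrite lrmorph_horner_alg act_h op_horner. Qed.

Lemma act_z v n : act gz v n = sig n 'X * v n.
Proof.
rewrite /gz rmorphB rmorphM /= ?operE act_hp act_u act_d /= subrK sig_w sig_z.
by ring.
Qed.

Lemma act_ev a v n : act (ev a) v n = sig n a * v n.
Proof.
elim/poly_ind: a v => [|a c IHa] v; first by rewrite !rmorph0 mul0r.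
rewrite !rmorphD !rmorphM /= ?operE IHa ev_polyC ev_z act_z act_hp sig_polyC.
by rewrite mulrDl mulrA.
Qed.

Definition weight (k : int) : R :=
  match k with
  | Posz _ => 1
  | Negz n => \prod_(i < n.+1) sig (- i%:Z) biw
  end.

Lemma weight_neq0 k : weight k != 0.
Proof.
case: k => [n|n] /=; first exact: oner_neq0.
by apply/prodf_neq0 => i _; rewrite sig_eq0 w_neq0.
Qed.

Lemma size_weight k : size (weight k) = (if k is Negz n then n.+2 else 1)%N.
Proof.
case: k => [n|n] /=; first by rewrite size_poly1.
elim: n => [|n IHn]; first by rewrite big_ord1 size_sig size_w.
rewrite big_ord_recr size_mul ?IHn /= ?size_sig ?size_w ?addn2 //.
  by apply: (weight_neq0 (Negz n)).
by rewrite sig_eq0 w_neq0.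
Qed.

Lemma act_um k n : act (um k) e0 n = (n == k)%:R * weight k.
Proof.
case: k => k /=.
  rewrite mulr1; elim: k n => [|k IHk] n; first by rewrite rmorph1.
  by rewrite exprS rmorphM /= act_u /= IHk; congr (_%:R); lia.
elim: k n => [|k IHk] n.
  rewrite big_ord1 act_d /= oppr0 /e0 (_ : (n == Negz 0) = (n + 1 == 0)); last by lia.
  by have [->|_] := eqVneq (n + 1) 0; rewrite ?mulr0 ?mul0r ?mul1r ?mulr1.
rewrite exprS rmorphM /= act_d /= IHk [in RHS]big_ord_recr /=.
rewrite (_ : (n == Negz k.+1) = (n + 1 == Negz k)); last by lia.
have [->|_] := eqVneq (n + 1) (Negz k); last by rewrite !mul0r mulr0.
by rewrite NegzE !mul1r mulrC.
Qed.

Lemma gcoefD x y n : gcoef (x + y) n = gcoef x n + gcoef y n.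
Proof. by rewrite /gcoef rmorphD. Qed.
Lemma gcoefB x y n : gcoef (x - y) n = gcoef x n - gcoef y n.
Proof. by rewrite /gcoef rmorphB. Qed.
Lemma gcoefZ c x n : gcoef (c *: x) n = bicst c * gcoef x n.
Proof. by rewrite /gcoef linearZ. Qed.
Lemma gcoef0 n : gcoef 0 n = 0.
Proof. by rewrite /gcoef rmorph0. Qed.

Lemma gcoef_evM a x n : gcoef (ev a * x) n = sig n a * gcoef x n.
Proof. by rewrite /gcoef rmorphM /= act_ev. Qed.

Lemma gcoef_um k n : gcoef (um k) n = (n == k)%:R * weight k.
Proof. exact: act_um. Qed.

Lemma gcoef_ev a n : gcoef (ev a) n = (n == 0)%:R * a.
Proof.
rewrite /gcoef act_ev /e0; have [->|_] := eqVneq n 0; last by rewrite mul0r mulr0.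
by rewrite sig0 mulr1 mul1r.
Qed.

Lemma gcoef_nform a n : gcoef (nform a) n = sig n a@_n * weight n.
Proof.
rewrite /nform /mmap /gcoef linear_sum /=.
have -> (X : seq int) (F : int -> oper K) v :
    (\sum_(k <- X) F k) v n = \sum_(k <- X) F k v n.
  by elim: X => [|k X IHX]; rewrite ?big_nil // !big_cons operE IHX.
have E k : act (ev a@_k * um k) e0 n = (n == k)%:R * (sig n a@_k * weight k).
  by rewrite -/(gcoef _ _) gcoef_evM gcoef_um mulrCA.
under eq_bigr => k _ do rewrite E.
have [an|nan] := boolP (n \in msupp a).
  rewrite (bigD1_seq n) ?fset_uniq //= eqxx mul1r big1 ?addr0 // => k.
  by rewrite eq_sym => /negPf ->; rewrite mul0r.
rewrite mcoeff_outdom // rmorph0 mul0r big_seq big1 // => k ka.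
case: eqP => [nk|_]; last by rewrite mul0r.
by rewrite -nk (negPf nan) in ka.
Qed.

(** The degree n coefficient of a normal form is a twist of its n-th entry times a nonzero weight,
    so the entries can be recovered. This gives both the faithfulness of the action and the
    uniqueness of normal forms. *)
Lemma gcoef_inj x : (forall n, gcoef x n = 0) -> x = 0.
Proof.
have [a ->] := nform_surj x => cx.
suff -> : a = 0 by rewrite /nform raddf0.
apply/malgP => n; move/eqP: (cx n).
by rewrite gcoef_nform mulf_eq0 (negPf (weight_neq0 n)) orbF sig_eq0 mcoeff0 => /eqP.
Qed.

Lemma gcoef_ext x y : (forall n, gcoef x n = gcoef y n) -> x = y.
Proof.
move=> xy; apply/eqP; rewrite -subr_eq0; apply/eqP/gcoef_inj => n.
by rewrite gcoefB xy subrr.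
Qed.

Lemma gcoef_support x : exists X : seq int,
  uniq X /\ forall n, n \notin X -> gcoef x n = 0.
Proof.
have [a ->] := nform_surj x; exists (msupp a : seq int); split=> [|n nX].
  exact: fset_uniq.
by rewrite gcoef_nform mcoeff_outdom // rmorph0 mul0r.
Qed.

(** The coefficient is a nonzero multiple of [weight (Negz n)], whose degree in z is n + 1. *)
Lemma size_gcoef_neg x n : gcoef x (Negz n) != 0 -> (n.+2 <= size (gcoef x (Negz n)))%N.
Proof.
have [a ->] := nform_surj x; rewrite gcoef_nform mulf_eq0 negb_or => /andP[a0 w0].
by rewrite size_mul // size_weight; move: a0; rewrite -size_poly_gt0; lia.
Qed.

Definition homog (k : int) (x : A) := forall n, n != k -> gcoef x n = 0.

Lemma homogP k x : homog k x -> exists a, x = ev a * um k.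
Proof.
have [a ->] := nform_surj x => ka; exists a@_k; rewrite -nformU; congr nform.
apply/malgP => n; rewrite mcoeffU; have [->|nk] := eqVneq k n; first by [].
have := ka n; rewrite eq_sym nk => /(_ isT)/eqP.
by rewrite gcoef_nform mulf_eq0 (negPf (weight_neq0 n)) orbF sig_eq0 => /eqP.
Qed.

(* Right translation by [u ^ j]. *)
Definition shift (j : int) (v : V) : V := fun n => sig j (v (n - j)).

(** Left multiplications commute with right translations. The twist [sig j] in [shift] is the price
    of moving right coefficients past u ^ j. *)
Lemma act_shift x j v n : act x (shift j v) n = shift j (act x v) n.
Proof.
elim/(presented_ind pA): x n => [|x y Hx Hy|c x Hx|x Hx|x Hx|x Hx] n.
- by rewrite rmorph1.
- by rewrite rmorphD /= Hx Hy /shift rmorphD.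
- by rewrite linearZ /= ?operE Hx /shift /= rmorphM /= sig_cst.
- rewrite rmorphM /= act_d /= Hx /shift /= rmorphM /= sigD.
  by congr (sig _ _ * sig j (act x v _)); lia.
- by rewrite rmorphM /= act_u /= Hx /shift /=; congr (sig j (act x v _)); lia.
- rewrite rmorphM /= act_h /= Hx /shift /= !rmorphM /= sig_h sig_cst.
  rewrite (_ : r ^ n = r ^ (n - j) * r ^ j) ?bicstM; last by rewrite -expfzDr ?subrK.
  by ring.
Qed.

(** This is the product rule u^i a u^j b = u^(i + j) sigma^j(a) b, summed over a finite set X
    containing the support of y. *)
Lemma gcoefM x y X k : uniq X -> (forall n, n \notin X -> gcoef y n = 0) ->
  gcoef (x * y) k = \sum_(j <- X) sig j (gcoef x (k - j)) * gcoef y j.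
Proof.
move=> uX yX; rewrite {1}/gcoef rmorphM /=.
(* The image of y is a combination of translates of [e0], and by [act_shift] the action of x on a
   translate is known from its action on [e0]. *)
have -> : act y e0 = fun n => \sum_(j <- X) gcoef y j * shift j e0 n.
  apply/funext => n; rewrite -/(gcoef y n).
  have E j : shift j e0 n = (n == j)%:R.
    by rewrite /shift /e0 rmorph_nat subr_eq0.
  under eq_bigr => j _ do rewrite E.
  have [nX|nX] := boolP (n \in X).
    rewrite (bigD1_seq n) //= eqxx mulr1 big1 ?addr0 // => j.
    by rewrite eq_sym => /negPf ->; rewrite mulr0.
  rewrite yX // big_seq big1 // => j jX.
  case: eqP => [nj|_]; last by rewrite mulr0.
  by rewrite -nj (negPf nX) in jX.
rewrite oper_sum; apply: eq_bigr => j _.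
by rewrite operZ act_shift mulrC.
Qed.
(** * Degrees *)
Implicit Types x y : A.

(** The factor e, later 1 or -1, lets a single argument serve for top and bottom degrees. *)
Lemma seq_extremum (e : int) (P : pred int) (X : seq int) : has P X ->
  exists2 n, P n & forall m, m \in X -> P m -> (e * m <= e * n)%R.
Proof.
elim: X => //= k X IHX; have [PX _|PX] := boolP (has P X).
  have [n Pn nX] := IHX PX.
  have [ekn|ekn] := leP (e * k) (e * n).
    by exists n => // m; rewrite inE => /predU1P[->|/nX].
  have [Pk|Pk] := boolP (P k).
    exists k => // m; rewrite inE => /predU1P[->|mX] // /(nX _ mX) emn.
    by apply: le_trans emn (ltW ekn).
  by exists n => // m; rewrite inE => /predU1P[->|/nX]; rewrite ?(negPf Pk).
rewrite orbF => Pk; exists k => // m; rewrite inE => /predU1P[->|mX] // Pm.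
by case/hasP: PX; exists m.
Qed.

(* Bounds the degrees of [x] from above if [e = 1], from below if [e = -1]. *)
Definition bounded (e n : int) (x : A) :=
  forall m, (e * n < e * m)%R -> gcoef x m = 0.

Lemma extreme_degree e x : x != 0 -> exists2 n, gcoef x n != 0 & bounded e n x.
Proof.
move=> x0; have [X [_ xX]] := gcoef_support x.
have : has (fun n => gcoef x n != 0) X.
  apply: contraNT x0 => /hasPn nX; apply/eqP/gcoef_inj => n.
  by have [/nX|/xX//] := boolP (n \in X); rewrite negbK => /eqP.
case/(seq_extremum e) => n xn nX; exists n => // m; apply: contraTeq => xm.
rewrite -leNgt; apply: nX => //; apply: contraNT xm => /xX ->; exact: eqxx.
Qed.

Definition sign (e : int) := e = 1 \/ e = -1.

(** Any other splitting of n + m into two degrees takes one of them beyond its bound, so one term of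
    the product rule survives. *)
Lemma gcoefM_extreme e n m x y : sign e -> bounded e n x -> bounded e m y ->
  gcoef (x * y) (n + m) = sig m (gcoef x n) * gcoef y m.
Proof.
move=> se xn ym; have [X [uX yX]] := gcoef_support y.
rewrite (gcoefM x _ uX yX).
have Z j : j != m -> sig j (gcoef x (n + m - j)) * gcoef y j = 0.
  move=> jm; have [emj|ejm] := ltP (e * m) (e * j); first by rewrite ym ?mulr0.
  rewrite xn ?rmorph0 ?mul0r //; case: se ejm jm => -> /=; lia.
have [mX|mX] := boolP (m \in X).
  rewrite (bigD1_seq m) //= big1 ?addr0 ?addrK // => j; exact: Z.
rewrite (yX _ mX) mulr0 big_seq big1 // => j jX; apply: Z.
by apply: contraNneq mX => <-.
Qed.

Lemma bounded_neq0 e n m x : sign e -> bounded e n x -> gcoef x m != 0 ->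
  (e * m <= e * n)%R.
Proof. by move=> se xn; apply: contraR; rewrite -ltNge => /xn ->. Qed.

Lemma A_mulf_neq0 x y : x != 0 -> y != 0 -> x * y != 0.
Proof.
move=> x0 y0; have [n xn xb] := extreme_degree 1 x0.
have [m ym yb] := extreme_degree 1 y0.
have := gcoefM_extreme (or_introl erefl) xb yb; apply: contra_eq_neq => ->.
by rewrite gcoef0 eq_sym mulf_neq0 // sig_eq0.
Qed.

Lemma homog_extreme n x : bounded 1 n x -> bounded (-1) n x -> homog n x.
Proof.
move=> x1 x2 m mn; case: (ltgtP m n) mn => // mn _.
  by apply: x2; lia.
by apply: x1; lia.
Qed.

(** Top degrees add up to k and so do bottom degrees; as no top lies below its bottom, they coincide
    in each factor. *)
Lemma homog_factor k x y : x != 0 -> y != 0 -> homog k (x * y) ->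
  exists n m : int, [/\ n + m = k, homog n x & homog m y].
Proof.
move=> x0 y0 xyk.
have [n xn xb] := extreme_degree 1 x0; have [m ym yb] := extreme_degree 1 y0.
have [n' xn' xb'] := extreme_degree (-1) x0.
have [m' ym' yb'] := extreme_degree (-1) y0.
have ek i j : sig j (gcoef x i) * gcoef y j != 0 ->
    gcoef (x * y) (i + j) = sig j (gcoef x i) * gcoef y j -> i + j = k.
  move=> ne E; apply/eqP; apply: contraNT ne => /xyk xy0.
  by rewrite -E xy0 eqxx.
have e1 : n + m = k.
  apply: (ek n m); first by rewrite mulf_neq0 // sig_eq0.
  by apply: (gcoefM_extreme (or_introl erefl)).
have e2 : n' + m' = k.
  apply: (ek n' m'); first by rewrite mulf_neq0 // sig_eq0.
  by apply: (gcoefM_extreme (or_intror erefl)).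
have := bounded_neq0 (or_introl erefl) xb xn'.
have := bounded_neq0 (or_introl erefl) yb ym' => lem len.
have [en em] : n' = n /\ m' = m by lia.
exists n, m; split=> //; apply: homog_extreme => //; first by rewrite -en.
by rewrite -em.
Qed.

Lemma gcoefM_homogr m x y k : homog m y ->
  gcoef (x * y) k = sig m (gcoef x (k - m)) * gcoef y m.
Proof.
move=> ym; rewrite (gcoefM x (X := [:: m]) k) // ?big_seq1 // => n.
by rewrite inE => /ym.
Qed.

Lemma gcoefM_homogl n x y k : homog n x ->
  gcoef (x * y) k = sig (k - n) (gcoef x n) * gcoef y (k - n).
Proof.
move=> xn; have [X [uX yX]] := gcoef_support y; rewrite (gcoefM x _ uX yX).
have Z j : j != k - n -> sig j (gcoef x (k - j)) * gcoef y j = 0.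
  by move=> jkn; rewrite xn ?rmorph0 ?mul0r //; lia.
have [kX|kX] := boolP (k - n \in X).
  by rewrite (bigD1_seq (k - n)) //= big1 ?addr0 ?subKr.
rewrite (yX _ kX) mulr0 big_seq big1 // => j jX; apply: Z.
by apply: contraNneq kX => <-.
Qed.

Lemma homog_um k : homog k (um k).
Proof. by move=> n nk; rewrite gcoef_um (negPf nk) mul0r. Qed.
Lemma um_u : um 1 = u. Proof. exact: expr1. Qed.
Lemma um_d : um (-1) = d. Proof. exact: expr1. Qed.
Lemma homog_u : homog 1 u. Proof. by rewrite -um_u; apply: homog_um. Qed.
Lemma homog_d : homog (-1) d. Proof. by rewrite -um_d; apply: homog_um. Qed.
Lemma homog_ev a : homog 0 (ev a).
Proof. by move=> n n0; rewrite gcoef_ev (negPf n0) mul0r. Qed.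
Lemma homogZ k c x : homog k x -> homog k (c *: x).
Proof. by move=> xk n /xk; rewrite gcoefZ => ->; rewrite mulr0. Qed.

Lemma gcoef_u1 : gcoef u 1 = 1.
Proof. by rewrite -um_u gcoef_um mul1r. Qed.
Lemma gcoef_d1 : gcoef d (-1) = biw.
Proof. by rewrite -um_d gcoef_um mul1r /= big_ord1 oppr0 sig0. Qed.
Lemma gcoef_ev0 a : gcoef (ev a) 0 = a.
Proof. by rewrite gcoef_ev mul1r. Qed.

Lemma ev_inj : injective ev.
Proof. by move=> a b /(congr1 (gcoef^~ 0)); rewrite !gcoef_ev0. Qed.

Lemma homog0_ev x : homog 0 x -> x = ev (gcoef x 0).
Proof.
move=> x0; apply: gcoef_ext => n; rewrite gcoef_ev.
by have [->|/x0 ->] := eqVneq n 0; rewrite ?mul1r ?mul0r.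
Qed.

Lemma u_neq0 : u != 0.
Proof. by apply: contra_eq_neq gcoef_u1 => ->; rewrite gcoef0 eq_sym oner_neq0. Qed.
Lemma d_neq0 : d != 0.
Proof. by apply: contra_eq_neq gcoef_d1 => ->; rewrite gcoef0 eq_sym w_neq0. Qed.
Lemma bih_neq0 : bih K != 0. Proof. by rewrite polyC_eq0 polyX_eq0. Qed.
Lemma h_neq0 : h != 0.
Proof.
rewrite -ev_h; apply: contraNneq bih_neq0 => h0.
by rewrite -(gcoef_ev0 (bih K)) h0 gcoef0.
Qed.

(** * Irreducible elements *)

Definition scalar_elt (x : A) := exists c : K, x = c%:A.
Definition irr (x : A) := forall y z, x = y * z -> scalar_elt y \/ scalar_elt z.

Lemma scalar_ev x (a : {poly K}) : homog 0 x -> gcoef x 0 = a%:P ->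
  (size a <= 1)%N -> scalar_elt x.
Proof.
move=> x0 cx /size1_polyC ca; exists a`_0.
by rewrite (homog0_ev x0) cx [in LHS]ca -ev_cst.
Qed.

(* Twice the degree in z plus the degree in u is additive, and at least the
   absolute value of the degree in u. *)
Lemma homog_degree k x : homog k x -> x != 0 ->
  2 <= (size (gcoef x k)).*2%:Z /\ 2 - k <= (size (gcoef x k)).*2%:Z + k.
Proof.
move=> xk x0; have c0 : gcoef x k != 0.
  by apply: contraNneq x0 => c0; apply/eqP/gcoef_inj => n; have [->|/xk] := eqVneq n k.
case: k xk c0 => n xk c0; last by have := size_gcoef_neg c0; lia.
by move: c0; rewrite -size_poly_gt0; lia.
Qed.

(** Sizes exceed degrees in z by one. Hence the bound 3 says that the total degree of the product,
    counting z twice and u once, is at most 1. One factor then has total degree 0, and therefore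
    degree 0 in u and in z. *)
Lemma degree_split (n m k : int) (a b : nat) : n + m = k ->
  (0 < a)%N -> (0 < b)%N -> 2 - n <= a.*2%:Z + n -> 2 - m <= b.*2%:Z + m ->
  (a + b).-1.*2%:Z + k <= 3 ->
  (n = 0 /\ (a <= 1)%N) \/ (m = 0 /\ (b <= 1)%N).
Proof. lia. Qed.

Lemma irr_factor k x y : x != 0 -> y != 0 -> homog k (x * y) ->
  (size (gcoef (x * y) k)).*2%:Z + k <= 3 ->
  exists n m : int, [/\ n + m = k, homog n x, homog m y,
    gcoef (x * y) k = sig m (gcoef x n) * gcoef y m &
    (n = 0 /\ (size (gcoef x n) <= 1)%N) \/ (m = 0 /\ (size (gcoef y m) <= 1)%N)].
Proof.
move=> x0 y0 xyk.
have [n [m [nm xn ym]]] := homog_factor x0 y0 xyk.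
have E : gcoef (x * y) k = sig m (gcoef x n) * gcoef y m.
  by rewrite (gcoefM_homogr _ _ ym) -nm addrK.
have cx0 : gcoef x n != 0.
  by apply: contraNneq x0 => c0; apply/eqP/gcoef_inj => i; have [->|/xn] := eqVneq i n.
have cy0 : gcoef y m != 0.
  by apply: contraNneq y0 => c0; apply/eqP/gcoef_inj => i; have [->|/ym] := eqVneq i m.
rewrite E size_mul ?sig_eq0 // size_sig => le; exists n, m; split=> //.
have [A1 A2] := homog_degree xn x0; have [B1 B2] := homog_degree ym y0.
by apply: (degree_split nm _ _ A2 B2 le); rewrite size_poly_gt0.
Qed.

Lemma scalar_bicst x c : homog 0 x -> gcoef x 0 = bicst c -> scalar_elt x.
Proof. by move=> x0 cx; exists c; rewrite (homog0_ev x0) cx ev_cst. Qed.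

Lemma monic_factor (a b : R) : a * b \is monic -> (size a <= 1)%N ->
  exists c, a = bicst c.
Proof.
rewrite monicE lead_coefM => /eqP ab /size1_polyC a1.
have : size (lead_coef a * lead_coef b) = 1 by rewrite ab size_poly1.
move/eqP; rewrite size_mul_eq1 => /andP[/eqP sa _].
move: sa; rewrite {1}a1 lead_coefC => /eqP/size_poly1P [c _ ac].
by exists c; rewrite a1 ac.
Qed.

(** By the degree count one factor lies in K[h]; monicity in z makes its leading coefficient divide
    1, so it is a scalar. *)
Lemma irr_monic k x : x != 0 -> homog k x -> gcoef x k \is monic ->
  (size (gcoef x k)).*2%:Z + k <= 3 -> irr x.
Proof.
move=> x0 xk mx sx y z xE.
have [y0 z0] : y != 0 /\ z != 0.
  by split; apply: contraNneq x0 => e0; rewrite xE e0 ?mul0r ?mulr0.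
rewrite xE in xk mx sx.
have [n [m [nm yn zm E [[n0 sn]|[m0 sm]]]]] := irr_factor y0 z0 xk sx.
  left; move: mx; rewrite E => /monic_factor.
  rewrite size_sig => /(_ sn) [c /(congr1 (sig (- m)))].
  by rewrite sigK sig_cst n0 => /scalar_bicst; apply; rewrite -n0.
right; move: mx; rewrite E mulrC => /monic_factor/(_ sm) [c].
by rewrite m0 => /scalar_bicst; apply; rewrite -m0.
Qed.

Lemma irr_u : irr u.
Proof.
apply: (irr_monic u_neq0 homog_u); rewrite gcoef_u1 ?monic1 //.
by rewrite size_poly1.
Qed.

Lemma irr_d : irr d.
Proof.
apply: (irr_monic d_neq0 homog_d); rewrite gcoef_d1; first exact: monicXaddC.
by rewrite size_w.
Qed.

Lemma homog_h : homog 0 h. Proof. by rewrite -ev_h; apply: homog_ev. Qed.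
Lemma gcoef_h : gcoef h 0 = bih K. Proof. by rewrite -[in LHS]ev_h gcoef_ev0. Qed.

(** As h is not monic in z, [irr_monic] does not apply: both factors are brought into K[h], where
    degrees in h decide. *)
Lemma irr_h : irr h.
Proof.
move=> y z hE.
have [y0 z0] : y != 0 /\ z != 0.
  by split; apply: contraNneq h_neq0 => e0; rewrite hE e0 ?mul0r ?mulr0.
have h0 := homog_h; have ch := gcoef_h; rewrite hE in h0 ch.
have sh : (size (gcoef (y * z) 0)).*2%:Z + 0 <= 3.
  by rewrite ch size_polyC polyX_eq0.
have [n [m [nm yn zm E D]]] := irr_factor y0 z0 h0 sh.
have [n0 m0] : n = 0 /\ m = 0 by case: D => -[]; lia.
rewrite n0 m0 in yn zm E; rewrite ch sig0 in E.
have /eqP := congr1 (size \o @polyseq _) E.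
rewrite /= size_polyC polyX_eq0 /= eq_sym size_mul_eq1 => /andP[/size_poly1P [a _ ya]].
case/size_poly1P => b _ zb.
have /eqP := congr1 (fun p : R => size p`_0) E.
rewrite ya zb -polyCM !coefC /= size_polyX => sab.
have a0 : a != 0 by apply: contraTneq sab => ->; rewrite mul0r size_poly0.
have b0 : b != 0 by apply: contraTneq sab => ->; rewrite mulr0 size_poly0.
move: sab; rewrite size_mul //; move: a0 b0; rewrite -!size_poly_gt0 => a0 b0 sab.
have [sa|sb] : (size a <= 1)%N \/ (size b <= 1)%N by lia.
  by left; apply: (scalar_ev yn ya).
by right; apply: (scalar_ev zm zb).
Qed.

Lemma scalar_homog x : scalar_elt x -> homog 0 x.
Proof. by move=> [c ->]; rewrite -ev_cst; apply: homog_ev. Qed.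

Lemma homog_unique i j x : homog i x -> homog j x -> x != 0 -> i = j.
Proof.
move=> xi xj; apply: contraNeq => ij; apply/eqP/gcoef_inj => n.
by have [->|/xi] := eqVneq n i; first exact: xj.
Qed.

(** In nonzero degree the normal form ends in u or d. Splitting off this last letter, which is not a
    scalar because of its degree, makes the remaining factor a scalar. *)
Lemma irr_homog n x : homog n x -> irr x ->
  [\/ exists c, x = c *: u, exists c, x = c *: d | exists a, x = ev a].
Proof.
move=> /homogP [a xE] irx; case: n xE => [[|n]|n] /= xE.
- by constructor 3; exists a; rewrite xE mulr1.
- constructor 1; move: xE; rewrite exprSr mulrA => xE.
  have [[c ec]|/scalar_homog u0] := irx _ _ xE.
    by exists c; rewrite xE ec mulr_algl.
  by have := homog_unique homog_u u0 u_neq0.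
- constructor 2; move: xE; rewrite exprSr mulrA => xE.
  have [[c ec]|/scalar_homog d0] := irx _ _ xE.
    by exists c; rewrite xE ec mulr_algl.
  by have := homog_unique homog_d d0 d_neq0.
Qed.

(** * Normal elements *)

Definition normal_elt (w : A) := forall x, exists y, w * x = y * w.

Lemma normal_gen w : (exists y, w * d = y * w) -> (exists y, w * u = y * w) ->
  (exists y, w * h = y * w) -> normal_elt w.
Proof.
move=> [d' wd] [u' wu] [h' wh].
apply: (presented_ind pA) => [|x y [x' Hx] [y' Hy]|c x [x' Hx]
  |x [x' Hx]|x [x' Hx]|x [x' Hx]].
- by exists 1; rewrite mulr1 mul1r.
- by exists (x' + y'); rewrite mulrDr mulrDl Hx Hy.
- by exists (c *: x'); rewrite -scalerAr Hx scalerAl.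
- by exists (d' * x'); rewrite mulrA wd -mulrA Hx mulrA.
- by exists (u' * x'); rewrite mulrA wu -mulrA Hx mulrA.
- by exists (h' * x'); rewrite mulrA wh -mulrA Hx mulrA.
Qed.

Lemma swap_scale c x y : c != 0 -> x * y = c *: (y * x) -> y * x = c^-1 *: (x * y).
Proof. by move=> c0 ->; rewrite scalerA mulVf // scale1r. Qed.

Lemma normal_h : normal_elt h.
Proof.
apply: normal_gen; last by exists h.
  by exists (r^-1 *: d); rewrite (swap_scale r0 dhE) scalerAl.
by exists (r *: u); rewrite huE scalerAl.
Qed.

Hypothesis r_free : forall k : int, k != 0 -> r ^ k != 1.

Lemma r_inj i j : r ^ i = r ^ j -> i = j.
Proof.
move=> rij; apply/eqP; rewrite -subr_eq0; apply: contraTT isT => /r_free.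
by rewrite expfzDr // rij -expfzDr // subrr eqxx.
Qed.

Lemma r_neq1 : r != 1. Proof. exact: (r_free (k := 1)). Qed.

Lemma gcoef_neq0 x : x != 0 -> exists n, gcoef x n != 0.
Proof. by case/(extreme_degree 1) => n xn _; exists n. Qed.

(** Normality is tested on h alone: x h = y x. Right multiplication by h keeps the support of x,
    which confines y to degree 0; then y h^-1 would have to be r^-k for every degree k of x, and
    this allows one k only. *)
Lemma normal_homog x : x != 0 -> normal_elt x -> exists n, homog n x.
Proof.
move=> x0 /(_ h) [y xhE].
have y0 : y != 0.
  by apply: contraNneq (A_mulf_neq0 x0 h_neq0) => y0; rewrite xhE y0 mul0r.
have xh k : gcoef (x * h) k = gcoef x k * bih K.
  by rewrite (gcoefM_homogr _ _ homog_h) gcoef_h subr0 sig0.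
have supp k : gcoef (y * x) k != 0 -> gcoef x k != 0.
  by rewrite -xhE xh; apply: contraNneq => ->; rewrite mul0r.
have yhom : homog 0 y.
  (* The product y x reaches the extreme degree m + n, which must already occur in x; hence the top
     of y is at most 0 and its bottom at least 0. *)
  have P e n m : sign e -> gcoef x n != 0 -> bounded e n x -> gcoef y m != 0 ->
      bounded e m y -> e * m <= 0.
    move=> se xn xb ym yb; have : gcoef x (m + n) != 0.
      by apply: supp; rewrite (gcoefM_extreme se) // mulf_neq0 ?sig_eq0.
    by move/(bounded_neq0 se xb); rewrite mulrDr; lia.
  have [n xn xb] := extreme_degree 1 x0; have [n' xn' xb'] := extreme_degree (-1) x0.
  have [m ym yb] := extreme_degree 1 y0; have [m' ym' yb'] := extreme_degree (-1) y0.
  have := P 1 _ _ (or_introl erefl) xn xb ym yb.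
  have := P (-1) _ _ (or_intror erefl) xn' xb' ym' yb'.
  have := bounded_neq0 (or_introl erefl) yb ym' => l1 l2 l3.
  have [em em'] : m = 0 /\ m' = 0 by lia.
  by apply: homog_extreme; rewrite -?em // em -em'.
have key k : gcoef x k != 0 -> sig k (gcoef y 0) = bih K.
  move=> xk; apply: (mulIf xk); rewrite [RHS]mulrC -xh xhE.
  by rewrite (gcoefM_homogl _ _ yhom) subr0.
have [n xn] := gcoef_neq0 x0; exists n => m mn.
apply/eqP; apply: contraNT mn => /key Em; apply/eqP/r_inj.
have := key n xn; rewrite -(subrK m n) -sigD Em sig_h.
move=> /(congr1 (fun p : R => p`_0`_1)).
rewrite /= coef_bicstM !coefC /= coefX /= mulr1 => rnm.
by rewrite expfzDr // rnm mul1r.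
Qed.

Lemma gcoef_weight x n : exists a, gcoef x n = a * weight n.
Proof.
by have [a ->] := nform_surj x; exists (sig n a@_n); rewrite gcoef_nform.
Qed.

(** The degree in z forces b into K[h]; the coefficient of z then gives b = s^j, and the constant
    term gives the relation on g. For j = 1 and j = -1 it amounts to f = 0. *)
Lemma w_assoc j (b : R) : sig j biw = b * biw -> s ^ j *: g = g \Po (r ^ j *: 'X).
Proof.
move=> E; have b0 : b != 0.
  apply: contraTneq (w_neq0) => b0; move/eqP: E.
  by rewrite b0 mul0r sig_eq0 => ->.
have sb : (size b <= 1)%N.
  have : size (sig j biw) = size (b * biw) by rewrite E.
  by rewrite size_sig size_mul // ?w_neq0 // size_w addn2 => -[<-].
move: E; rewrite sig_w (size1_polyC sb) => E.
have := congr1 (fun p : R => p`_1) E; have := congr1 (fun p : R => p`_0) E.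
rewrite /= /biw !coefCM !coefD !coefCM !coefX !coefC /= mulr0 mulr1 !add0r !addr0.
by rewrite mulr1 => -> <-; rewrite mul_polyC.
Qed.

Lemma w_assoc1 b : sig 1 biw = b * biw -> f = 0.
Proof. by move/w_assoc; rewrite !expr1z f_conf => ->; rewrite subrr. Qed.

Lemma w_assocN1 b : sig (-1) biw = b * biw -> f = 0.
Proof.
move/w_assoc/(congr1 (fun p => s *: (p \Po (r *: 'X)))).
rewrite comp_polyZ scalerA -[X in X * _]expr1z -expfzDr // subrr scale1r.
rewrite -comp_polyA comp_polyZ comp_polyX scalerA -[X in _ * X]expr1z -expfzDr //.
by rewrite addNr scale1r comp_polyXr f_conf => ->; rewrite subrr.
Qed.

(** In degree 0 the equation reads w = sigma(y'), where y' is the coefficient of y in degree -1.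
    Being a multiple of w, it makes w divide its own translate. *)
Lemma ud_skew y : u * d = y * u -> f = 0.
Proof.
move/(congr1 (gcoef^~ 0)) => /=.
rewrite (gcoefM_homogr _ _ homog_d) (gcoefM_homogr _ _ homog_u) !sub0r opprK.
rewrite gcoef_u1 gcoef_d1 rmorph1 mul1r mulr1.
have [a ->] := gcoef_weight y (-1); rewrite /= big_ord1 oppr0 sig0.
move/(congr1 (sig (-1))); rewrite sigD addNr sig0; exact: w_assocN1.
Qed.

Lemma du_skew y : d * u = y * d -> f = 0.
Proof.
move/(congr1 (gcoef^~ 0)) => /=.
rewrite (gcoefM_homogr _ _ homog_d) (gcoefM_homogr _ _ homog_u) !sub0r opprK.
by rewrite gcoef_u1 gcoef_d1 mulr1; apply: w_assoc1.
Qed.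

Lemma gcoefM_neq0 x y n : gcoef (x * y) n != 0 ->
  exists j, gcoef x (n - j) != 0 /\ gcoef y j != 0.
Proof.
have [X [uX yX]] := gcoef_support y; rewrite (gcoefM x _ uX yX) => nz.
have /hasP [j _ jn] : has (fun j => (gcoef x (n - j) != 0) && (gcoef y j != 0)) X.
  apply: contraNT nz => /hasPn nX; rewrite big_seq big1 // => j /nX.
  by rewrite negb_and !negbK => /orP[]/eqP ->; rewrite ?rmorph0 ?mul0r ?mulr0.
by exists j; apply/andP.
Qed.

Definition supported (S : int -> Prop) x := forall n, gcoef x n != 0 -> S n.

Lemma supported_homog (S : int -> Prop) k x : homog k x -> S k -> supported S x.
Proof.
move=> xk Sk n xn; suff -> : n = k by [].
by apply/eqP; apply: contraNT xn => /xk ->.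
Qed.

Lemma image_supported (e : {lrmorphism A -> A}) (S : int -> Prop) :
  S 0 -> (forall a b, S a -> S b -> S (a + b)) ->
  supported S (e d) -> supported S (e u) -> supported S (e h) ->
  forall x, supported S (e x).
Proof.
move=> S0 SD Sd Su Sh.
have SM x y : supported S x -> supported S y -> supported S (x * y).
  move=> Sx Sy n /gcoefM_neq0 [j [xj yj]].
  by rewrite -(subrK j n); apply: SD; [apply: Sx | apply: Sy].
apply: (presented_ind pA) => [|x y Hx Hy|c x Hx|x Hx|x Hx|x Hx].
- rewrite rmorph1; apply: (supported_homog _ S0).
  by apply: scalar_homog; exists 1; rewrite scale1r.
- move=> n; rewrite rmorphD gcoefD; have [->|/Hx//] := eqVneq (gcoef (e x) n) 0.
  by rewrite add0r; apply: Hy.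
- move=> n; rewrite linearZ gcoefZ; have [->|/Hx//] := eqVneq (gcoef (e x) n) 0.
  by rewrite mulr0 eqxx.
- by rewrite rmorphM; apply: SM.
- by rewrite rmorphM; apply: SM.
- by rewrite rmorphM; apply: SM.
Qed.

(** Monomials diagonalize sigma, so every monomial occurring in an eigenvector determines the
    eigenvalue. *)
Lemma coef_tw_eigen j c (p : R) k i :
  sig j p = bicst c * p -> p`_k`_i != 0 -> (s ^ j) ^+ k * (r ^ j) ^+ i = c.
Proof.
move=> /(congr1 (fun q : R => q`_k`_i)); rewrite coef_bicstM coef_tw => E pki.
exact: (mulIf pki).
Qed.

Lemma bicoef_neq0 (p : R) : p != 0 -> exists k i, p`_k`_i != 0.
Proof.
rewrite -lead_coef_eq0 => p0; exists (size p).-1, (size p`_(size p).-1).-1.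
by rewrite -!lead_coefE lead_coef_eq0.
Qed.

Lemma coef1_sig j (p : R) k :
  (sig j p)`_k = (s ^ j) ^+ k *: (p`_k \Po (r ^ j *: 'X)).
Proof.
by apply/polyP => i; rewrite coef_tw coefZ coef_comp_scale mulrA.
Qed.

(** Since sigma preserves the degree in z, and the degree in h of the leading coefficient in z, b
    has degree 0 in both variables. *)
Lemma sig_eigen j (b p : R) : p != 0 -> sig j p = b * p ->
  exists2 c, c != 0 & b = bicst c.
Proof.
move=> p0 E; have b0 : b != 0.
  by apply: contraNneq p0 => b0; rewrite -(sig_eq0 j) E b0 mul0r.
have sb : (size b <= 1)%N.
  have : size (sig j p) = size (b * p) by rewrite E.
  rewrite size_sig size_mul //; move: p0; rewrite -size_poly_gt0.
  case: (size p) => // n _; rewrite addnS /= => /eqP.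
  by rewrite -[X in X == _]addn1 addnC eqn_add2r => /eqP <-.
have bE := size1_polyC sb; rewrite bE polyC_eq0 in b0; rewrite bE in E *.
have : size (sig j p)`_(size p).-1 = size (b`_0 * lead_coef p) by rewrite E coefCM.
rewrite coef1_sig size_scale ?expf_neq0 ?expfz_neq0 // size_comp_poly2; last first.
  by rewrite size_scale ?size_polyX ?expfz_neq0.
have q0 : lead_coef p != 0 by rewrite lead_coef_eq0.
rewrite -/(lead_coef p) size_mul // => Es.
have /size_poly1P [c c0 ->] : size b`_0 == 1%N; last by exists c.
move: b0 q0 Es; rewrite -!size_poly_gt0.
move: (size b`_0) (size (lead_coef p)) => [|m] [|k] //= _ _.
by rewrite addnS => -[] /eqP; rewrite -[X in X == _]add0n eqn_add2r => /eqP <-.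
Qed.

(** * Images of the generators under an automorphism *)

Section Automorphism.
Variables phi psi : {lrmorphism A -> A}.
Hypotheses (phiK : cancel phi psi) (psiK : cancel psi phi).

Let phi_inj : injective phi := can_inj phiK.

Lemma image_neq0 x : x != 0 -> phi x != 0.
Proof. by rewrite -(inj_eq phi_inj) rmorph0. Qed.

Lemma image_normal w : normal_elt w -> normal_elt (phi w).
Proof.
move=> nw x; have [y E] := nw (psi x).
by exists (phi y); rewrite -{1}(psiK x) -!rmorphM /= E.
Qed.

Lemma image_scalar x : scalar_elt (psi x) -> scalar_elt x.
Proof.
by move=> [c E]; exists c; rewrite -(psiK x) E linearZ /= rmorph1.
Qed.

Lemma image_irr w : irr w -> irr (phi w).
Proof.
move=> iw y z E; have /iw : w = psi y * psi z by rewrite -rmorphM /= -E phiK.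
by case=> /image_scalar; [left | right].
Qed.

Lemma image_cases w : w != 0 -> normal_elt w -> irr w ->
  [\/ exists c, phi w = c *: u, exists c, phi w = c *: d | exists a, phi w = ev a].
Proof.
move=> w0 nw iw; have [n pn] := normal_homog (image_neq0 w0) (image_normal nw).
exact: irr_homog pn (image_irr iw).
Qed.

(** Surjectivity enters here: u and d are themselves images, and their degrees 1 and -1 must be
    reached. *)
Lemma image_support (S : int -> Prop) :
  S 0 -> (forall a b, S a -> S b -> S (a + b)) ->
  supported S (phi d) -> supported S (phi u) -> supported S (phi h) ->
  S 1 /\ S (-1).
Proof.
move=> S0 SD Sd Su Sh; have Sx := image_supported S0 SD Sd Su Sh.
split; first by apply: (Sx (psi u)); rewrite psiK gcoef_u1 oner_neq0.
by apply: (Sx (psi d)); rewrite psiK gcoef_d1 w_neq0.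
Qed.

Lemma phi_dh : phi d * phi h = r *: (phi h * phi d).
Proof. by have := congr1 phi dhE; rewrite linearZ !rmorphM. Qed.
Lemma phi_hu : phi h * phi u = r *: (phi u * phi h).
Proof. by have := congr1 phi huE; rewrite linearZ !rmorphM. Qed.
Lemma phi_du : phi d * phi u = s *: (phi u * phi d) - horner_alg (phi h) f.
Proof.
have := congr1 phi duE.
by rewrite rmorphB /= linearZ /= !rmorphM /= lrmorph_horner_alg.
Qed.

Lemma scaled_neq0 x y c : x != 0 -> phi x = c *: y -> c != 0.
Proof.
move=> x0 E; apply: contraNneq (image_neq0 x0) => c0.
by rewrite E c0 scale0r.
Qed.

Lemma scaled_normal c x : c != 0 -> normal_elt (c *: x) -> normal_elt x.
Proof.
move=> c0 nx y; have [z E] := nx y; exists z; apply: (scalerI c0).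
by rewrite scalerAl E scalerAr.
Qed.

Lemma scale_fix c x : c != 1 -> x = c *: x -> x = 0.
Proof.
move=> c1 /eqP; rewrite -subr_eq0 -{1}[x]scale1r -scalerBl scaler_eq0.
by rewrite subr_eq0 eq_sym (negPf c1) => /eqP.
Qed.

Lemma scaled_relation a b c x y : a != 0 -> b != 0 ->
  (a *: x) * (b *: y) = c *: ((b *: y) * (a *: x)) -> x * y = c *: (y * x).
Proof.
move=> a0 b0; rewrite -!scalerAl -!scalerAr !scalerA => E.
apply: (scalerI (mulf_neq0 a0 b0)); rewrite E scalerA; congr (_ *: _); ring.
Qed.

Lemma commuting_scaled a b x : a != 0 -> b != 0 -> x != 0 ->
  (a *: x) * (b *: x) = r *: ((b *: x) * (a *: x)) -> False.
Proof.
move=> a0 b0 x0 /(scaled_relation a0 b0)/(scale_fix r_neq1) xx0.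
by have := A_mulf_neq0 x0 x0; rewrite xx0 eqxx.
Qed.

Lemma duE0 : f = 0 -> d * u = s *: (u * d).
Proof. by move=> f0; rewrite duE f0 rmorph0 subr0. Qed.

Lemma normal_u : f = 0 -> normal_elt u.
Proof.
move=> f0; apply: normal_gen; [exists (s^-1 *: d) | by exists u | exists (r^-1 *: h)].
  by rewrite (swap_scale s0 (duE0 f0)) scalerAl.
by rewrite (swap_scale r0 huE) scalerAl.
Qed.

Lemma normal_d : f = 0 -> normal_elt d.
Proof.
move=> f0; apply: normal_gen; [by exists d | exists (s *: u) | exists (r *: h)].
  by rewrite (duE0 f0) scalerAl.
by rewrite dhE scalerAl.
Qed.

Lemma A_mulIf z x y : z != 0 -> x * z = y * z -> x = y.
Proof.
move=> z0 E; apply/eqP; rewrite -subr_eq0; apply: contraTT isT => xy0.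
by have := A_mulf_neq0 xy0 z0; rewrite mulrBl E subrr eqxx.
Qed.

Lemma ev_scale c a : ev (bicst c * a) = c *: ev a.
Proof. by rewrite rmorphM /= ev_cst mulr_algl. Qed.

Lemma u_ev_skew c b : u * ev b = c *: (ev b * u) -> sig (-1) b = bicst c * b.
Proof.
rewrite u_ev scalerAl -ev_scale => E; exact: ev_inj (A_mulIf u_neq0 E).
Qed.

Lemma ev_d_skew c b : ev b * d = c *: (d * ev b) -> sig (-1) b = bicst c * b.
Proof.
rewrite d_ev scalerAl -ev_scale => E.
have {}E := ev_inj (A_mulIf d_neq0 E).
by rewrite [in LHS]E rmorphM /= sig_cst sigD addNr sig0.
Qed.

(** A monomial z^k h^i of b would give r^(- k - i) = r with k and i nonnegative. *)
Lemma no_eigen (b : R) : s = r -> b != 0 -> sig (-1) b = bicst r * b -> False.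
Proof.
move=> sr b0 E; have [k [i bki]] := bicoef_neq0 b0.
have := coef_tw_eigen E bki; rewrite sr -exprD !exprnP exprz_exp.
by rewrite -[RHS]expr1z => /r_inj; lia.
Qed.

Lemma rs_eq1 : u * d = r *: (d * u) -> f = 0 -> s = r^-1.
Proof.
move=> E f0; rewrite (duE0 f0) scalerA in E.
have ud0 := A_mulf_neq0 u_neq0 d_neq0.
have [rs1|rs1] := eqVneq (r * s) 1.
  by rewrite -[s](mulKf r0) rs1 mulr1.
by move: ud0; rewrite (scale_fix rs1 E) eqxx.
Qed.

Lemma s_eq_r : d * u = r *: (u * d) -> f = 0 -> s = r.
Proof.
move=> E f0; have ud0 := A_mulf_neq0 u_neq0 d_neq0.
move: E => /eqP; rewrite (duE0 f0) -subr_eq0 -scalerBl scaler_eq0 (negPf ud0).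
by rewrite orbF subr_eq0 => /eqP.
Qed.

Lemma ev_neq0 x a : x != 0 -> phi x = ev a -> a != 0.
Proof.
move=> x0 E; apply: contraNneq (image_neq0 x0) => a0.
by rewrite E a0 rmorph0.
Qed.

Lemma homog_supported (S : int -> Prop) k c x : homog k x -> S k -> supported S (c *: x).
Proof. by move=> xk; apply: supported_homog; apply: homogZ. Qed.

(** Normality of u gives f = 0, so u and d are normal too and their images fall under the same three
    cases. The image of u cannot lie on K u, where everything commutes although r is not 1; on K d
    the relation between h and u becomes u d = r d u, that is s = r^-1. An image of u in K[h, z] is
    excluded through the image of d. *)
Lemma phi_h_u c : phi h = c *: u -> f = 0 /\ s = r^-1.
Proof.
move=> hE; have c0 := scaled_neq0 h_neq0 hE.
have f0 : f = 0.
  have := image_normal normal_h; rewrite hE => /(scaled_normal c0)/(_ d) [y].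
  exact: ud_skew.
split=> //; have := phi_hu; have := phi_dh; rewrite hE.
have [[e uE]|[e uE]|[b uE]] := image_cases u_neq0 (normal_u f0) irr_u.
- have e0 := scaled_neq0 u_neq0 uE.
  by rewrite uE => _ /(commuting_scaled c0 e0 u_neq0).
- have e0 := scaled_neq0 u_neq0 uE.
  by rewrite uE => _ /(scaled_relation c0 e0)/rs_eq1; apply.
have b0 := ev_neq0 u_neq0 uE.
rewrite uE -[ev b]scale1r => Ed /(scaled_relation c0 (oner_neq0 K))/u_ev_skew Eb.
have [[e dE]|[e dE]|[a dE]] := image_cases d_neq0 (normal_d f0) irr_d.
- have e0 := scaled_neq0 d_neq0 dE; rewrite dE in Ed.
  by case: (commuting_scaled e0 c0 u_neq0 Ed).
- have e0 := scaled_neq0 d_neq0 dE; rewrite dE in Ed.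
  have sr := s_eq_r (scaled_relation e0 c0 Ed) f0.
  by case: (no_eigen sr b0 Eb).
(* With both [phi d] and [phi u] in K[h, z], the image would live in nonnegative degrees and miss
   d. *)
have [] // := @image_support (fun n => 0 <= n) _ _ _ _ _ => //.
- by move=> i j; lia.
- by rewrite dE; refine (supported_homog (homog_ev a) _); rewrite /=; lia.
- by rewrite uE; refine (supported_homog (homog_ev b) _); rewrite /=; lia.
- by rewrite hE; apply: (@homog_supported _ 1); [exact: homog_u | lia].
Qed.

Lemma phi_h_d c : phi h = c *: d -> f = 0 /\ s = r^-1.
Proof.
move=> hE; have c0 := scaled_neq0 h_neq0 hE.
have f0 : f = 0.
  have := image_normal normal_h; rewrite hE => /(scaled_normal c0)/(_ u) [y].
  exact: du_skew.
split=> //; have := phi_hu; have := phi_dh; rewrite hE.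
have [[e dE]|[e dE]|[b dE]] := image_cases d_neq0 (normal_d f0) irr_d.
- have e0 := scaled_neq0 d_neq0 dE.
  by rewrite dE => /(scaled_relation e0 c0)/rs_eq1 E _; apply: E.
- have e0 := scaled_neq0 d_neq0 dE.
  by rewrite dE => /(commuting_scaled e0 c0 d_neq0).
have b0 := ev_neq0 d_neq0 dE.
rewrite dE -[ev b]scale1r => /(scaled_relation (oner_neq0 K) c0)/ev_d_skew Eb Eu.
have [[e uE]|[e uE]|[a uE]] := image_cases u_neq0 (normal_u f0) irr_u.
- have e0 := scaled_neq0 u_neq0 uE; rewrite uE in Eu.
  have sr := s_eq_r (scaled_relation c0 e0 Eu) f0.
  by case: (no_eigen sr b0 Eb).
- have e0 := scaled_neq0 u_neq0 uE; rewrite uE in Eu.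
  by case: (commuting_scaled c0 e0 d_neq0 Eu).
have [] // := @image_support (fun n => n <= 0) _ _ _ _ _ => //.
- by move=> i j; lia.
- by rewrite dE; refine (supported_homog (homog_ev b) _); rewrite /=; lia.
- by rewrite uE; refine (supported_homog (homog_ev a) _); rewrite /=; lia.
- by rewrite hE; apply: (@homog_supported _ (-1)); [exact: homog_d | lia].
Qed.

Lemma bicst_inj a b (p : R) : p != 0 -> bicst a * p = bicst b * p -> a = b.
Proof. by move=> p0 /(mulIf p0)/polyC_inj/polyC_inj. Qed.

Lemma sig_eigen_pow c (p : R) n : sig 1 p = bicst c * p -> sig n p = bicst (c ^ n) * p.
Proof.
move=> E; apply/bipolyP => k i; rewrite coef_tw coef_bicstM.
have [->|pki] := eqVneq (p`_k`_i) 0; first by rewrite !mulr0.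
rewrite -(coef_tw_eigen E pki) !expr1z expfzMl !exprnP !exprz_exp.
by rewrite -[(n * k%:Z)]mulrC -[(n * i%:Z)]mulrC.
Qed.

(** Normality tested on d, in degree -1: both sides contain the factor w, and cancelling it leaves
    [sig (-1) p] a multiple of p, necessarily a scalar one. *)
Lemma phi_h_eigen p : phi h = ev p -> exists2 c, c != 0 & sig 1 p = bicst c * p.
Proof.
move=> hE; have p0 := ev_neq0 h_neq0 hE.
have := image_normal normal_h; rewrite hE => /(_ d) [y /(congr1 (gcoef^~ (-1)))] /=.
rewrite (gcoefM_homogr _ _ homog_d) (gcoefM_homogr _ _ (homog_ev p)).
rewrite subrr subr0 sig0 !gcoef_ev0 gcoef_d1.
have [a ->] := gcoef_weight y (-1); rewrite /= big_ord1 oppr0 sig0.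
rewrite mulrAC => /(mulIf w_neq0) E; have [c c0 ac] := sig_eigen p0 E.
exists c^-1; rewrite ?invr_eq0 //.
have pE : p = bicst c^-1 * sig (-1) p.
  by rewrite E ac mulrA -bicstM mulVf // mul1r.
by rewrite [in LHS]pE rmorphM /= sig_cst sigD subrr sig0.
Qed.

Lemma irr_homog1 x : x != 0 -> homog 1 x -> irr x -> exists c, x = c *: u.
Proof.
move=> x0 x1 /(irr_homog x1) [//|[c xE]|[a xE]].
  by have := homog_unique x1 _ x0 (j := -1); rewrite xE => /(_ (homogZ _ homog_d)).
by have := homog_unique x1 _ x0 (j := 0); rewrite xE => /(_ (homog_ev a)).
Qed.

Lemma irr_homogN1 x : x != 0 -> homog (-1) x -> irr x -> exists c, x = c *: d.
Proof.
move=> x0 x1 /(irr_homog x1) [[c xE]|//|[a xE]].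
  by have := homog_unique x1 _ x0 (j := 1); rewrite xE => /(_ (homogZ _ homog_u)).
by have := homog_unique x1 _ x0 (j := 0); rewrite xE => /(_ (homog_ev a)).
Qed.

(** If c is the eigenvalue of p, the relations with h say that c^n = r for each degree n of [phi u]
    and c^-n = r for each degree n of [phi d]. As r has infinite order, so has c; hence these images
    are homogeneous of degrees m and -m. All degrees in the image are multiples of m, so m is 1 or
    -1. *)
Lemma phi_h_ev p : phi h = ev p -> exists a b,
  [\/ [/\ phi u = a *: u, phi d = b *: d & sig 1 p = bicst r * p] |
      [/\ phi u = a *: d, phi d = b *: u & sig 1 p = bicst r^-1 * p]].
Proof.
move=> hE; have p0 := ev_neq0 h_neq0 hE; have [c c0 Ep] := phi_h_eigen hE.
have Su n : gcoef (phi u) n != 0 -> c ^ n = r.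
  move=> un; have := congr1 (gcoef^~ n) phi_hu; rewrite /= hE gcoefZ.
  rewrite (gcoefM_homogl _ _ (homog_ev p)) (gcoefM_homogr _ _ (homog_ev p)).
  rewrite !subr0 sig0 gcoef_ev0 (sig_eigen_pow n Ep) -mulrA [gcoef _ _ * p]mulrC.
  by apply: bicst_inj; rewrite mulf_neq0.
have Sd n : gcoef (phi d) n != 0 -> c ^ (- n) = r.
  move=> dn; have := congr1 (gcoef^~ n) phi_dh; rewrite /= hE gcoefZ.
  rewrite (gcoefM_homogl _ _ (homog_ev p)) (gcoefM_homogr _ _ (homog_ev p)).
  rewrite !subr0 sig0 gcoef_ev0 (sig_eigen_pow n Ep) => E.
  have /bicst_inj cn : bicst 1 * (p * gcoef (phi d) n) =
      bicst (r * c ^ n) * (p * gcoef (phi d) n).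
    by rewrite bicst1 mul1r bicstM [LHS]mulrC [LHS]E; ring.
  have := expfz_neq0 n c0 => cn0; apply: (mulIf cn0).
  by rewrite -cn ?mulf_neq0 // -expfzDr // addNr.
have [m um0] := gcoef_neq0 (image_neq0 u_neq0); have cm := Su m um0.
have c_inj i j : c ^ i = c ^ j -> i = j.
  move=> cij; apply/eqP; rewrite -subr_eq0; apply: contraTT isT => /r_free.
  by rewrite -cm exprz_exp mulrC -exprz_exp expfzDr // cij -expfzDr // subrr exp1rz eqxx.
have uhom : homog m (phi u).
  move=> n nm; apply/eqP; apply: contraNT nm => /Su; rewrite -cm => /c_inj ->.
  exact: eqxx.
have dhom : homog (- m) (phi d).
  move=> n nm; apply/eqP; apply: contraNT nm => /Sd; rewrite -cm => /c_inj <-.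
  by rewrite opprK.
have [[k1 e1] _] : (exists k, 1 = k * m) /\ (exists k, -1 = k * m).
  apply: (image_support (S := fun n => exists k, n = k * m)).
  - by exists 0; rewrite mul0r.
  - by move=> _ _ [i ->] [j ->]; exists (i + j); rewrite mulrDl.
  - by apply: (supported_homog dhom); exists (-1); rewrite mulN1r.
  - by apply: (supported_homog uhom); exists 1; rewrite mul1r.
  - by rewrite hE; apply: (supported_homog (homog_ev p)); exists 0; rewrite mul0r.
have [m1|m1] : m = 1 \/ m = -1.
  have := congr1 absz e1; rewrite abszM => /esym/eqP.
  by rewrite muln_eq1 => /andP[_ /eqP]; lia.
  rewrite m1 in uhom dhom cm.
  have [a ua] := irr_homog1 (image_neq0 u_neq0) uhom (image_irr irr_u).
  have [b db] := irr_homogN1 (image_neq0 d_neq0) dhom (image_irr irr_d).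
  by exists a, b; left; split=> //; rewrite Ep -cm expr1z.
rewrite m1 ?opprK in uhom dhom cm.
have [a ua] := irr_homogN1 (image_neq0 u_neq0) uhom (image_irr irr_u).
have [b db] := irr_homog1 (image_neq0 d_neq0) dhom (image_irr irr_d).
by exists a, b; right; split=> //; rewrite Ep -cm invrK.
Qed.

Definition fsub (q : {poly K}) (p : R) : R := map_poly polyC q \Po p.

Lemma ev_fsub q p : ev (fsub q p) = horner_alg (ev p) q.
Proof.
rewrite /fsub; elim/poly_ind: q => [|q c IHq].
  by rewrite !rmorph0.
rewrite rmorphD rmorphM /= map_polyX map_polyC /= comp_polyD comp_polyM.
rewrite comp_polyX comp_polyC !rmorphD !rmorphM /= IHq horner_algX horner_algC.
by rewrite -/(bicst c) ev_cst.
Qed.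

Lemma fsub_polyC q p : fsub q p%:P = (q \Po p)%:P.
Proof.
rewrite /fsub; elim/poly_ind: q => [|q c IHq].
  by rewrite !rmorph0.
rewrite rmorphD rmorphM /= map_polyX map_polyC /= !comp_polyD !comp_polyM IHq.
by rewrite !comp_polyX !comp_polyC polyCD polyCM.
Qed.

Lemma hp_fE : hp f = s *: (u * d) - d * u.
Proof. by rewrite duE opprB addrC subrK. Qed.

Lemma phi_fE : horner_alg (phi h) f = s *: (phi u * phi d) - phi d * phi u.
Proof. by rewrite phi_du opprB addrC subrK. Qed.

Lemma phi_fsub_diag p a b : phi h = ev p -> phi u = a *: u -> phi d = b *: d ->
  fsub f p = bicst (a * b) * f%:P.
Proof.
move=> hE uE dE; apply: ev_inj; rewrite ev_fsub ev_scale ev_polyC -hE.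
rewrite phi_fE uE dE hp_fE scalerBr -!scalerAl -!scalerAr !scalerA.
by congr (_ *: _ - _ *: _); ring.
Qed.

Lemma phi_fsub_flip p a b : phi h = ev p -> phi u = a *: d -> phi d = b *: u ->
  fsub f p = bicst (a * b) *
    (bicst (s ^+ 2 - 1) * 'X + (s *: (g \Po (r *: 'X)) - g)%:P).
Proof.
move=> hE uE dE; apply: ev_inj; rewrite ev_fsub ev_scale -hE.
rewrite phi_fE uE dE -!scalerAl -!scalerAr !scalerA.
transitivity ((a * b) *: (s *: (d * u) - u * d)).
  by rewrite scalerBr !scalerA; congr (_ *: _ - _ *: _); ring.
congr (_ *: _).
rewrite duE' udE rmorphD rmorphM /= ev_cst ev_z ev_polyC mulr_algl.
rewrite rmorphB /= -(mul_polyC s) rmorphM /= horner_algC mulr_algl.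
by rewrite scalerDr scalerA scalerBl scale1r opprD addrACA.
Qed.

Lemma eigen_polyC (q : {poly K}) : sig 1 q%:P = bicst r * q%:P -> q = q`_1 *: 'X.
Proof.
move=> E; apply/polyP => i; rewrite coefZ coefX.
have [->|i1] := eqVneq i 1%N; first by rewrite mulr1.
rewrite mulr0; apply/eqP; apply: contraNT i1 => qi.
have := @coef_tw_eigen 1 r q%:P 0 i E; rewrite coefC /= => /(_ qi).
by rewrite expr0 mul1r expr1z exprnP -[RHS]expr1z => /r_inj[->].
Qed.

Lemma ev_hX l : ev (l *: 'X)%:P = l *: h.
Proof. by rewrite -mul_polyC polyCM ev_scale ev_h. Qed.

(** If no pure power of z occurs in p, then h divides p, the constant monomial being excluded by r
    <> 1; irreducibility of p makes the cofactor a scalar. A pure power z^j has eigenvalue s^j,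
    which must be r. *)
Lemma h_dich p : phi h = ev p -> sig 1 p = bicst r * p ->
  (exists l, phi h = l *: h) \/ (exists2 j, (0 < j)%N & s ^+ j = r).
Proof.
move=> hE E; have [[j [j0 pj]]|np] := pselect (exists j, (0 < j)%N /\ p`_j`_0 != 0).
  right; exists j => //; have := coef_tw_eigen E pj.
  by rewrite expr0 mulr1 !expr1z.
left; pose q := \poly_(k < size p) drop_poly 1 p`_k.
have pE : p = bih K * q.
  apply/bipolyP => k i; rewrite /bih mulrC coefMC coef_poly.
  case: ltnP => [kp|pk]; last by rewrite mul0r [p`_k]nth_default.
  rewrite coefMX coef_drop_poly; case: i => [|i] /=; last by rewrite addn1.
  apply/eqP; apply: contraPT isT => pk0.
  case: k kp pk0 => [|k] _ pk0; last by case: np; exists k.+1.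
  have := coef_tw_eigen E pk0; rewrite !expr0 mulr1 => r1.
  by have := r_neq1; rewrite -r1 eqxx.
rewrite pE rmorphM /= in hE.
have [[c hc]|[c qc]] := image_irr irr_h hE.
  have := congr1 (fun x => (gcoef x 0)`_0`_1) hc.
  by rewrite /= -ev_cst !gcoef_ev0 !coefC /= coefX => /eqP; rewrite oner_eq0.
by exists c; rewrite hE qc ev_h mulr_algr.
Qed.

Lemma size_map_polyC q : size (map_poly (@polyC K) q) = size q.
Proof. exact: (size_map_inj_poly (@polyC_inj K) (polyC0 K)). Qed.

Lemma size_fsub q p : (size (fsub q p)).-1 = ((size q).-1 * (size p).-1)%N.
Proof. by rewrite size_comp_poly size_map_polyC. Qed.

(** Here f(p) = a b f(h) has degree 0 in z, while its degree in z is deg f times that of p. *)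
Lemma diag_polyC p a b : phi h = ev p -> phi u = a *: u -> phi d = b *: d ->
  (1 < size f)%N -> (size p <= 1)%N.
Proof.
move=> hE uE dE sf; have := size_fsub f p; rewrite (phi_fsub_diag hE uE dE).
rewrite -polyCM; move: (size_polyC_leq1 ((a * b)%:P * f)) sf.
by case: (size f) (size p) (size _%:P) => [|[|n]] // [|[|m]] // [|[|k]].
Qed.

Lemma aut_diag p a b : phi h = ev p -> phi u = a *: u -> phi d = b *: d ->
  sig 1 p = bicst r * p ->
  (exists l, phi h = l *: h) \/
  (size f <= 1)%N /\ (exists2 j, (0 < j)%N & s ^+ j = r).
Proof.
move=> hE uE dE E; have [[l hl]|sj] := h_dich hE E; first by left; exists l.
have [sf|sf] := leqP (size f) 1; first by right.
left; have pE := size1_polyC (diag_polyC hE uE dE sf).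
exists p`_0`_1; rewrite pE in E; rewrite hE [in LHS]pE {1}(eigen_polyC E).
exact: ev_hX.
Qed.

Lemma aut_scalar l a b : phi h = l *: h -> phi u = a *: u -> phi d = b *: d ->
  f \Po (l *: 'X) = (a * b) *: f.
Proof.
rewrite -ev_hX => hE uE dE; have := phi_fsub_diag hE uE dE.
by rewrite fsub_polyC -polyCM mul_polyC => /polyC_inj.
Qed.

Lemma aut_const p a b : phi h = ev p -> phi u = a *: u -> phi d = b *: d ->
  (size f <= 1)%N -> (a * b) *: f = f.
Proof.
move=> hE uE dE sf; have := phi_fsub_diag hE uE dE.
rewrite -polyCM mul_polyC {1}(size1_polyC sf) /fsub map_polyC comp_polyC /=.
by move/polyC_inj => <-; rewrite [RHS](size1_polyC sf).
Qed.

Lemma fsub_affine a b p : fsub (a *: 'X + b%:P) p = bicst a * p + bicst b.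
Proof.
rewrite /fsub rmorphD /= map_polyC map_polyZ map_polyX /= comp_polyD comp_polyZ.
by rewrite comp_polyX comp_polyC -mul_polyC.
Qed.

Lemma size2_affine (q : {poly K}) : size q = 2%N -> q = q`_1 *: 'X + (q`_0)%:P.
Proof.
move=> sq; apply/polyP => -[|[|i]]; rewrite coefD coefZ coefX coefC /=.
- by rewrite mulr0 add0r.
- by rewrite mulr1 addr0.
- by rewrite mulr0 addr0 nth_default // sq.
Qed.

Lemma aut_flip p a b : phi h = ev p -> phi u = a *: d -> phi d = b *: u ->
  sig 1 p = bicst r^-1 * p ->
  [/\ size f = 2%N, s = r^-1, a * b * f`_0 = f`_0 &
    exists2 l, phi h = l *: gz & l * f`_1 = a * b * (s ^+ 2 - 1)].
Proof.
move=> hE uE dE E; have a0 := scaled_neq0 u_neq0 uE; have b0 := scaled_neq0 d_neq0 dE.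
have eig k i : p`_k`_i != 0 -> s ^+ k * r ^+ i = r^-1.
  by move/(coef_tw_eigen E); rewrite !expr1z.
have p0 := ev_neq0 h_neq0 hE.
(* If s^2 = 1, squaring the eigenvalue of a monomial z^k h^i of p would give r^(2 i) = r^-2. *)
have s2 : s ^+ 2 - 1 != 0.
  rewrite subr_eq0; apply/eqP => s2.
  have [k [i /eig/(congr1 (fun x : K => x ^+ 2)) ki]] := bicoef_neq0 p0.
  have /r_inj : r ^ (i * 2)%N = r ^ (-2); last by lia.
  move: ki; rewrite exprMn -!exprM mulnC exprM s2 expr1n mul1r => ki.
  by rewrite -exprnP ki exprVn.
have := phi_fsub_flip hE uE dE.
set y := s *: _ - g => F.
have F' : fsub f p = bicst (a * b * (s ^+ 2 - 1)) * 'X + ((a * b)%:P * y)%:P.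
  by rewrite F mulrDr mulrA -bicstM [in RHS]polyCM.
have sF : size (fsub f p) = 2%N.
  rewrite F' size_MXaddC !polyC_eq0 (negPf (mulf_neq0 (mulf_neq0 a0 b0) s2)).
  by rewrite size_polyC polyC_eq0 mulf_neq0 ?mulf_neq0.
have := size_fsub f p; rewrite sF => /eqP.
rewrite eq_sym muln_eq1 => /andP[/eqP sf /eqP sp].
have {}sf : size f = 2%N by move: sf; case: (size f) => [|n] //= ->.
have {}sp : size p = 2%N by move: sp; case: (size p) => [|n] //= ->.
have f1 : f`_1 != 0.
  by have := lead_coef_eq0 f; rewrite /lead_coef sf -size_poly_eq0 sf => ->.
(* A monomial h^i has eigenvalue r^i, never r^-1; so p is a multiple of z, with eigenvalue s. *)
have p00 : p`_0 = 0.
  apply/polyP => i; rewrite coef0; apply/eqP; apply: contraT => /eig.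
  by rewrite expr0 mul1r exprnP => /(r_inj (j := -1)).
have FE := F'; rewrite {1}(size2_affine sf) fsub_affine in FE.
have p1 : p`_1 = ((f`_1)^-1 * (a * b * (s ^+ 2 - 1)))%:P.
  have := congr1 (fun q : R => q`_1) FE.
  rewrite /= !coefD !coefCM coefX !coefC /= mulr1 !addr0 => e1.
  by rewrite polyCM -e1 mulrA -polyCM mulVf // mul1r.
have pE : p = bicst ((f`_1)^-1 * (a * b * (s ^+ 2 - 1))) * 'X.
  apply/polyP => -[|[|k]]; rewrite coefCM coefX /= ?mulr0 ?mulr1 //.
  by rewrite nth_default // sp.
split=> //.
- have := eig 1%N 0%N; rewrite p1 coefC expr0 mulr1 expr1; apply.
  by rewrite !mulf_neq0 ?invr_eq0.
- have := congr1 (fun q : R => q`_0`_0) FE.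
  rewrite /= !coefD !coefCM coefX p00 !coefC /= !mulr0 !add0r coefCM => fE.
  (* The polynomials f and y have the same constant term (s - 1) g(0). *)
  rewrite [RHS]fE; congr (_ * _).
  by rewrite /y f_conf !coefB !coefZ !coef_comp_scale !expr0 !mul1r.
exists ((f`_1)^-1 * (a * b * (s ^+ 2 - 1))); first by rewrite hE pE ev_scale ev_z.
by rewrite mulrAC mulVf // mul1r.
Qed.

End Automorphism.

(** * The possible images of the generators *)

Lemma alg_aut_cases (phi : alg_aut A) :
  [\/ exists l a b, [/\ l != 0, a != 0, b != 0 &
        [/\ phi h = l *: h, phi u = a *: u, phi d = b *: d &
            f \Po (l *: 'X) = (a * b) *: f]],
      (size f <= 1)%N /\ exists p a b, [/\ a != 0, b != 0, (a * b) *: f = f,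
         (exists2 j, (0 < j)%N & s ^+ j = r) &
        [/\ phi h = ev p, phi u = a *: u, phi d = b *: d & sig 1 p = bicst r * p]],
      [/\ size f = 2%N, s = r^-1 & exists l a b, [/\ a != 0, b != 0,
         a * b * f`_0 = f`_0, l * f`_1 = a * b * (s ^+ 2 - 1) &
        [/\ phi h = l *: gz, phi u = a *: d & phi d = b *: u]]] |
      [/\ f = 0, s = r^-1 & exists c, phi h = c *: u \/ phi h = c *: d]].
Proof.
have phiK := aut_funK phi; have psiK := aut_invfK phi.
pose psi : {lrmorphism A -> A} := aut_inv phi.
have K1 : cancel phi psi := phiK; have K2 : cancel psi phi := psiK.
have [[c hE]|[c hE]|[p hE]] := image_cases K1 K2 h_neq0 normal_h irr_h.
- have [f0 sr] := phi_h_u K1 K2 hE.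
  by constructor 4; split=> //; exists c; left.
- have [f0 sr] := phi_h_d K1 K2 hE.
  by constructor 4; split=> //; exists c; right.
have [a [b [[uE dE E]|[uE dE E]]]] := phi_h_ev K1 K2 hE.
  have a0 := scaled_neq0 K1 u_neq0 uE; have b0 := scaled_neq0 K1 d_neq0 dE.
  have [[l hl]|[sf sj]] := aut_diag K1 K2 hE uE dE E.
    constructor 1; exists l, a, b; split=> //; first exact: (scaled_neq0 K1 h_neq0 hl).
    by split=> //; apply: (aut_scalar hl uE dE).
  constructor 2; split=> //; exists p, a, b; split=> //.
  exact: (aut_const hE uE dE sf).
have a0 := scaled_neq0 K1 u_neq0 uE; have b0 := scaled_neq0 K1 d_neq0 dE.
have [sf sr abf [l hl lf]] := aut_flip K1 hE uE dE E.
by constructor 3; split=> //; exists l, a, b.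
Qed.

Lemma lrmorph_ext (B : algType K) (e e' : {lrmorphism A -> B}) :
  e d = e' d -> e u = e' u -> e h = e' h -> e =1 e'.
Proof.
move=> ed eu eh.
apply: (presented_ind pA) => [|x y Hx Hy|c x Hx|x Hx|x Hx|x Hx].
- by rewrite !rmorph1.
- by rewrite !rmorphD /= Hx Hy.
- by rewrite !linearZ /= Hx.
- by rewrite !rmorphM /= ed Hx.
- by rewrite !rmorphM /= eu Hx.
- by rewrite !rmorphM /= eh Hx.
Qed.

(** * Group isomorphisms from parametrized images *)

Section Parametrization.
Variables (Q : groupType) (D U H : Q -> A).
Hypothesis relDH : forall q, D q * H q = r *: (H q * D q).
Hypothesis relHU : forall q, H q * U q = r *: (U q * H q).
Hypothesis relDU : forall q,
  D q * U q = s *: (U q * D q) - horner_alg (H q) f.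
Hypothesis param1 : [/\ D 1%g = d, U 1%g = u & H 1%g = h].
Hypothesis paramM : forall (e : {lrmorphism A -> A}) q q',
  e d = D q -> e u = U q -> e h = H q ->
  [/\ e (D q') = D (q * q')%g, e (U q') = U (q * q')%g &
      e (H q') = H (q * q')%g].

(** The endomorphisms attached to q and to its inverse are mutually inverse by the composition rule.
    For this reason [paramM] speaks of endomorphisms, before bijectivity is known. *)
Lemma param_aut q : exists phi : alg_aut A,
  [/\ phi d = D q, phi u = U q & phi h = H q].
Proof.
have ex q' := presented_univ pA (relDH q') (relHU q') (relDU q').
have [D1 U1 H1] := param1.
have inv q1 q2 (e1 e2 : {lrmorphism A -> A}) : (q1 * q2)%g = 1%g ->
    [/\ e1 d = D q1, e1 u = U q1 & e1 h = H q1] ->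
    [/\ e2 d = D q2, e2 u = U q2 & e2 h = H q2] -> cancel e2 e1.
  move=> q12 [d1 u1 h1] [d2 u2 h2]; have [eD eU eH] := paramM q2 d1 u1 h1.
  apply: (@lrmorph_ext A (e1 \o e2 : {lrmorphism A -> A})
    (idfun : {lrmorphism A -> A})) => /=.
  - by rewrite d2 eD q12 D1.
  - by rewrite u2 eU q12 U1.
  - by rewrite h2 eH q12 H1.
have [e eE] := ex q; have [e' eE'] := ex q^-1%g.
have eK : cancel e e' by apply: (inv q^-1%g q) => //; apply: mulVg.
have e'K : cancel e' e by apply: (inv q q^-1%g) => //; apply: mulgV.
by exists (AlgAut (Bijective eK e'K)).
Qed.

Hypothesis param_inj : forall q q', D q = D q' -> U q = U q' -> H q = H q' -> q = q'.
Hypothesis param_surj : forall phi : alg_aut A, exists q,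
  [/\ phi d = D q, phi u = U q & phi h = H q].

Lemma param_isomorphic : group_isomorphic (alg_aut A) Q.
Proof.
pose F (phi : alg_aut A) := sval (cid (param_surj phi)).
have FE (phi : alg_aut A) : [/\ phi d = D (F phi), phi u = U (F phi) & phi h = H (F phi)].
  by rewrite /F; case: cid.
pose G (q : Q) := sval (cid (param_aut q)).
have GE (q : Q) : [/\ G q d = D q, G q u = U q & G q h = H q].
  by rewrite /G; case: cid.
have FM : {morph F : x y / (x * y)%g}.
  move=> x y; have [xd xu xh] := FE x; have [yd yu yh] := FE y.
  have [xyd xyu xyh] := FE (x * y)%g; have [eD eU eH] := paramM (F y) xd xu xh.
  by apply: param_inj;
    [rewrite -xyd -eD -yd | rewrite -xyu -eU -yu | rewrite -xyh -eH -yh].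
pose FM' := monoid.isMultiplicative.Build _ _ F FM.
pose Fm : {multiplicative alg_aut A -> Q} := HB.pack F FM'.
exists Fm; exists G => [phi|q] /=.
  apply: alg_autP; have [? ? ?] := GE (F phi); have [? ? ?] := FE phi.
  by apply: lrmorph_ext; congruence.
have [? ? ?] := GE q; have [? ? ?] := FE (G q).
by apply: param_inj; congruence.
Qed.
End Parametrization.

Lemma d_eigen (p : R) : sig 1 p = bicst r * p -> d * ev p = r *: (ev p * d).
Proof. by move=> E; rewrite d_ev E ev_scale scalerAl. Qed.

Lemma eigen_u (p : R) : sig 1 p = bicst r * p -> ev p * u = r *: (u * ev p).
Proof. by move=> E; rewrite ev_u E ev_scale scalerAr. Qed.

Lemma horner_const (x : A) (q : {poly K}) : (size q <= 1)%N -> horner_alg x q = (q`_0)%:A.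
Proof. by move=> sq; rewrite {1}(size1_polyC sq) horner_algC. Qed.

Lemma scaler_injl (x : A) (c c' : K) : x != 0 -> c *: x = c' *: x -> c = c'.
Proof.
move=> x0 /eqP; rewrite -subr_eq0 -scalerBl scaler_eq0 (negPf x0) orbF.
by rewrite subr_eq0 => /eqP.
Qed.

(** * Parametrization of the automorphism group *)

Section ConstantRelation.
Variable j : nat.
Hypotheses (j0 : (0 < j)%N) (sj : s ^+ j = r) (sg : (size g <= 1)%N).

Lemma s_inj m n : s ^+ m = s ^+ n -> m = n.
Proof.
move=> /(congr1 (fun x : K => x ^+ j)); rewrite -!exprM -!(mulnC j) !exprM sj.
by rewrite !exprnP => /r_inj [].
Qed.

Lemma size_f_const : (size f <= 1)%N.
Proof.
rewrite f_conf (size1_polyC sg) comp_polyC -mul_polyC -polyCM -polyCB.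
exact: size_polyC_leq1.
Qed.

(** One has f(0) = (s - 1) g(0), and s is not 1 because its power r is not. *)
Lemma fix_f_g c : c *: f = f -> c * g`_0 = g`_0.
Proof.
move=> cf; have f0 : f`_0 = (s - 1) * g`_0.
  by rewrite f_conf coefB coefZ coef_comp_scale expr0 mul1r mulrBl mul1r.
have s1 : s - 1 != 0.
  rewrite subr_eq0; apply/eqP => s1; have := r_neq1.
  by rewrite -sj s1 expr1n eqxx.
have := congr1 (fun q : {poly K} => q`_0) cf; rewrite /= coefZ f0 mulrCA.
exact: mulfI.
Qed.

Lemma image_gz (e : {lrmorphism A -> A}) a b : e u = a *: u -> e d = b *: d ->
  (a * b) *: f = f -> e gz = (a * b) *: gz.
Proof.
move=> eu ed /fix_f_g abg; rewrite /gz !horner_const // rmorphB rmorphM /= eu ed.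
rewrite linearZ /= rmorph1 -scalerAl -scalerAr scalerA scalerBr scalerA.
by rewrite abg.
Qed.

(** With l factored out, composing the parameters t and t' gives t + l^-1 (a b)^j t', which is the
    multiplication of the semidirect product. *)
Definition unip (l t : K) : R := bicst l * (bih K + bicst t * 'X^j).

Lemma ev_unip l t : ev (unip l t) = l *: (h + t *: gz ^+ j).
Proof. by rewrite ev_scale rmorphD /= ev_scale rmorphXn /= ev_z ev_h. Qed.

Lemma unip_eigen l t : sig 1 (unip l t) = bicst r * unip l t.
Proof.
rewrite /unip !(rmorphM, rmorphD, rmorphXn) /= !sig_cst sig_h sig_z !expr1z.
have -> : bicst r = bicst s ^+ j.
  by rewrite -sj /bicst !rmorphXn.
by rewrite exprMn; ring.
Qed.

Lemma unip_coef l t : (unip l t)`_0`_1 = l /\ (unip l t)`_j`_0 = l * t.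
Proof.
rewrite /unip !coef_bicstM !coefD !coef_bicstM !coefXn !coefC /= eqxx.
rewrite (gtn_eqF j0) (ltn_eqF j0) /= coefX coef1 coef0 /=.
by rewrite coefC /= !(mulr0, addr0, mulr1, add0r).
Qed.

(** The monomial z^k h^i has eigenvalue s^(k + j i), which equals s^j for h and z^j only. *)
Lemma unip_form (p : R) : sig 1 p = bicst r * p ->
  p = bicst p`_0`_1 * bih K + bicst p`_j`_0 * 'X^j.
Proof.
move=> E; have eig k i : p`_k`_i != 0 -> (k + j * i)%N = j.
  by move=> /(coef_tw_eigen E); rewrite !expr1z -{1}sj -exprM -exprD -sj => /s_inj.
apply/bipolyP => k i; rewrite !coefD !coef_bicstM coefXn coefC.
have [->|k0] := eqVneq k 0%N.
  rewrite (ltn_eqF j0) /= coef0 mulr0 addr0 coefX.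
  have [->|i1] := eqVneq i 1%N; first by rewrite mulr1.
  rewrite mulr0; apply/eqP; apply: contraNT i1 => /eig.
  by rewrite add0n -[RHS]muln1 => /eqP; rewrite eqn_pmul2l.
rewrite coef0 mulr0 add0r; have [->|kj] := eqVneq k j.
  rewrite coef1; have [->|i0] := eqVneq i 0%N; first by rewrite mulr1.
  rewrite mulr0; apply/eqP; apply: contraNT i0 => /eig.
  by rewrite -[RHS]addn0 => /addnI/eqP; rewrite muln_eq0 (gtn_eqF j0).
rewrite coef0 mulr0; apply/eqP; apply: contraNT kj => /eig.
case: i => [|i]; first by rewrite muln0 addn0 => ->.
rewrite mulnS => /eqP; rewrite addnCA -[X in _ == X]addn0 eqn_add2l.
by rewrite addn_eq0 (negPf k0).
Qed.

Variables (T : groupType) (l a b chi : T -> unit_group K).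
Hypotheses (lM : {morph l : x y / (x * y)%g}) (aM : {morph a : x y / (x * y)%g}).
Hypotheses (bM : {morph b : x y / (x * y)%g}) (chiM : {morph chi : x y / (x * y)%g}).
Hypothesis chiE : forall x : T,
  uval (chi x) = (uval (l x))^-1 * (uval (a x) * uval (b x)) ^+ j.
Hypothesis abf : forall x : T, (uval (a x) * uval (b x)) *: f = f.
Hypothesis lab_inj : forall x y : T, l x = l y -> a x = a y -> b x = b y -> x = y.
Hypothesis lab_surj : forall l0 a0 b0 : K, l0 != 0 -> a0 != 0 -> b0 != 0 ->
  (a0 * b0) *: f = f ->
  exists x : T, [/\ uval (l x) = l0, uval (a x) = a0 & uval (b x) = b0].

Lemma aut_unipotent :
  group_isomorphic (alg_aut A) (semidirect (scaling_action chiM)).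
Proof.
pose Q : groupType := semidirect (scaling_action chiM).
pose D (q : Q) := uval (b q.2) *: d; pose U (q : Q) := uval (a q.2) *: u.
pose H (q : Q) := ev (unip (uval (l q.2)) q.1).
have m1 (m : T -> unit_group K) : {morph m : x y / (x * y)%g} -> m 1%g = 1%g.
  by move=> mM; apply: (mulgI (m 1%g)); rewrite -mM !mulg1.
apply: (@param_isomorphic Q D U H).
- by move=> q; rewrite /D -scalerAl (d_eigen (unip_eigen _ _)) -scalerAr !scalerA mulrC.
- by move=> q; rewrite /U -scalerAr (eigen_u (unip_eigen _ _)) -scalerAl !scalerA mulrC.
- move=> q; rewrite /D /U -!scalerAl -!scalerAr !scalerA duE scalerBr scalerA.
  rewrite !(horner_const _ size_f_const) scalerA.
  congr (_ *: _ - _ *: _); first by ring.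
  have := congr1 (fun p : {poly K} => p`_0) (abf q.2).
  by rewrite /= coefZ [X in X * _]mulrC.
- rewrite /D /U /H /= !m1 // !scale1r; split=> //.
  by rewrite ev_unip scale1r scale0r addr0.
- move=> e q q' ed eu eh; rewrite /D /U /H !linearZ /= ed eu /D /U !scalerA.
  rewrite lM aM bM; split; try by congr (_ *: _); rewrite mulrC.
  rewrite !ev_unip linearZ /= rmorphD /= linearZ rmorphXn /= eh (image_gz eu ed (abf _)).
  rewrite exprZn /H ev_unip !scalerDr !scalerA -addrA -scalerDl.
  congr (_ *: _ + _ *: _); first by rewrite mulrC.
  have l0 := uval_neq0 (l q.2); rewrite /= /gact /= chiE.
  by rewrite -[(q.1 * _)%g]/((q.1 : K) + _); field.
- move=> [t x] [t' x'] DD UU HH.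
  have bb : b x = b x' by apply: val_inj; apply: scaler_injl d_neq0 DD.
  have aa : a x = a x' by apply: val_inj; apply: scaler_injl u_neq0 UU.
  have [/= c1 c2] := unip_coef (uval (l x)) t.
  have [/= c1' c2'] := unip_coef (uval (l x')) t'.
  move/ev_inj: HH => /= HH; rewrite HH in c1 c2.
  have ll : l x = l x' by apply: val_inj; rewrite /= -c1 c1'.
  rewrite (lab_inj ll aa bb); congr pair.
  by apply: (mulfI (uval_neq0 (l x'))); rewrite -{1}ll -c2 c2'.
move=> phi; have sf := size_f_const.
case: (alg_aut_cases phi) => [[l0 [a0 [b0 [nl na nb [hE uE dE]]]]]|P2|[sf2 _ _]|[_ sr _]].
- rewrite {1}(size1_polyC sf) comp_polyC -(size1_polyC sf) => /esym abf0.
  have [x [lx ax bx]] := lab_surj nl na nb abf0.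
  exists (0, x); rewrite /D /U /H /= ax bx; split=> //.
  by rewrite ev_unip lx scale0r addr0.
- case: P2 => _ [p [a0 [b0 [na nb ab _ [hE uE dE E]]]]]; have pE := unip_form E.
  (* Without its h-term, [phi h] would be a multiple of the image of z^j, and h a multiple of
     z^j. *)
  have nl : p`_0`_1 != 0.
    apply/eqP => l0; rewrite l0 bicst0 mul0r add0r in pE.
    have zE : (p`_j`_0 * (a0 * b0) ^- j) *: gz ^+ j = h.
      apply: (bij_inj (alg_aut_bij phi)); rewrite linearZ rmorphXn /=.
      rewrite (image_gz uE dE ab) exprZn scalerA mulfVK ?expf_neq0 ?mulf_neq0 //.
      by rewrite hE [in RHS]pE ev_scale rmorphXn /= ev_z.
    have := congr1 (fun x => (gcoef x 0)`_0`_1) zE.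
    rewrite /= -ev_z -rmorphXn -ev_scale -ev_h !gcoef_ev0 coef_bicstM coefXn coefC coefX.
    by rewrite (ltn_eqF j0) /= coef0 mulr0 => /eqP; rewrite eq_sym oner_eq0.
  have [x [lx ax bx]] := lab_surj nl na nb ab.
  exists (p`_j`_0 / p`_0`_1, x); rewrite /D /U /H /= ax bx; split=> //.
  by rewrite hE [in LHS]pE lx /unip mulrDr mulrA -bicstM [p`_0`_1 * _]mulrC mulfVK.
- by move: sf; rewrite sf2.
have : r ^ j = r ^ (-1).
  by rewrite -[LHS]invrK -exprVn -sr sj.
by move/r_inj; lia.
Qed.
End ConstantRelation.

(** * Affine f with s = r^-1: exchange of u and d *)

Section AffineRelation.
Hypotheses (sf : size f = 2%N) (sr : s = r^-1).

Lemma f_coef i : f`_i = (s - r ^+ i) * g`_i.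
Proof. by rewrite f_conf coefB coefZ coef_comp_scale mulrBl. Qed.

Lemma horner_affine (x : A) (q : {poly K}) : (size q <= 2)%N ->
  horner_alg x q = q`_1 *: x + (q`_0)%:A.
Proof.
move=> sq; have {1}-> : q = (q`_1)%:P * 'X + (q`_0)%:P.
  apply/polyP => -[|[|i]]; rewrite coefD coefCM coefX coefC /=.
  - by rewrite mulr0 add0r.
  - by rewrite mulr1 addr0.
  - by rewrite mulr0 addr0 nth_default // (leq_trans sq).
by rewrite rmorphD rmorphM /= horner_algX !horner_algC mulr_algl.
Qed.

(** The factor s - r^i relating the coefficients of f and g never vanishes, as s = r^-1 and i is
    nonnegative. *)
Lemma size_g_affine : (size g <= 2)%N.
Proof.
apply/leq_sizeP => i i2; have := f_coef i; rewrite nth_default ?sf // => /esym/eqP.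
rewrite mulf_eq0 => /orP[|/eqP//]; rewrite subr_eq0 sr => /eqP E.
have /r_inj : r ^ (-1) = r ^ i%:Z by [].
by [].
Qed.

Lemma f1_neq0 : f`_1 != 0.
Proof.
by have := lead_coef_eq0 f; rewrite /lead_coef sf -size_poly_eq0 sf => ->.
Qed.

Lemma g1_neq0 : g`_1 != 0.
Proof. by apply: contraNneq f1_neq0 => g1; rewrite f_coef g1 mulr0. Qed.

Lemma s_neq1 : s - 1 != 0.
Proof. by rewrite subr_eq0 sr invr_eq1 r_neq1. Qed.

Lemma fix_g0 c : c * f`_0 = f`_0 -> c * g`_0 = g`_0.
Proof. by rewrite f_coef expr0 mulrCA; apply/mulfI/s_neq1. Qed.

(** The value of l / (a b) forced by [aut_flip] when h goes to l z. *)
Definition flip_scalar : K := (s ^+ 2 - 1) / f`_1.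

Lemma flip_scalarE : flip_scalar = s / g`_1.
Proof.
have rs : s * r = 1 by rewrite sr mulVf.
apply: (mulIf f1_neq0); rewrite /flip_scalar mulfVK ?f1_neq0 // f_coef expr1.
transitivity (s * (s - r)); first by rewrite mulrBr -expr2 rs.
by field; apply: g1_neq0.
Qed.

Lemma flip_scalar_neq0 : flip_scalar != 0.
Proof. by rewrite flip_scalarE mulf_neq0 ?invr_eq0 ?g1_neq0. Qed.

(* Identities in the span of [u * d], [h] and [1] are checked on coordinates. *)
Definition lin3 (x y z : K) : A := x *: (u * d) + y *: h + z%:A.

Lemma lin3D (x1 y1 z1 x2 y2 z2 : K) :
  lin3 x1 y1 z1 + lin3 x2 y2 z2 = lin3 (x1 + x2) (y1 + y2) (z1 + z2).
Proof. by rewrite /lin3 !scalerDl addrACA [X in X + _ = _]addrACA. Qed.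
Lemma lin3Z (c x1 y1 z1 : K) : c *: lin3 x1 y1 z1 = lin3 (c * x1) (c * y1) (c * z1).
Proof. by rewrite /lin3 !scalerDr !scalerA. Qed.
Lemma lin3N (x1 y1 z1 : K) : - lin3 x1 y1 z1 = lin3 (- x1) (- y1) (- z1).
Proof. by rewrite -scaleN1r lin3Z !mulN1r. Qed.
Lemma lin3_ud : u * d = lin3 1 0 0.
Proof. by rewrite /lin3 !scale0r scale1r !addr0. Qed.
Lemma lin3_h : h = lin3 0 1 0.
Proof. by rewrite /lin3 !scale0r scale1r add0r addr0. Qed.
Lemma lin3_1 c : c%:A = lin3 0 0 c.
Proof. by rewrite /lin3 !scale0r !add0r. Qed.
Lemma lin3_gz : gz = lin3 1 (- g`_1) (- g`_0).
Proof.
rewrite /gz (horner_affine _ size_g_affine) lin3_ud lin3_h lin3_1 lin3Z.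
by rewrite lin3D lin3N lin3D; congr lin3; ring.
Qed.
Lemma lin3_du : d * u = lin3 s (- f`_1) (- f`_0).
Proof.
rewrite duE (horner_affine _ (eq_leq sf)) lin3_ud lin3_h lin3_1 !lin3Z.
by rewrite lin3D lin3N lin3D; congr lin3; ring.
Qed.
Definition lin3E := (lin3_gz, lin3_du, lin3_ud, lin3_h, lin3_1, lin3Z, lin3N, lin3D).

Lemma du_indep (c c' : K) : c != 0 -> c *: d = c' *: u -> False.
Proof.
move=> c0 /(congr1 (gcoef^~ (-1))); rewrite /= !gcoefZ gcoef_d1 homog_u // mulr0.
by move/eqP; rewrite mulf_eq0 (negPf w_neq0) orbF !polyC_eq0 (negPf c0).
Qed.

Variables (N : groupType) (a b : N -> unit_group K) (sigma : N -> N).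
Hypotheses (aM : {morph a : x y / (x * y)%g}) (bM : {morph b : x y / (x * y)%g}).
Hypotheses (sigmaM : {morph sigma : x y / (x * y)%g}).
Hypothesis sigma2 : forall x : N, iter 2 sigma x = x.
Hypothesis a_sigma : forall x : N, a (sigma x) = b x.
Hypothesis b_sigma : forall x : N, b (sigma x) = a x.
Hypothesis abf : forall x : N, uval (a x) * uval (b x) * f`_0 = f`_0.
Hypothesis ab_inj : forall x y : N, a x = a y -> b x = b y -> x = y.
Hypothesis ab_surj : forall a0 b0 : K, a0 != 0 -> b0 != 0 -> a0 * b0 * f`_0 = f`_0 ->
  exists x : N, uval (a x) = a0 /\ uval (b x) = b0.

Lemma aut_affine :
  group_isomorphic (alg_aut A) (semidirect (@cyclic_action 2 N sigma isT sigmaM sigma2)).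
Proof.
pose Q : groupType := semidirect (@cyclic_action 2 N sigma isT sigmaM sigma2).
(* The scalars a and b belong to the target lines K u and K d, also for a flip. Composing after a
   flip therefore exchanges them, as [sigma] does. *)
pose D (q : Q) := if val q.2 is 0 then uval (b q.1) *: d else uval (a q.1) *: u.
pose U (q : Q) := if val q.2 is 0 then uval (a q.1) *: u else uval (b q.1) *: d.
pose H (q : Q) := if val q.2 is 0 then (uval (a q.1) * uval (b q.1)) *: h
  else (flip_scalar * (uval (a q.1) * uval (b q.1))) *: gz.
have m1 (m : N -> unit_group K) : {morph m : x y / (x * y)%g} -> m 1%g = 1%g.
  by move=> mM; apply: (mulgI (m 1%g)); rewrite -mM !mulg1.
have f1E := f_coef 1; have f0E := f_coef 0; rewrite expr1 in f1E; rewrite expr0 in f0E.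
have g1 := g1_neq0.
have uz : u * gz = r *: (gz * u) by rewrite (swap_scale s0 zu) sr invrK.
have zd : gz * d = r *: (d * gz) by rewrite (swap_scale s0 dz) sr invrK.
(* A flip sends h to a multiple of z, so the composition rule needs the image of z. Its constant
   term vanishes because a b fixes g(0). *)
have Egz (e : {lrmorphism A -> A}) q : e d = D q -> e u = U q -> e h = H q ->
    e gz = if val q.2 is 0 then (uval (a q.1) * uval (b q.1)) *: gz
           else (uval (a q.1) * uval (b q.1) / flip_scalar) *: h.
  have := fix_g0 (abf q.1); case: q => x [[|[|//]] i2] /= xg0 ed eu eh.
    rewrite {1}/gz (horner_affine _ size_g_affine) rmorphB rmorphD rmorphM /= ed eu.
    rewrite !linearZ /= rmorph1 eh /D /U /H /= -scalerAl -scalerAr scalerA !lin3E.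
    by congr lin3; [ring | ring | rewrite mulrN xg0; ring].
  rewrite {1}/gz (horner_affine _ size_g_affine) rmorphB rmorphD rmorphM /= ed eu.
  rewrite !linearZ /= rmorph1 eh /D /U /H /= -scalerAl -scalerAr scalerA !lin3E.
  rewrite flip_scalarE f1E f0E.
  have rs : r = s^-1 by rewrite sr invrK.
  congr lin3.
  - by field; rewrite ?s0 ?g1.
  - by rewrite rs; field; rewrite ?s0 ?g1.
  - rewrite !mulr0 [LHS](_ : _ = uval (a x) * uval (b x) * g`_0 - g`_0).
      by rewrite xg0 subrr.
    by field; rewrite ?s0 ?g1.
apply: (@param_isomorphic Q D U H).
- move=> [x [[|[|//]] i2]]; rewrite /D /H /= -!scalerAl -!scalerAr !scalerA.
    by rewrite dhE scalerA; congr (_ *: _); ring.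
  by rewrite uz scalerA; congr (_ *: _); ring.
- move=> [x [[|[|//]] i2]]; rewrite /U /H /= -!scalerAl -!scalerAr !scalerA.
    by rewrite huE scalerA; congr (_ *: _); ring.
  by rewrite zd scalerA; congr (_ *: _); ring.
- move=> [x [[|[|//]] i2]]; rewrite (horner_affine _ (eq_leq sf)) /D /U /H /=;
    rewrite -!scalerAl -!scalerAr !scalerA !lin3E; have xf0 := abf x.
    congr lin3; [ring | ring | ].
    by rewrite mulrN [X in - (X * _)]mulrC xf0; ring.
  have c1 : f`_1 * flip_scalar = s ^+ 2 - 1 by rewrite mulrC mulfVK ?f1_neq0.
  have c2 : g`_1 * flip_scalar = s by rewrite flip_scalarE mulrC mulfVK.
  have xg0 := fix_g0 xf0.
  congr lin3.
  - by rewrite (mulrA f`_1) c1; ring.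
  - rewrite [RHS](_ : _ = f`_1 * (uval (a x) * uval (b x)) * (g`_1 * flip_scalar - s)).
      by rewrite c2 subrr !mulr0.
    by ring.
  - rewrite [RHS](_ : _ = - s * (uval (a x) * uval (b x) * f`_0) +
      f`_1 * flip_scalar * (uval (a x) * uval (b x) * g`_0) - f`_0); last by ring.
    by rewrite xf0 xg0 c1 f0E; ring.
- by rewrite /D /U /H /= !m1 // mulr1 !scale1r.
- move=> e q q' ed eu eh; have ez := Egz e q ed eu eh.
  case: q ed eu eh ez => x [[|[|//]] i2]; case: q' => x' [[|[|//]] i2'];
    rewrite /D /U /H /= => ed eu eh ez; rewrite !linearZ /= ?ed ?eu ?eh ?ez !scalerA.
  + rewrite aM bM; split; congr (_ *: _); rewrite /=; ring.
  + rewrite aM bM; split; congr (_ *: _); rewrite /=; ring.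
  + rewrite aM bM a_sigma b_sigma; split; congr (_ *: _); rewrite /=; ring.
  + rewrite aM bM a_sigma b_sigma; split; congr (_ *: _); rewrite /=; try ring.
    by field; apply: flip_scalar_neq0.
- have inj i i' (x x' : N) : uval (a x) = uval (a x') -> uval (b x) = uval (b x') ->
      val i = val i' -> (x, i) = (x', i') :> Q.
    by move=> ax bx ii; congr pair; [apply: ab_inj; apply: val_inj | apply: val_inj].
  move=> [x [[|[|//]] i2]] [x' [[|[|//]] i2']]; rewrite /D /U /H /= => DD UU _.
  + by apply: inj; [apply: scaler_injl u_neq0 _ | apply: scaler_injl d_neq0 _ |].
  + by case: (du_indep (uval_neq0 (b x)) DD).
  + by case: (du_indep (uval_neq0 (b x')) (esym DD)).
  + by apply: inj; [apply: scaler_injl u_neq0 _ | apply: scaler_injl d_neq0 _ |].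
move=> phi; case: (alg_aut_cases phi) =>
  [[l [a0 [b0 [nl na nb [hE uE dE E]]]]]|[sf1 _]|P3|[f0 _ _]].
- have abf0 : a0 * b0 * f`_0 = f`_0.
    have := congr1 (fun p : {poly K} => p`_0) E.
    by rewrite /= coef_comp_scale coefZ mul1r.
  have lE : l = a0 * b0.
    have := congr1 (fun p : {poly K} => p`_1) E; rewrite /= coef_comp_scale coefZ expr1.
    by move/(mulIf f1_neq0).
  have [x [ax bx]] := ab_surj na nb abf0; exists (x, ord0).
  by rewrite /D /U /H /= ax bx -lE.
- by move: sf1; rewrite sf.
- case: P3 => _ _ [l [a0 [b0 [na nb abf0 lE [hE uE dE]]]]].
  have [x [bx ax]] : exists x : N, uval (b x) = a0 /\ uval (a x) = b0.
    have [|x [ax bx]] := @ab_surj b0 a0 nb na; first by rewrite [b0 * _]mulrC.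
    by exists x.
  exists (x, ord_max); rewrite /D /U /H /= ax bx; split=> //.
  rewrite hE; congr (_ *: _); apply: (mulIf f1_neq0).
  by rewrite lE /flip_scalar; field; apply: f1_neq0.
by have := f1_neq0; rewrite f0 coef0 eqxx.
Qed.
End AffineRelation.

(** * The case f = 0 and s = r^-1: cyclic symmetry of the generators *)

Section QuantumSpace.
Hypotheses (f0 : f = 0) (sr : s = r^-1).

Local Notation T3 := (unit_group K * unit_group K * unit_group K)%type.

(** In the cyclic order d, h, u each generator satisfies the same relation with the next one;
    indices modulo 3 turn the rotation into an addition. *)
Definition gen3 (n : nat) : A := match (n %% 3)%N with 0%N => d | 1%N => h | _ => u end.
Definition coef3 (x : T3) (n : nat) : K :=
  match (n %% 3)%N with 0%N => uval x.1.1 | 1%N => uval x.1.2 | _ => uval x.2 end.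

Lemma mod3_cases n : [\/ n %% 3 = 0, n %% 3 = 1 | n %% 3 = 2]%N.
Proof.
by case: (n %% 3)%N (ltn_mod n 3) => [|[|[|//]]] _;
  [constructor 1|constructor 2|constructor 3].
Qed.

Lemma modS3 n : (n.+1 %% 3 = (n %% 3).+1 %% 3)%N.
Proof. by rewrite -addn1 -modnDml addn1. Qed.

Lemma gen3_mod m n : (m = n %[mod 3])%N -> gen3 m = gen3 n.
Proof. by rewrite /gen3 => ->. Qed.
Lemma coef3_mod m n (x : T3) : (m = n %[mod 3])%N -> coef3 x m = coef3 x n.
Proof. by rewrite /coef3 => ->. Qed.

Lemma coef3_neq0 (x : T3) n : coef3 x n != 0.
Proof. by rewrite /coef3; case: (n %% 3)%N => [|[|m]]; apply: uval_neq0. Qed.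

Lemma coef3M (x y : T3) n : coef3 (x * y)%g n = coef3 x n * coef3 y n.
Proof. by rewrite /coef3; case: (n %% 3)%N => [|[|m]]. Qed.

Lemma coef3_rot (x : T3) n : coef3 (rot3 x) n.+1 = coef3 x n.
Proof. by rewrite /coef3 modS3; case: (mod3_cases n) => ->. Qed.

Lemma coef3_iter_rot k (x : T3) n : coef3 (iter k (@rot3 K) x) (n + k) = coef3 x n.
Proof. by elim: k => [|k IHk]; rewrite ?addn0 // addnS coef3_rot. Qed.

Lemma coef3_inj (x y : T3) : (forall n, coef3 x n = coef3 y n) -> x = y.
Proof.
move=> xy; have := (xy 0%N, xy 1%N, xy 2%N).
case: x {xy} => [[x1 x2] x3]; case: y => [[y1 y2] y3].
by rewrite /coef3 /= => -[[/val_inj -> /val_inj ->] /val_inj ->].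
Qed.

Lemma gen3_rel n : gen3 n * gen3 n.+1 = r *: (gen3 n.+1 * gen3 n).
Proof.
rewrite /gen3 modS3; case: (mod3_cases n) => -> //=.
by rewrite (swap_scale s0 (duE0 f0)) sr invrK.
Qed.

Lemma gen3_neq0 n : gen3 n != 0.
Proof.
by rewrite /gen3; case: (mod3_cases n) => ->; rewrite ?d_neq0 ?h_neq0 ?u_neq0.
Qed.

Lemma gen3_homog n : homog ((n %% 3)%N%:Z - 1) (gen3 n).
Proof.
rewrite /gen3; case: (mod3_cases n) => ->; [exact: homog_d|exact: homog_h|exact: homog_u].
Qed.

Lemma gen3_indep (c c' : K) m n : c != 0 -> c *: gen3 m = c' *: gen3 n ->
  (m = n %[mod 3])%N.
Proof.
move=> c0 E; have nz : c *: gen3 m != 0 by rewrite scaler_eq0 negb_or c0 gen3_neq0.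
have h1 := homogZ c (gen3_homog (n := m)); have h2 := homogZ c' (gen3_homog (n := n)).
rewrite -E in h2; have := homog_unique h1 h2 nz; lia.
Qed.

Lemma aut_quantum_space :
  group_isomorphic (alg_aut A) (semidirect (rot3_action K)).
Proof.
pose Q : groupType := semidirect (rot3_action K).
(* The image of the m-th generator. Its coefficient is indexed by the target generator, so that
   composing with a rotation permutes coefficients as [rot3] does. *)
pose X m (q : Q) := coef3 q.1 (val q.2 + m) *: gen3 (val q.2 + m).
have relX m q : X m q * X m.+1 q = r *: (X m.+1 q * X m q).
  rewrite /X !addnS -!scalerAl -!scalerAr !scalerA gen3_rel scalerA.
  by congr (_ *: _); ring.
have X3 q : X 3%N q = X 0%N q.
  rewrite /X addn0; congr (_ *: _); [apply: coef3_mod | apply: gen3_mod];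
  by rewrite modnDr.
have relDH q : X 0%N q * X 1%N q = r *: (X 1%N q * X 0%N q) by apply: relX.
have relHU q : X 1%N q * X 2%N q = r *: (X 2%N q * X 1%N q) by apply: relX.
have relDU q : X 0%N q * X 2%N q = s *: (X 2%N q * X 0%N q) - horner_alg (X 1%N q) f.
  by rewrite f0 rmorph0 subr0 -X3 relX scalerA sr mulVf // scale1r.
have param1 : [/\ X 0%N 1%g = d, X 2%N 1%g = u & X 1%N 1%g = h].
  by rewrite /X /coef3 /gen3 /= !scale1r.
have paramM (e : {lrmorphism A -> A}) q q' :
    e d = X 0%N q -> e u = X 2%N q -> e h = X 1%N q ->
    [/\ e (X 0%N q') = X 0%N (q * q')%g, e (X 2%N q') = X 2%N (q * q')%g &
        e (X 1%N q') = X 1%N (q * q')%g].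
  move=> ed eu eh.
  have eg n : e (gen3 n) = coef3 q.1 (n + val q.2) *: gen3 (n + val q.2).
    rewrite [in LHS]/gen3; have E m : (n %% 3 = m %% 3)%N ->
        X m q = coef3 q.1 (n + val q.2) *: gen3 (n + val q.2).
      by move=> nm; rewrite /X; congr (_ *: _); [apply: coef3_mod | apply: gen3_mod];
        rewrite addnC -modnDml -nm modnDml.
    by case: (mod3_cases n) => nE; rewrite nE ?ed ?eu ?eh; apply: E; rewrite nE.
  suff eX m : e (X m q') = X m (q * q')%g by [].
  have km : (val q'.2 + m + val q.2 = val (q * q')%g.2 + m %[mod 3])%N.
    by rewrite /= modnDml; congr modn; rewrite addnC addnA.
  rewrite {1}/X linearZ /= eg scalerA /X -(coef3_mod _ km) -(gen3_mod km) coef3M.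
  by rewrite coef3_iter_rot mulrC.
apply: (param_isomorphic relDH relHU relDU param1 paramM).
- move=> [x k] [y l] DD UU HH.
  have kl : k = l.
    apply: val_inj; have := gen3_indep (coef3_neq0 _ _) DD.
    by rewrite !addn0 /= !modn_small.
  subst l; congr pair; apply: coef3_inj => n.
  have E m : X m (x, k) = X m (y, k) -> coef3 x (k + m) = coef3 y (k + m).
    by apply: scaler_injl; apply: gen3_neq0.
  (* Here k * 2 stands for - k modulo 3, so k + m with m = 0, 1, 2 reaches every index. *)
  have nE : (k + (n + k * 2) %% 3 = n %[mod 3])%N.
    by rewrite modnDmr addnCA -mulnS mulnC -modnDmr modnMr addn0.
  rewrite -!(coef3_mod _ nE).
  by case: (mod3_cases (n + k * 2)) => ->; apply: E.
move=> phi; have [j [c jc]] : exists j c, phi h = c *: gen3 j.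
  case: (alg_aut_cases phi) => [[l [a [b [_ _ _ [hE _ _ _]]]]]
    |[_ [p [a [b [_ _ _ [j j0 sj] _]]]]]|[sf _ _]|[_ _ [c [hE|hE]]]].
  - by exists 1%N, l.
  - have : r ^ j = r ^ (-1) by rewrite -[LHS]invrK -exprVn -sr sj.
    by move/r_inj; lia.
  - by rewrite f0 size_poly0 in sf.
  - by exists 2%N, c.
  - by exists 0%N, c.
(* Since h has index 1, the rotation taking h to [gen3 j] is by j - 1, that is j + 2 modulo 3.
   Undoing it leaves an automorphism that fixes the line K h, which is diagonal. *)
pose q0 : Q := (1%g, inZp (j + 2)).
have [rho [rd ru rh]] := param_aut relDH relHU relDU param1 paramM q0.
pose phi' : alg_aut A := (rho^-1 * phi)%g.
have phiE x : phi x = rho (phi' x) by rewrite /phi' /= aut_invfK.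
have rhE : rho h = gen3 j.
  rewrite rh /X [coef3 _ _](_ : _ = 1); last first.
    by rewrite /coef3; case: (_ %% 3)%N => [|[|]].
  rewrite scale1r; apply: gen3_mod => /=.
  by rewrite modnDml -addnA modnDr.
have h'E : phi' h = c *: h.
  by apply: (bij_inj (alg_aut_bij rho)); rewrite -phiE linearZ /= rhE.
have c0 : c != 0.
  apply: contraNneq h_neq0 => c0; apply/eqP.
  by apply: (bij_inj (alg_aut_bij phi')); rewrite h'E c0 scale0r rmorph0.
case: (alg_aut_cases phi') => [[l [a [b [nl na nb [hE uE dE _]]]]]
  |[_ [p [a [b [_ _ _ [i i0 si] _]]]]]|[sf _ _]|[_ _ [c' [hE|hE]]]].
- pose q' : Q := ((UnitGroup nb, UnitGroup nl, UnitGroup na), 0%R).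
  have [eD eU eH] := paramM rho q0 q' rd ru rh.
  by exists (q0 * q')%g; rewrite !phiE hE uE dE -eD -eU -eH.
- have : r ^ i = r ^ (-1) by rewrite -[LHS]invrK -exprVn -sr si.
  by move/r_inj; lia.
- by rewrite f0 size_poly0 in sf.
- rewrite h'E in hE; by have := @gen3_indep c c' 1 2 c0 hE.
- rewrite h'E in hE; by have := @gen3_indep c c' 1 0 c0 hE.
Qed.
End QuantumSpace.
End ConformalAlgebra.

(** * Reduction to gamma = 0 *)

Section Shift.
Variables (K : fieldType) (f : {poly K}) (r s gamma : K).
Hypothesis r1 : r - 1 != 0.

Lemma comp_horner_alg (A : algType K) (a : A) (p q : {poly K}) :
  horner_alg a (p \Po q) = horner_alg (horner_alg a q) p.
Proof.
elim/poly_ind: p => [|p c IHp]; first by rewrite comp_poly0 !rmorph0.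
rewrite comp_polyD comp_polyM comp_polyX comp_polyC !rmorphD !rmorphM /= IHp.
by rewrite horner_algX !horner_algC.
Qed.

Lemma horner_tilde (A : algType K) (h : A) :
  horner_alg h (f_tilde f r gamma) = horner_alg ((r - 1)^-1 *: (h + gamma%:A)) f.
Proof.
rewrite /f_tilde comp_horner_alg; congr (horner_alg _ f).
by rewrite -mul_polyC rmorphM rmorphD /= horner_algX !horner_algC mulr_algl.
Qed.

Definition shift_gen (A : algType K) (h : A) : A := (r - 1) *: h - gamma%:A.

Lemma shift_genK (A : algType K) (h : A) :
  (r - 1)^-1 *: (shift_gen h + gamma%:A) = h.
Proof. by rewrite subrK scalerA mulVf // scale1r. Qed.

Lemma unshift_genK (A : algType K) (h : A) :
  shift_gen ((r - 1)^-1 *: (h + gamma%:A)) = h.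
Proof. by rewrite /shift_gen scalerA mulfV // scale1r addrK. Qed.

Lemma combine_shift (V : lmodType K) (x y z : V) :
  ((r - 1) *: x - gamma *: z) - r *: ((r - 1) *: y - gamma *: z) =
  (r - 1) *: (x - r *: y + gamma *: z).
Proof.
rewrite scalerBr opprB scalerDr scalerBr !scalerA -!addrA; congr (_ + _).
rewrite addrA addrC; congr (- (_ *: _) + _); first exact: mulrC.
by rewrite -scaleNr -scalerDl; congr (_ *: _); ring.
Qed.

Lemma dh_shift (A : algType K) (d h : A) :
  d * h - r *: (h * d) + gamma *: d = 0 <->
  d * shift_gen h = r *: (shift_gen h * d).
Proof.
have E : d * shift_gen h - r *: (shift_gen h * d) =
    (r - 1) *: (d * h - r *: (h * d) + gamma *: d).
  rewrite /shift_gen mulrBr mulrBl mulr_algl mulr_algr -scalerAr -scalerAl.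
  exact: combine_shift.
split=> [dh|/eqP]; first by apply/eqP; rewrite -subr_eq0 E dh scaler0.
by rewrite -subr_eq0 E scaler_eq0 (negPf r1) => /eqP.
Qed.

Lemma hu_shift (A : algType K) (u h : A) :
  h * u - r *: (u * h) + gamma *: u = 0 <->
  shift_gen h * u = r *: (u * shift_gen h).
Proof.
have E : shift_gen h * u - r *: (u * shift_gen h) =
    (r - 1) *: (h * u - r *: (u * h) + gamma *: u).
  rewrite /shift_gen mulrBr mulrBl mulr_algl mulr_algr -scalerAr -scalerAl.
  exact: combine_shift.
split=> [hu|/eqP]; first by apply/eqP; rewrite -subr_eq0 E hu scaler0.
by rewrite -subr_eq0 E scaler_eq0 (negPf r1) => /eqP.
Qed.

Lemma du_shift (A : algType K) (d u h : A) :
  d * u - s *: (u * d) + horner_alg h f = 0 <->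
  d * u = s *: (u * d) - horner_alg (shift_gen h) (f_tilde f r gamma).
Proof.
rewrite horner_tilde shift_genK; split=> [/eqP|->]; last by rewrite addrAC subrK subrr.
by rewrite -addrA addr_eq0 opprD opprK => /eqP ->.
Qed.

Lemma shift_stable (A : algType K) (h : A) (P : A -> Prop) :
  (forall x y, P x -> P y -> P (x + y)) -> (forall c x, P x -> P (c *: x)) ->
  (forall x, P x -> P (shift_gen h * x)) -> forall x, P x -> P (h * x).
Proof.
move=> PD PZ Ph x Px; rewrite -[h]shift_genK -scalerAl mulrDl mulr_algl.
by apply: (PZ); apply: PD; [apply: Ph | apply: PZ].
Qed.

Lemma presented_shift (A : algType K) (d u h : A) :
  d * h - r *: (h * d) + gamma *: d = 0 ->
  h * u - r *: (u * h) + gamma *: u = 0 ->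
  d * u - s *: (u * d) + horner_alg h f = 0 ->
  (forall P : A -> Prop,
    P 1 -> (forall x y, P x -> P y -> P (x + y)) ->
    (forall c x, P x -> P (c *: x)) ->
    (forall x, P x -> P (d * x)) -> (forall x, P x -> P (u * x)) ->
    (forall x, P x -> P (h * x)) -> forall x, P x) ->
  (forall (B : algType K) (D U H : B),
    D * H - r *: (H * D) + gamma *: D = 0 ->
    H * U - r *: (U * H) + gamma *: U = 0 ->
    D * U - s *: (U * D) + horner_alg H f = 0 ->
    exists e : {lrmorphism A -> B}, [/\ e d = D, e u = U & e h = H]) ->
  presented (f_tilde f r gamma) r s d u (shift_gen h).
Proof.
move=> dh hu du ind univ; split.
- exact/dh_shift.
- exact/hu_shift.
- exact/du_shift.
- move=> P P1 PD PZ Pd Pu Ph; apply: ind => //; exact: shift_stable PD PZ Ph.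
move=> B D U H dh' hu' du'; pose H' := (r - 1)^-1 *: (H + gamma%:A).
have HE : shift_gen H' = H by apply: unshift_genK.
have [|||e [eD eU eH]] := univ B D U H'.
- by apply/dh_shift; rewrite HE.
- by apply/hu_shift; rewrite HE.
- by apply/du_shift; rewrite HE.
exists e; split=> //; rewrite -HE -eH /shift_gen.
by rewrite rmorphB /= !linearZ /= rmorph1.
Qed.

Lemma gdua_presented :
  presented (f_tilde f r gamma) r s (gdua_d f r s gamma) (gdua_u f r s gamma)
    (shift_gen (gdua_h f r s gamma)).
Proof.
exact: (presented_shift (gdua_dh f r s gamma) (gdua_hu f r s gamma)
  (gdua_du f r s gamma) (@gdua_ind K f r s gamma)
  (fun B D U H dh hu du => @gdua_universal K B D U H f r s gamma dh hu du)).
Qed.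

Lemma size_tilde : size (f_tilde f r gamma) = size f.
Proof.
rewrite /f_tilde size_comp_poly2 // size_scale ?invr_eq0 //.
exact: size_XaddC.
Qed.

Lemma tilde_coef0 : (f_tilde f r gamma)`_0 = f.[gamma / (r - 1)].
Proof.
by rewrite -horner_coef0 horner_comp hornerZ hornerD hornerX hornerC add0r mulrC.
Qed.

(** The affine change of variable conjugates X -> r X - gamma into X -> r X. *)
Lemma tilde_conf (g : {poly K}) : f = s *: g - (g \Po (r *: 'X - gamma%:P)) ->
  f_tilde f r gamma = s *: f_tilde g r gamma - (f_tilde g r gamma \Po (r *: 'X)).
Proof.
move=> ->; rewrite /f_tilde comp_polyB comp_polyZ -!comp_polyA; congr (_ - (g \Po _)).
rewrite comp_polyB !comp_polyZ comp_polyD comp_polyX !comp_polyC comp_polyX.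
apply: (scalerI r1); rewrite scalerBr !scalerA mulrAC mulfV // mul1r scale1r.
rewrite scalerDr -addrA; congr (_ + _).
by rewrite -!mul_polyC -!polyCM -polyCB; congr polyC; ring.
Qed.
End Shift.

(** * Transport of automorphism groups *)

Section Isomorphisms.
Variables G1 G2 G3 : groupType.

Lemma group_isomorphic_trans :
  group_isomorphic G1 G2 -> group_isomorphic G2 G3 -> group_isomorphic G1 G3.
Proof.
move=> [e be] [e' be']; exists (e' \o e : {multiplicative G1 -> G3}).
exact: bij_comp be' be.
Qed.
End Isomorphisms.

Lemma conj_isomorphic (K : fieldType) (A B : algType K)
    (e : {lrmorphism A -> B}) (e' : {lrmorphism B -> A}) :
  cancel e e' -> cancel e' e -> group_isomorphic (alg_aut A) (alg_aut B).
Proof.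
move=> eK e'K.
have bij (phi : alg_aut A) : bijective (e \o (phi \o e')).
  by apply: bij_comp; [exists e' | apply: bij_comp; [apply: alg_aut_bij | exists e]].
have bij' (phi : alg_aut B) : bijective (e' \o (phi \o e)).
  by apply: bij_comp; [exists e | apply: bij_comp; [apply: alg_aut_bij | exists e']].
pose F (phi : alg_aut A) : alg_aut B :=
  @AlgAut K B (e \o (phi \o e') : {lrmorphism B -> B}) (bij phi).
pose F' (phi : alg_aut B) : alg_aut A :=
  @AlgAut K A (e' \o (phi \o e) : {lrmorphism A -> A}) (bij' phi).
have FM : {morph F : x y / (x * y)%g}.
  by move=> x y; apply: alg_autP => b /=; rewrite eK.
pose FM' := monoid.isMultiplicative.Build _ _ F FM.
exists (HB.pack F FM' : {multiplicative alg_aut A -> alg_aut B}).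
by exists F' => phi; apply: alg_autP => b /=; rewrite ?eK ?e'K.
Qed.

Lemma presented_isomorphic (K : fieldType) (f : {poly K}) (r s : K)
    (A B : algType K) (d u h : A) (d' u' h' : B) :
  presented f r s d u h -> presented f r s d' u' h' ->
  group_isomorphic (alg_aut A) (alg_aut B).
Proof.
move=> pA pB.
have [e [ed eu eh]] :=
  presented_univ pA (presented_dh pB) (presented_hu pB) (presented_du pB).
have [e' [ed' eu' eh']] :=
  presented_univ pB (presented_dh pA) (presented_hu pA) (presented_du pA).
apply: (@conj_isomorphic K A B e e').
  apply: (lrmorph_ext pA (e := e' \o e : {lrmorphism A -> A})
    (e' := idfun : {lrmorphism A -> A})) => /=;
  by rewrite ?ed ?eu ?eh.
apply: (lrmorph_ext pB (e := e \o e' : {lrmorphism B -> B})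
  (e' := idfun : {lrmorphism B -> B})) => /=;
by rewrite ?ed' ?eu' ?eh'.
Qed.

Lemma h_group_isomorphic (K : fieldType) (f : {poly K}) (r s : K) :
  (forall phi : alg_aut (gdua f r s 0), phi \in @h_diagonal K f r s) ->
  group_isomorphic (alg_aut (gdua f r s 0)) (h_group f r s).
Proof.
move=> diag.
pose F (phi : alg_aut (gdua f r s 0)) : h_group f r s := exist _ phi (diag phi).
have FM : {morph F : x y / (x * y)%g} by move=> x y; apply: val_inj.
pose FM' := monoid.isMultiplicative.Build _ _ F FM.
exists (HB.pack F FM' : {multiplicative alg_aut (gdua f r s 0) -> h_group f r s}).
by exists val => // x; apply: val_inj.
Qed.

(** For the minimal m with s^m = r^k one gets r^m = s^(j m) = r^(k j), so m = k j with k > 0 and m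
    is at least j. Hence an exponent found for an automorphism is tau. *)
Lemma tau_eq (K : fieldType) (r s : K) (j : nat) :
  (forall k : int, k != 0 -> r ^ k != 1) -> r != 0 ->
  (0 < j)%N -> s ^+ j = r -> tau r s = j.
Proof.
move=> r_free r0 j0 sj; rewrite /tau.
have pj : power_dependent r s j.
  by rewrite /power_dependent j0; apply/asboolP; exists 1; rewrite expr1z.
case: pselect => [ex|]; last by case; exists j.
case: ex_minnP => m /andP[m0 /asboolP [k sm]] mmin.
have mj := mmin j pj; apply/eqP; rewrite eqn_leq mj /=.
have /(r_inj r0 r_free) mk : r ^ m = r ^ (k * j%:Z).
  by rewrite -exprz_exp -sm -!exprnP -sj -!exprM mulnC.
have : (0 < k)%R by nia.
move: mk; case: k {sm} => // k; rewrite -PoszM => -[->] k0.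
by rewrite leq_pmull.
Qed.

Lemma gdua_presented0 (K : fieldType) (f : {poly K}) (r s : K) :
  presented f r s (gdua_d f r s 0) (gdua_u f r s 0) (gdua_h f r s 0).
Proof.
have rel (A : algType K) (x y z : A) (c : K) :
    (x * y - c *: (y * x) + 0 *: z = 0) <-> (x * y = c *: (y * x)).
  by rewrite scale0r addr0; split=> [/eqP|->]; rewrite ?subrr ?subr_eq0 // => /eqP.
have relf (A : algType K) (x y z : A) :
    (x - y + z = 0) <-> (x = y - z).
  have -> : x - y + z = x - (y - z) by rewrite opprB addrA addrAC.
  by split=> [/eqP|->]; rewrite ?subrr // subr_eq0 => /eqP.
split.
- exact/rel/gdua_dh.
- exact/rel/gdua_hu.
- exact/relf/gdua_du.
- exact: gdua_ind.
move=> B D U H dh hu du.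
by apply: gdua_universal; [exact/rel|exact/rel|exact/relf].
Qed.

Lemma uval_expg (K : fieldType) (x : unit_group K) n : uval (x ^+ n)%g = uval x ^+ n.
Proof. by elim: n => [//|n IHn]; rewrite expgS exprS -IHn. Qed.

(** * Assembly of the six cases *)

Theorem theorem2p19 (K : closedFieldType) (char0 : [pchar K] =i pred0)
    (f : {poly K}) (r s gamma : K) (r_neq0 : r != 0) (s_neq0 : s != 0)
    (r_not_unity : not_root_of_unity r)
    (f_conf : exists g : {poly K}, f = s *: g - (g \Po (r *: 'X - gamma%:P))) :
  let L := gdua f r s gamma in
  let t := tau r s in
  let x0 := gamma / (r - 1) in
  let cond_a := (f = 0) /\ (s = r^-1) in
  let cond_b := (f = 0) /\ (s ^+ t = r) in
  let cond_c := (size f = 1%N) /\ (s ^+ t = r) in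
  let cond_d := [/\ size f = 2%N, s = r^-1 & f.[x0] = 0] in
  let cond_e := [/\ size f = 2%N, s = r^-1 & f.[x0] <> 0] in
  (cond_a -> group_isomorphic (alg_aut L) (semidirect (rot3_action K))) /\
  (cond_b ->
     group_isomorphic (alg_aut L) (semidirect (scaling_action (@chi3M K t)))) /\
  (cond_c ->
     group_isomorphic (alg_aut L) (semidirect (scaling_action (@chi2M K)))) /\
  (cond_d -> group_isomorphic (alg_aut L) (semidirect (flip2_action K))) /\
  (cond_e -> group_isomorphic (alg_aut L) (semidirect (inv_action K))) /\
  (~ cond_a -> ~ cond_b -> ~ cond_c -> ~ cond_d -> ~ cond_e ->
     group_isomorphic (alg_aut L) (h_group (f_tilde f r gamma) r s)).
Proof.
move=> L t x0 cond_a cond_b cond_c cond_d cond_e.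
have r_free (k : int) : k != 0 -> r ^ k != 1.
  have rn n : r ^+ n.+1 != 1 by rewrite -unity_rootE r_not_unity.
  case: k => [[|n]|n] //= _; first exact: rn.
  by rewrite NegzE -exprnN invr_eq1 rn.
have r1 : r - 1 != 0 by rewrite subr_eq0; apply: (r_free 1).
have [g gE] := f_conf.
have pL := gdua_presented f s gamma r1; have cf := tilde_conf r1 gE.
have sf := size_tilde f gamma r1; have f0 := tilde_coef0 f r gamma.
(* The default value 0 of tau would give r = 1. *)
have t_gt0 : s ^+ t = r -> (0 < t)%N.
  rewrite lt0n => st; apply/eqP => t0; move: r1.
  by rewrite -st t0 expr0 subrr eqxx.
have unitE (c : K) (c0 : c != 0) : exists x : unit_group K, uval x = c.
  by exists (UnitGroup c0).
split; [|split; [|split; [|split; [|split]]]].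
- move=> [fz sr]; apply: (aut_quantum_space r_neq0 s_neq0 cf pL r_free) => //.
  by rewrite fz /f_tilde comp_poly0.
- move=> [fz st]; have ft0 : f_tilde f r gamma = 0 by rewrite fz /f_tilde comp_poly0.
  (* A given g may be nonzero even for f = 0; the choice 0 makes z equal to [u * d]. *)
  have cf0 : f_tilde f r gamma = s *: 0 - (0 \Po (r *: 'X)).
    by rewrite ft0 comp_poly0 scaler0 subrr.
  apply: (aut_unipotent r_neq0 s_neq0 cf0 pL r_free (t_gt0 st) st _
    (l := fun x => x.1.1) (a := fun x => x.1.2) (b := fun x => x.2)) => //.
  + by rewrite size_poly0.
  + by move=> x; rewrite /chi3 /= uval_expg.
  + by move=> x; rewrite ft0 scaler0.
  + by move=> [[x1 x2] x3] [[y1 y2] y3] /= -> -> ->.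
  move=> l0 a0 b0 /unitE [x xE] /unitE [y yE] /unitE [z zE] _.
  by exists (x, y, z).
(* Only the constant term of g contributes to a constant f, and [aut_unipotent] requires g to be
   constant. *)
- move=> [f1 st]; pose g0 := ((f_tilde g r gamma)`_0)%:P.
  have cf0 : f_tilde f r gamma = s *: g0 - (g0 \Po (r *: 'X)).
    have f00 : (f_tilde f r gamma)`_0 = (s - 1) * (f_tilde g r gamma)`_0.
      by rewrite cf coefB coefZ coef_comp_scale expr0 mulrBl.
    rewrite [LHS]size1_polyC ?sf ?f1 // f00 /g0 comp_polyC -mul_polyC -polyCM -polyCB.
    by congr polyC; ring.
  have ab1 (c : K) : c *: f_tilde f r gamma = f_tilde f r gamma -> c = 1.
    move=> cE; have fz : f_tilde f r gamma != 0 by rewrite -size_poly_eq0 sf f1.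
    move/eqP: cE; rewrite -subr_eq0 -[X in _ - X]scale1r -scalerBl scaler_eq0.
    by rewrite (negPf fz) orbF subr_eq0 => /eqP.
  apply: (aut_unipotent r_neq0 s_neq0 cf0 pL r_free (t_gt0 st) st _
    (l := fun x => x.1) (a := fun x => x.2) (b := fun x => x.2^-1%g)) => //.
  + exact: size_polyC_leq1.
  + by move=> x y; apply: unit_invM.
  + by move=> x; rewrite /chi2 /= mulfV ?uval_neq0 // expr1n mulr1.
  + by move=> x; rewrite /= mulfV ?uval_neq0 // scale1r.
  + by move=> [x1 x2] [y1 y2] /= -> -> _.
  move=> l0 a0 b0 /unitE [x xE] /unitE [y yE] b0n /ab1 ab.
  have a0n : a0 != 0 by rewrite -yE uval_neq0.
  exists (x, y); split=> //=; rewrite yE.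
  by rewrite -[RHS](mulKf a0n) ab mulr1.
- move=> [f2 sr fx]; rewrite fx in f0.
  (* Here a b is unrestricted. The coordinates are (a b, b): exchanging a and b fixes the first and
     sends the second to a, as [flip2] does. *)
  apply: (aut_affine r_neq0 s_neq0 cf pL r_free _ sr
    (a := fun x => (x.2^-1 * x.1)%g) (b := fun x => x.2)) => //.
  + by rewrite sf.
  + by move=> x y; apply: val_inj; rewrite /= invfM; ring.
  + by move=> x; apply: val_inj => /=; field; rewrite !uval_neq0.
  + by move=> x; rewrite f0 mulr0.
  + by move=> [x1 x2] [y1 y2] /= xy e2; rewrite e2 in xy *; rewrite (mulgI _ _ _ xy).
  move=> a0 b0 a0n b0n _; have [x xE] := unitE _ (mulf_neq0 b0n a0n).
  have [y yE] := unitE _ b0n; exists (x, y); split=> //=.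
  by rewrite xE yE mulKf.
- move=> [f2 sr fx].
  (* The nonzero constant term of the shifted polynomial forces a b = 1, and exchanging a and b
     becomes inversion. *)
  apply: (aut_affine r_neq0 s_neq0 cf pL r_free _ sr
    (a := fun x => x^-1%g) (b := fun x => x)) => //.
  + by rewrite sf.
  + exact: unit_invM.
  + by move=> x; rewrite invgK.
  + by move=> x; rewrite /= mulVf ?uval_neq0 // mul1r.
  move=> a0 b0 a0n b0n ab; have [y yE] := unitE _ b0n.
  exists y; split=> //=; rewrite yE.
  have ab1 : a0 * b0 = 1.
    have fn : (f_tilde f r gamma)`_0 != 0 by rewrite f0; apply/eqP.
    by apply: (mulIf fn); rewrite mul1r.
  by rewrite -[RHS](mulfK b0n) ab1 mul1r.
move=> na nb nc nd ne.
have pB := gdua_presented0 (f_tilde f r gamma) r s.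
apply: group_isomorphic_trans (presented_isomorphic pL pB) (h_group_isomorphic _) => phi.
apply/asboolP.
case: (alg_aut_cases r_neq0 s_neq0 cf pB r_free phi) =>
  [[l [a [b [l0 _ _ [hE _ _ _]]]]]|[sf1 [p [a [b [_ _ _ [j j0 sj] _]]]]]|[sf2 sr _]|[ft0 sr _]].
- by exists l.
- have st : s ^+ t = r by rewrite /t (tau_eq r_free r_neq0 j0 sj).
  move: sf1; rewrite sf leq_eqVlt ltnS leqn0 => /orP[/eqP f1|].
    by case: nc.
  by rewrite size_poly_eq0 => /eqP fz; case: nb.
- rewrite sf in sf2; case: (pselect (f.[x0] = 0)) => fx; first by case: nd.
  by case: ne.
case: na; split=> //; apply/eqP; rewrite -size_poly_eq0 -sf ft0.
by rewrite size_poly0.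
Qed.
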